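(* Let $A:\mathbb R^d\to\mathbb R^d$ be a $C^3$ orientation-preserving diffeomorphism, $M(x):=DA(x)^{-1}$, let $\pi_A$ be the Gaussian-conjugate target and $K_A^{(2)}(x,x')=\big(1+A(x)^\top A(x')\big)M(x)M(x')^\top$. Let $X_i^N(0)$, $1\le i\le N$, be i.i.d. with law $\mu_0$ (generic copy $X(0)$). Assume that $$\mathbb E\exp\{\alpha\|A(X(0))\|^2\}<\infty,\qquad\mathrm{Cov}(A(X(0)))\ge c_0I_d$$ for some $\alpha>0$, $c_0>0$. Then the matrix-SVGD flow for $(\pi_A,K_A^{(2)})$, with $\mu_t$ the mean-field solution started from $\mu_0$ and $\mu_t^N$ the empirical measure of the $N$-particle system started from $(X_i^N(0))_i$, satisfies $$\mathbb E\Big[\sup_{t\ge0}d_{A,2}^2(\mu_t^N,\mu_t)\Big]\le CN^{-1},$$ where $C=C(d,c_0,\alpha,\mathbb Ee^{\alpha\|A(X(0))\|^2})<\infty$ and $$d_{A,2}(\rho,\nu):=\Big(\|\rho A-\nu A\|^2+\|\rho(AA^\top)-\nu(AA^\top)\|_F^2\Big)^{1/2},$$ with $\rho A=\int A\,d\rho$ and $\rho(AA^\top)=\int A(x)A(x)^\top\rho(dx)$.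
   Context: **Matrix-kernel SVGD.** For $\pi\propto e^{-V}$ on $\mathbb R^d$ and a positive-definite matrix kernel $K:\mathbb R^d\times\mathbb R^d\to\mathbb R^{d\times d}$, set $v_\rho(x):=\int\{-K(x,y)\nabla V(y)+\mathrm{div}_yK(x,y)\}\rho(dy)$, with $[\mathrm{div}_yK(x,y)]_a:=\sum_b\partial_{y_b}K_{ab}(x,y)$. The mean-field flow is the weak solution of $\partial_t\mu_t+\nabla\cdot(v_{\mu_t}\mu_t)=0$ with initial law $\mu_0$; the $N$-particle system is $\dot X_i^N(t)=v_{\mu_t^N}(X_i^N(t))$, $\mu_t^N=\frac1N\sum_i\delta_{X_i^N(t)}$. Well-posedness of these flows is transferred from the Gaussian base system through the diffeomorphism $A$. **Gaussian-conjugate target.** $\pi_A(dx)=(2\pi)^{-d/2}e^{-V_A(x)}dx$ with $V_A(x)=-\log\det DA(x)+\frac12\|A(x)\|^2$; equivalently $A_\#\pi_A$ is the standard Gaussian $\gamma_d$ on $\mathbb R^d$. $\|\cdot\|_F$ is the Frobenius norm; $\ge$ between symmetric matrices is the Loewner order. *)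

(* Defs.v *)
From HB Require Import structures.
From mathcomp Require Import all_boot all_order all_algebra.
From mathcomp Require Import all_classical all_reals all_analysis.

Set Implicit Arguments.
Unset Strict Implicit.
Unset Printing Implicit Defensive.

Import Order.TTheory GRing.Theory Num.Theory.
Import numFieldNormedType.Exports.

Local Open Scope classical_set_scope.
Local Open Scope ring_scope.

(* Points of R^d are row vectors 'rV[R]_d.  The library norm `|_| on matrices
   is the sup norm; the Euclidean and Frobenius norms are [l2norm] below. *)

(* Borel sigma-algebra on matrices. *)
Section matrix_borel.
Variables (R : realType) (m n : nat).
Let G : set (set 'M[R]_(m, n)) := [set U | open U].
HB.instance Definition _ := @isMeasurable.Build (sigma_display G)
  'M[R]_(m, n) <<s G >> (@sigma_algebra0 _ setT G) (@sigma_algebraC _ G)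
  (@sigma_algebra_bigcup _ setT G).
End matrix_borel.

Section linear_algebra.
Variable R : realType.

(* Frobenius norm; on row vectors it is the Euclidean norm. *)
Definition l2norm m n (B : 'M[R]_(m, n)) : R :=
  Num.sqrt (\sum_i \sum_j B i j ^+ 2).

Definition dot d (u v : 'rV[R]_d) : R := \sum_i u 0 i * v 0 i.

Definition loewner_le d (B C : 'M[R]_d) : Prop :=
  forall u : 'rV[R]_d, 0 <= dot (u *m (C - B)) u.

End linear_algebra.

Section calculus.
Variables (R : realType) (d : nat).

Definition partial (W : normedModType R) (i : 'I_d) (f : 'rV[R]_d -> W) :
  'rV[R]_d -> W := fun x => 'D_(delta_mx 0 i) f x.

Fixpoint Ck (W : normedModType R) (k : nat) (f : 'rV[R]_d -> W) : Prop :=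
  if k is k'.+1 then
    (forall x, differentiable f x) /\ (forall i, Ck k' (partial i f))
  else continuous f.

Definition compact_support (phi : 'rV[R]_d -> R) : Prop :=
  compact (closure [set x | phi x != 0]).

Definition grad (f : 'rV[R]_d -> R) (x : 'rV[R]_d) : 'rV[R]_d :=
  \row_i partial i f x.

(* The library's [jacobian] acts on row vectors from the right, hence the
   transpose: (DA x) i j is the j-th partial derivative of the i-th component
   of A. *)
Definition DA (A : 'rV[R]_d -> 'rV[R]_d) (x : 'rV[R]_d) : 'M[R]_d :=
  (jacobian A x)^T.

Definition Ck_diffeomorphism (k : nat) (A : 'rV[R]_d -> 'rV[R]_d) : Prop :=
  Ck k A /\ exists B, [/\ cancel A B, cancel B A & Ck k B].

Definition orientation_preserving (A : 'rV[R]_d -> 'rV[R]_d) : Prop :=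
  forall x, 0 < \det (DA A x).

End calculus.

Section empirical_measure.
Context disp (T : measurableType disp) (R : realType) (N : nat).
Variable x : 'I_N -> T.

Definition empirical (S : set T) : \bar R :=
  ((N%:R^-1)%:E * \sum_(i < N) \d_(x i) S)%E.

Let empirical0 : empirical set0 = 0%E.
Proof. by rewrite /empirical big1 ?mule0// => i _; rewrite measure0. Qed.

Let empirical_ge0 S : (0 <= empirical S)%E.
Proof.
by apply: mule_ge0; [rewrite lee_fin invr_ge0 | apply: sume_ge0 => i _; exact: measure_ge0].
Qed.

Let empirical_sigma_additive : semi_sigma_additive empirical.
Proof.
move=> F mF tF mUF; apply: cvg_toP.
  by apply: is_cvg_ereal_nneg_natsum_cond => n _ _; exact: empirical_ge0.
rewrite /empirical nneseriesZl; last by move=> k _; apply: sume_ge0 => ? _; exact: measure_ge0.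
congr (_ * _)%E; rewrite nneseries_sum//.
by apply: eq_bigr => i _; rewrite measure_semi_bigcup.
Qed.

HB.instance Definition _ := isMeasure.Build _ _ _ empirical
  empirical0 empirical_ge0 empirical_sigma_additive.

End empirical_measure.

Section probability.
Context disp disp' (Omega : measurableType disp) (T : measurableType disp').
Variable R : realType.

Definition mutually_independent (P : probability Omega R) (N : nat)
    (X : 'I_N -> Omega -> T) : Prop :=
  forall (J : {set 'I_N}) (S : 'I_N -> set T), (forall i, measurable (S i)) ->
    P (\bigcap_(i in [set` J]) (X i @^-1` S i)) =
    (\prod_(i in J) P (X i @^-1` S i))%E.

Definition has_law (P : probability Omega R) (X : Omega -> T)
    (mu : probability T R) : Prop :=
  forall S, measurable S -> pushforward P X S = mu S.

Definition iid (P : probability Omega R) (N : nat) (X : 'I_N -> Omega -> T)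
    (mu : probability T R) : Prop :=
  [/\ forall i, measurable_fun setT (X i), mutually_independent P X &
      forall i, has_law P (X i) mu].

Definition covmx (P : probability Omega R) d (Y : Omega -> 'rV[R]_d) :
  'M[R]_d :=
  \matrix_(i, j)
    fine (covariance P (fun w => Y w 0 i) (fun w => Y w 0 j)).

End probability.

Section matrix_svgd.
Variables (R : realType) (d : nat).
Local Notation E := 'rV[R]_d.
Implicit Types (V : E -> R) (K : E -> E -> 'M[R]_d).

(* V is a potential of the law with (Lebesgue) density p, i.e. p is
   proportional to exp(-V). *)
Definition potential_of (p V : E -> R) : Prop :=
  exists Z : R, 0 < Z /\ forall x, p x = expR (- V x) / Z.

(* div_y K(x, y), the a-th entry being the sum of the d_{y_b} K_{ab}(x, y). *)
Definition div2 K (x y : E) : E :=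
  \row_a \sum_b partial b (fun z => K x z a b) y.

(* - K(x, y) (grad V)(y) + div_y K(x, y), as a row vector. *)
Definition svgd_integrand V K (x y : E) : E :=
  - (grad V y *m (K x y)^T) + div2 K x y.

Definition svgd_velocity V K (rho : {measure set E -> \bar R}) (x : E) : E :=
  \row_a \int[rho]_y (svgd_integrand V K x y 0 a).

(* Weak solutions, indexed by t >= 0 (values at t < 0 are irrelevant), of
     d_t mu_t + div (v_{mu_t} mu_t) = 0,
   in time-integrated form against C^1 compactly supported test functions.
   The first two conditions after the initial one make v_{mu_t}(x) well
   defined, with an integral locally bounded in time; the next two make the
   integrals of the weak formulation well defined. *)
Record mean_field_flow V K (mu0 : probability E R)
    (mu : R -> probability E R) : Prop := MeanFieldFlow {
  mff_init : forall S, measurable S -> mu 0 S = mu0 S;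
  mff_integrable : forall x t a, 0 <= t ->
    (mu t).-integrable setT (fun y => (svgd_integrand V K x y 0 a)%:E);
  mff_locally_bounded : forall x T, exists M : R, forall t, 0 <= t <= T ->
    (\int[mu t]_y (l2norm (svgd_integrand V K x y))%:E <= M%:E)%E;
  mff_space_integrable : forall phi, Ck 1 phi -> compact_support phi ->
    forall t, 0 <= t ->
    (mu t).-integrable setT
      (fun x => (dot (grad phi x) (svgd_velocity V K (mu t) x))%:E);
  mff_time_integrable : forall phi, Ck 1 phi -> compact_support phi ->
    forall t, 0 <= t ->
    (@lebesgue_measure R).-integrable `[0, t]
      (fun s => (\int[mu s]_x
         dot (grad phi x) (svgd_velocity V K (mu s) x))%:E);
  mff_weak : forall phi, Ck 1 phi -> compact_support phi ->
    forall t, 0 <= t ->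
    \int[mu t]_x phi x = \int[mu 0]_x phi x +
      \int[@lebesgue_measure R]_(s in `[0, t])
        (\int[mu s]_x dot (grad phi x) (svgd_velocity V K (mu s) x))
}.

Definition particle_flow V K (N : nat) (x : 'I_N -> R -> E) : Prop :=
  forall i, {within `[0, +oo[, continuous (x i)} /\
    forall t : R, 0 < t ->
      is_derive t 1 (x i)
        (svgd_velocity V K (empirical R (fun j => x j t)) (x i t)).

End matrix_svgd.

Section gaussian_conjugate.
Variables (R : realType) (d : nat) (A : 'rV[R]_d -> 'rV[R]_d).
Local Notation E := 'rV[R]_d.

Definition VA (x : E) : R := - ln (\det (DA A x)) + l2norm (A x) ^+ 2 / 2.

(* Density of pi_A with respect to the Lebesgue measure of R^d. *)
Definition piA_density (x : E) : R :=
  (2 * pi) `^ (- (d%:R / 2)) * expR (- VA x).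

Definition KA2 (x y : E) : 'M[R]_d :=
  (1 + dot (A x) (A y)) *: (invmx (DA A x) *m (invmx (DA A y))^T).

Definition mean_mx (rho : {measure set E -> \bar R}) : E :=
  \row_i \int[rho]_x (A x 0 i).

Definition second_moment_mx (rho : {measure set E -> \bar R}) : 'M[R]_d :=
  \matrix_(i, j) \int[rho]_x (A x 0 i * A x 0 j).

Definition dA2 (rho nu : {measure set E -> \bar R}) : R :=
  Num.sqrt (l2norm (mean_mx rho - mean_mx nu) ^+ 2
    + l2norm (second_moment_mx rho - second_moment_mx nu) ^+ 2).

End gaussian_conjugate.

(* Main.v *)
(** In the coordinates [Y = A X] the velocity field becomes [(1 - S) Y - m], with
    [m] and [S] the mean and the second moment of [Y].  Hence the moments of the
    mean-field law and of the empirical measure solve one closed system,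
      [m' = - S m],  [S' = 2 S - 2 S^2 - 2 m m^T],
    and [d_{A,2}] is the distance between two of its solutions.

    Let [Sigma = S - m m^T] and [P = Sigma^-1].  The quantity [s = m^T P m] satisfies
    [s' = - 2 s], and therefore [\tr P] stays bounded; it follows that
    [|m| <= K exp (- t)] and [S >= 1 - K exp (- t)], with [K] depending only on
    [d], a lower bound of [Sigma 0] and an upper bound of [\tr (S 0)].  The squared
    distance [D] of two solutions then satisfies [D' <= K' exp (- t) D], and
    [D t <= L * D 0] for all [t >= 0].  As [D 0] is a sum of squares of centred
    empirical means, its expectation is at most [C / N].

    The moment system of the mean-field law comes from the test functions
    [z z' cutoff (|A|^2 / n)], where [z] and [z'] are [1] or coordinates of [A]. *)

Require Import Defs.
From HB Require Import structures.
From mathcomp Require Import all_boot all_order all_algebra.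
From mathcomp Require Import all_classical all_reals all_analysis.
From mathcomp Require Import measurable_realfun perm ring lra.

Import Order.TTheory GRing.Theory Num.Theory.
Import numFieldNormedType.Exports.

Local Open Scope classical_set_scope.
Local Open Scope ring_scope.

Set Implicit Arguments.
Unset Strict Implicit.
Unset Printing Implicit Defensive.


(** * Derivatives of matrix-valued functions *)


(** Gronwall with a constant rate would lose a factor exponential in time. Uniformity in time rests
    on the integrability of the rate [K' exp (- t)]: the growth term [2 S] is compensated by the
    quadratic term as soon as [S >= 1 - K exp (- t)]. Such a lower bound is hard to read off the
    equation of [S]. The inverse covariance is the convenient unknown, as it solves
    [P' = 2 (1 - P) + m m^T P + P m m^T], a relaxation to the identity whose perturbation is
    controlled by [s]. Then [Sigma >= 2 - P], because [P - 2 + Sigma] is nonnegative.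

    Three obstacles shape the rest. The empirical covariance may be singular (always when [N <= d]),
    so a lower bound at time 0 is available for the mean-field law only, and stability has to be
    asymmetric in the two flows. A weak solution carries neither explicit moment bounds nor
    regularity in time: moments are extracted from the integrability of the velocity field, and
    differentiability is gained by bootstrapping an integral equation. The supremum over all times
    is not known to be measurable, so its expectation is bounded through the domination by
    [L * D 0]. *)

Section derivative_rules.
Context {R : realFieldType} {V : normedModType R}.
Implicit Types (f g : V -> R) (x v : V).

Lemma is_derive_add f g x v df dg : is_derive x v f df -> is_derive x v g dg ->
  is_derive x v (fun z => f z + g z) (df + dg).
Proof. exact: is_deriveD. Qed.

Lemma is_derive_opp f x v df : is_derive x v f df ->
  is_derive x v (fun z => - f z) (- df).
Proof. exact: is_deriveN. Qed.

Lemma is_derive_sub f g x v df dg : is_derive x v f df -> is_derive x v g dg ->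
  is_derive x v (fun z => f z - g z) (df - dg).
Proof. exact: is_deriveB. Qed.

Lemma is_derive_mul f g x v df dg : is_derive x v f df -> is_derive x v g dg ->
  is_derive x v (fun z => f z * g z) (df * g x + f x * dg).
Proof.
move=> hf hg; apply: (@is_derive_eq _ _ _ _ _ _ _ _ (is_deriveM hf hg)).
by rewrite addrC; congr (_ + _); rewrite /GRing.scale/= mulrC.
Qed.

Lemma is_derive_scale (k : R) f x v df : is_derive x v f df ->
  is_derive x v (fun z => k * f z) (k * df).
Proof. exact: is_deriveZ. Qed.

Lemma is_derive_inv f x v df : f x != 0 -> is_derive x v f df ->
  is_derive x v (fun z => (f z)^-1) (- (f x) ^- 2 * df).
Proof.
move=> fx0 [df1 <-]; apply: DeriveDef; first exact: derivableV.
by rewrite deriveV.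
Qed.

Lemma is_derive_bigsum (I : Type) (r : seq I) (P : pred I) (f : I -> V -> R)
    x v (df : I -> R) : (forall i, P i -> is_derive x v (f i) (df i)) ->
  is_derive x v (fun z => \sum_(i <- r | P i) f i z) (\sum_(i <- r | P i) df i).
Proof.
move=> h; elim: r => [|i r IH].
  rewrite big_nil (_ : (fun _ => _) = cst 0); first exact: is_derive_cst.
  by apply/funext => z; rewrite big_nil.
have -> : (fun z => \sum_(j <- i :: r | P j) f j z) =
    (fun z => (if P i then f i z else 0) + \sum_(j <- r | P j) f j z).
  by apply/funext => z; rewrite big_cons; case: ifP => // _; rewrite add0r.
rewrite big_cons; case: ifP => Pi; first exact: is_derive_add (h _ Pi) IH.
by under eq_fun do rewrite add0r.
Qed.

Lemma is_derive_bigprod (I : eqType) (r : seq I) (f : I -> V -> R)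
    x v (df : I -> R) : uniq r -> (forall i, is_derive x v (f i) (df i)) ->
  is_derive x v (fun z => \prod_(i <- r) f i z)
    (\sum_(i <- r) \prod_(j <- r) (if j == i then df j else f j x)).
Proof.
move=> + h; elim: r => [_|i r IH /= /andP[ir ur]].
  rewrite big_nil (_ : (fun _ => _) = cst 1); first exact: is_derive_cst.
  by apply/funext => z; rewrite big_nil.
under eq_fun do rewrite big_cons.
apply: is_derive_eq; first exact: is_derive_mul (h i) (IH ur).
rewrite big_cons big_cons eqxx; congr (_ * _ + _).
  by apply: eq_big_seq => j jr; case: eqP jr ir => // -> ->.
rewrite big_distrr/=; apply: eq_big_seq => j jr; rewrite big_cons.
by case: eqP jr ir => // -> ->.
Qed.

(** Jacobi's formula. The product rule in the permutation expansion differentiates one row at a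
    time; each resulting determinant is expanded along that row, whose cofactors are those of
    [F x]. *)
Lemma is_derive_det n (F : V -> 'M[R]_n) (dF : 'M[R]_n) x v :
  (forall i j, is_derive x v (fun z => F z i j) (dF i j)) ->
  is_derive x v (fun z => \det (F z)) (\tr (\adj (F x) *m dF)).
Proof.
move=> h; rewrite /determinant.
have hs (s : 'S_n) : is_derive x v (fun z => (-1) ^+ s * \prod_i F z i (s i))
    ((-1) ^+ s * \sum_i \prod_j (if j == i then dF j (s j) else F x j (s j))).
  apply: is_derive_scale.
  by apply: (is_derive_bigprod (index_enum_uniq _) (f:=fun i z => F z i (s i)) (df:=fun i =>
    dF i (s i))).
apply: is_derive_eq; first by apply: is_derive_bigsum => s _; exact: hs.
under eq_bigr do rewrite big_distrr/=.
rewrite exchange_big/= mxtrace_mulC /mxtrace; apply: eq_bigr => i _; rewrite mxE.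
pose G := \matrix_(k, j) if k == i then dF k j else F x k j.
transitivity (\det G).
  by apply: eq_bigr => s _; congr (_ * _); apply: eq_bigr => j _; rewrite mxE.
rewrite (expand_det_row _ i); apply: eq_bigr => j _; rewrite !mxE eqxx.
congr (_ * (_ * \det _)); apply/matrixP => k l; rewrite !mxE.
by rewrite eq_sym (negPf (neq_lift _ _)).
Qed.

(** Entries of the adjugate are signed minors, so [is_derive_det] applies to each. Existence is
    enough here: [is_derive_detadj] recovers the value from the product of [\adj F] and [F]. *)
Lemma is_derive_adj n (F : V -> 'M[R]_n) (dF : 'M[R]_n) x v :
  (forall i j, is_derive x v (fun z => F z i j) (dF i j)) ->
  exists dA : 'M[R]_n,
    forall i j, is_derive x v (fun z => \adj (F z) i j) (dA i j).
Proof.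
move=> h.
exists (\matrix_(i, j) ((-1) ^+ (j + i) *
   \tr (\adj (row' j (col' i (F x))) *m row' j (col' i dF)))) => i j.
rewrite mxE; under eq_fun do rewrite mxE.
apply: is_derive_scale; apply: (@is_derive_det n.-1 (fun z => row' j (col' i (F z)))) => k l.
by rewrite !mxE; under eq_fun do rewrite !mxE; exact: h.
Qed.

Lemma is_derive_mulmx m n p (F : V -> 'M[R]_(m, n)) (G : V -> 'M[R]_(n, p))
    (dF : 'M[R]_(m, n)) (dG : 'M[R]_(n, p)) x v :
  (forall i j, is_derive x v (fun z => F z i j) (dF i j)) ->
  (forall i j, is_derive x v (fun z => G z i j) (dG i j)) ->
  forall i j, is_derive x v (fun z => (F z *m G z) i j) ((dF *m G x + F x *m dG) i j).
Proof.
move=> hF hG i j; under eq_fun do rewrite mxE.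
rewrite !mxE -big_split/=; apply: is_derive_bigsum => k _.
exact: is_derive_mul.
Qed.

(* Equal to [invmx] on invertible matrices, but a rational expression throughout,
   so that the rules of calculus apply to it directly. *)
Definition detadj n (A : 'M[R]_n) : 'M[R]_n := (\det A)^-1 *: \adj A.

Lemma detadj_inv n (A : 'M[R]_n) : A \in unitmx -> detadj A = invmx A.
Proof. by rewrite /invmx /detadj => ->. Qed.

Lemma is_derive_detadj n (F : V -> 'M[R]_n) (dF : 'M[R]_n) x v :
  \det (F x) != 0 ->
  (forall i j, is_derive x v (fun z => F z i j) (dF i j)) ->
  forall i j, is_derive x v (fun z => detadj (F z) i j)
    ((- (invmx (F x) *m dF *m invmx (F x))) i j).
Proof.
move=> d0 h i j.
have uF : F x \in unitmx by rewrite unitmxE unitfE.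
have [dA hA] := is_derive_adj h.
have hdet := is_derive_det h.
set t := \tr _ in hdet.
(* Both sides of [\adj (F z) *m F z = (\det (F z))%:M] are differentiated; uniqueness of the
   derivative then determines [dA]. *)
have e1 : dA *m F x + \adj (F x) *m dF = t%:M.
  apply/matrixP => k l.
  have h1 := is_derive_mulmx hA h k l.
  have : (fun z => (\adj (F z) *m F z) k l) = (fun z => (k == l)%:R * \det (F z)).
    by apply/funext => z; rewrite mul_adj_mx mxE mulr_natl.
  move=> ee; rewrite ee in h1.
  have h2 := is_derive_scale (k == l)%:R hdet.
  by move: (@derive_val _ _ _ _ _ _ _ h1); rewrite (@derive_val _ _ _ _ _ _ _ h2) => <-;
    rewrite mxE mulr_natl.
have e2 : dA = t *: invmx (F x) - \adj (F x) *m dF *m invmx (F x).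
  have : (dA *m F x + \adj (F x) *m dF) *m invmx (F x) = t%:M *m invmx (F x) by rewrite e1.
  rewrite mulmxDl mulmxK// mul_scalar_mx => <-; by rewrite addrK.
have -> : (fun z => detadj (F z) i j) =
    (fun z => (\det (F z))^-1 * \adj (F z) i j).
  by apply/funext => z; rewrite /detadj mxE.
apply: is_derive_eq; first exact: is_derive_mul (is_derive_inv d0 hdet) (hA i j).
have ei : invmx (F x) = (\det (F x))^-1 *: \adj (F x) by rewrite /invmx uF.
have eW : \adj (F x) *m dF *m invmx (F x) =
    \det (F x) *: (invmx (F x) *m dF *m invmx (F x)).
  by rewrite {2}ei -!scalemxAl scalerA mulfV// scale1r.
rewrite /= e2 eW; move: (_ *m invmx (F x)) => W; rewrite ei.
move: (\adj (F x)) => M; rewrite !mxE; field; exact: d0.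
Qed.

End derivative_rules.

(** * Differential equations on the half-line *)

Section halfline.
Context {R : realType}.
Implicit Types (f g : R -> R) (t : R).

Definition hcont f := {within `[0, +oo[, continuous f}.

Lemma hcont_cst (c : R) : hcont (fun=> c).
Proof. by move=> x; exact: cvg_cst. Qed.

Lemma hcont_add f g : hcont f -> hcont g -> hcont (fun t => f t + g t).
Proof. by move=> hf hg x; apply: continuousD; [exact: hf|exact: hg]. Qed.

Lemma hcont_mul f g : hcont f -> hcont g -> hcont (fun t => f t * g t).
Proof. by move=> hf hg x; apply: continuousM; [exact: hf|exact: hg]. Qed.

Lemma hcont_bigsum (I : Type) (r : seq I) (P : pred I) (F : I -> R -> R) :
  (forall i, hcont (F i)) -> hcont (fun t => \sum_(i <- r | P i) F i t).
Proof.
move=> h; elim: r => [|i r IH].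
  by under eq_fun do rewrite big_nil; exact: hcont_cst.
under eq_fun do rewrite big_cons; case: (P i) => //; exact: hcont_add.
Qed.

Lemma hcont_bigprod (I : Type) (r : seq I) (P : pred I) (F : I -> R -> R) :
  (forall i, hcont (F i)) -> hcont (fun t => \prod_(i <- r | P i) F i t).
Proof.
move=> h; elim: r => [|i r IH].
  by under eq_fun do rewrite big_nil; exact: hcont_cst.
under eq_fun do rewrite big_cons; case: (P i) => //; exact: hcont_mul.
Qed.

Lemma hcont_inv f : (forall t, 0 <= t -> f t != 0) -> hcont f ->
  hcont (fun t => (f t)^-1).
Proof.
move=> f0 hf; apply: (@subspace_continuousP _ _ _ _).2 => x /= x0.
apply: cvgV; first by apply: f0; move: x0; rewrite in_itv/= andbT.
exact: ((@subspace_continuousP _ _ _ _).1 hf).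
Qed.

Lemma hcont_det n (F : R -> 'M[R]_n) : (forall i j, hcont (fun t => F t i j)) ->
  hcont (fun t => \det (F t)).
Proof.
move=> h; apply: hcont_bigsum => s; apply: hcont_mul; first exact: hcont_cst.
by apply: hcont_bigprod => i; exact: h.
Qed.

Lemma hcont_detadj n (F : R -> 'M[R]_n) :
  (forall t, 0 <= t -> \det (F t) != 0) ->
  (forall i j, hcont (fun t => F t i j)) ->
  forall i j, hcont (fun t => detadj (F t) i j).
Proof.
move=> d0 h i j; under eq_fun do rewrite mxE.
apply: hcont_mul; first by apply: hcont_inv => //; exact: hcont_det.
under eq_fun do rewrite mxE; apply: hcont_mul; first exact: hcont_cst.
by apply: hcont_det => k l; under eq_fun do rewrite !mxE; exact: h.
Qed.

(** Same shape as [particle_flow]: continuity up to time 0 and a derivative at positive times, which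
    is what monotonicity arguments on the half-line require. *)
Definition evolves f g := hcont f /\ forall t, 0 < t -> is_derive t 1 f (g t).

Lemma evolves_eq f g h : (forall t, 0 < t -> g t = h t) ->
  evolves f g -> evolves f h.
Proof. by move=> gh [cf df]; split=> // t t0; rewrite -gh//; exact: df. Qed.

Lemma evolves_cst (c : R) : evolves (fun=> c) (fun=> 0).
Proof. by split=> [|t _]; [exact: hcont_cst|exact: is_derive_cst]. Qed.

Lemma evolves_add f g df dg : evolves f df -> evolves g dg ->
  evolves (fun t => f t + g t) (fun t => df t + dg t).
Proof.
move=> [cf Df] [cg Dg]; split=> [|t t0]; first exact: hcont_add.
by apply: is_derive_add; [exact: Df|exact: Dg].
Qed.

Lemma evolves_mul f g df dg : evolves f df -> evolves g dg ->
  evolves (fun t => f t * g t) (fun t => df t * g t + f t * dg t).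
Proof.
move=> [cf Df] [cg Dg]; split=> [|t t0]; first exact: hcont_mul.
by apply: is_derive_mul; [exact: Df|exact: Dg].
Qed.

Lemma evolves_scale (c : R) f df : evolves f df ->
  evolves (fun t => c * f t) (fun t => c * df t).
Proof.
move=> /(evolves_mul (evolves_cst c)); apply: evolves_eq => t _.
by rewrite mul0r add0r.
Qed.

Lemma evolves_sub f g df dg : evolves f df -> evolves g dg ->
  evolves (fun t => f t - g t) (fun t => df t - dg t).
Proof.
move=> hf /(evolves_scale (-1)) /(evolves_add hf).
under eq_fun do rewrite mulN1r.
by apply: evolves_eq => t _; rewrite mulN1r.
Qed.

Lemma evolves_bigsum (I : Type) (r : seq I) (P : pred I) (F dF : I -> R -> R) :
  (forall i, evolves (F i) (dF i)) ->
  evolves (fun t => \sum_(i <- r | P i) F i t) (fun t => \sum_(i <- r | P i) dF i t).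
Proof.
move=> h; split=> [|t t0]; first by apply: hcont_bigsum => i; exact: (h i).1.
by apply: is_derive_bigsum => i _; exact: (h i).2.
Qed.

Lemma evolves_expR (c : R) :
  evolves (fun t => expR (c * t)) (fun t => c * expR (c * t)).
Proof.
split=> [|t _].
  apply: continuous_subspaceT => t.
  apply: continuous_comp; last exact: continuous_expR.
  exact: mulrl_continuous.
rewrite mulrC.
apply: (@is_derive1_comp _ expR ( *%R c)).
by rewrite -[X in is_derive _ _ _ X]mulr1; exact: is_derive_scale.
Qed.

Lemma evolves_nonincr f g : evolves f g -> (forall t, 0 < t -> g t <= 0) ->
  forall t, 0 <= t -> f t <= f 0.
Proof.
move=> [cf df] g0 t t0; apply: (@ler0_derive1_nincry _ f 0) => // x.
  by rewrite in_itv/= andbT => x0; have [] := df x x0.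
rewrite in_itv/= andbT => x0; rewrite derive1E; have dfx := df x x0.
by rewrite derive_val; exact: g0.
Qed.

Lemma evolves_const f g : evolves f g -> (forall t, 0 < t -> g t = 0) ->
  forall t, 0 <= t -> f t = f 0.
Proof.
move=> h g0 t t0; apply/eqP; rewrite eq_le; apply/andP; split.
  by apply: (evolves_nonincr h) => // s /g0 ->.
have := evolves_nonincr (evolves_scale (-1) h) _ t0.
by rewrite !mulN1r lerN2; apply => s /g0 ->; rewrite mulr0.
Qed.

(** From [1 + t <= exp t]. It absorbs the factor [t] that appears when a forcing term decays at the
    same rate as the homogeneous solution. *)
Lemma expR_mulN_le1 (t : R) : 0 <= t -> t * expR (- t) <= 1.
Proof.
move=> t0; rewrite expRN ler_pdivrMr ?expR_gt0// mul1r.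
by rewrite (le_trans _ (expR_ge1Dx t))// lerDr.
Qed.

End halfline.

(** * Positive semidefinite forms *)

Section bilinear_forms.
Context {R : realType} {d : nat}.
Implicit Types (B S : 'M[R]_d) (u v w : 'rV[R]_d).

Definition bf B u v : R := (u *m B *m v^T) 0 0.

Lemma dotE u v : dot u v = (u *m v^T) 0 0.
Proof. by rewrite mxE; apply: eq_bigr => i _; rewrite mxE. Qed.

Lemma dot_mulmx B u v : dot (u *m B) v = bf B u v.
Proof. by rewrite dotE. Qed.

Lemma dot_ge0 u : 0 <= dot u u.
Proof. by apply: sumr_ge0 => i _; rewrite -expr2 sqr_ge0. Qed.

Lemma dotC u v : dot u v = dot v u.
Proof. by apply: eq_bigr => i _; rewrite mulrC. Qed.

Lemma dot_delta u i : dot u (delta_mx 0 i) = u 0 i.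
Proof.
rewrite /dot (bigD1 i)//= big1 ?addr0 => [|j ji]; first by rewrite mxE !eqxx mulr1.
by rewrite mxE (negPf ji) andbF mulr0.
Qed.

Lemma bf_sym B u v : B^T = B -> bf B u v = bf B v u.
Proof.
move=> sB; have e : (v *m B *m u^T)^T = u *m B *m v^T.
  by rewrite !trmx_mul trmxK sB mulmxA.
by rewrite /bf -e [LHS]mxE.
Qed.

Lemma bfDl B u v w : bf B (u + v) w = bf B u w + bf B v w.
Proof. by rewrite /bf !mulmxDl mxE. Qed.

Lemma bfDr B u v w : bf B w (u + v) = bf B w u + bf B w v.
Proof. by rewrite /bf linearD/= mulmxDr mxE. Qed.

Lemma bfZl B k u w : bf B (k *: u) w = k * bf B u w.
Proof. by rewrite /bf -!scalemxAl mxE. Qed.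

Lemma bfZr B k u w : bf B w (k *: u) = k * bf B w u.
Proof. by rewrite /bf linearZ/= -scalemxAr mxE. Qed.

Lemma bf_add B S u v : bf (B + S) u v = bf B u v + bf S u v.
Proof. by rewrite /bf mulmxDr mulmxDl mxE. Qed.

Lemma bf_opp B u v : bf (- B) u v = - bf B u v.
Proof. by rewrite /bf mulmxN mulNmx mxE. Qed.

Lemma bf_scale k B u v : bf (k *: B) u v = k * bf B u v.
Proof. by rewrite /bf -scalemxAr -scalemxAl mxE. Qed.

Lemma bf_rank1 u v w z : bf (u^T *m v) w z = dot w u * dot v z.
Proof.
rewrite /bf mulmxA -mulmxA !dotE [_ *m z^T]mx11_scalar.
by rewrite [_ *m u^T]mx11_scalar -scalar_mxM !mxE eqxx !mulr1n.
Qed.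

Lemma bf_delta B i j : bf B (delta_mx 0 i) (delta_mx 0 j) = B i j.
Proof. by rewrite /bf -rowE -dotE dot_delta mxE. Qed.

Lemma bfE B u v : bf B u v = \sum_i \sum_j u 0 i * B i j * v 0 j.
Proof.
rewrite /bf mxE exchange_big; apply: eq_bigr => j _.
by rewrite !mxE mulr_suml.
Qed.

Definition psd B := forall u, 0 <= bf B u u.

(** For [0 < a] the minimiser [k = - b / a] gives the claim; [a < 0] is contradictory, and [a = 0]
    forces [b = 0]. *)
Lemma discr_le0 (a b c : R) : (forall k, 0 <= a * k ^+ 2 + 2 * b * k + c) ->
  b ^+ 2 <= a * c.
Proof.
move=> h; have [a0|a0|a0] := ltgtP a 0.
- have h1 := h (- b / a); have an0 : a != 0 by rewrite lt_eqF.
  have h0 := h 0; have h2 := h ((1 + c - 2 * b)/ - a); have h3 := h (- ((1 + c - 2 * b)/ - a)).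
  (* With [z = c / - a >= 0] and [k = 1 + z], the value is [a (1 + z + z^2) < 0]. Adding the
     hypothesis at [k] and at [- k] removes the linear term and contradicts this. *)
  have [k kP] : exists k : R, a * k ^+ 2 + c < 0.
    exists (1 + (c / - a)); have : 0 <= c / - a.
      by rewrite divr_ge0 ?oppr_ge0 ?(ltW a0)//; move: h0; rewrite expr2; lra.
    set z := c / - a => z0; have -> : c = - a * z by rewrite /z mulrC divfK ?oppr_eq0.
    nra.
  have := h k; have := h (- k); rewrite sqrrN; nra.
- have h1 := h (- b / a); have an0 : a != 0 by rewrite gt_eqF.
  have : a * (- b / a) ^+ 2 + 2 * b * (- b / a) + c = (a * c - b ^+ 2) / a by field.
  by move=> e; move: h1; rewrite e pmulr_lge0 ?invr_gt0// subr_ge0.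
- rewrite a0 mul0r; have [->|b0] := eqVneq b 0; first by rewrite expr0n.
  have := h (- (c + 1) / (2 * b)).
  have -> : a * (- (c + 1) / (2 * b)) ^+ 2 + 2 * b * (- (c + 1) / (2 * b)) + c = -1.
    by rewrite a0; field.
  lra.
Qed.

(** Discriminant of the nonnegative quadratic [k |-> bf B (k *: u + v) (k *: u + v)]. *)
Lemma psd_CS B u v : B^T = B -> psd B -> bf B u v ^+ 2 <= bf B u u * bf B v v.
Proof.
move=> sB pB; apply: discr_le0 => k; have := pB (k *: u + v).
rewrite !(bfDl, bfDr, bfZl, bfZr) (bf_sym v u)//.
by move: (bf B u u) (bf B u v) (bf B v v) => a b c h; lra.
Qed.

Lemma psd_diag B i : psd B -> 0 <= B i i.
Proof. by move=> /(_ (delta_mx 0 i)); rewrite bf_delta. Qed.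

Lemma psd_tr B : psd B -> 0 <= \tr B.
Proof. by move=> h; apply: sumr_ge0 => i _; exact: psd_diag. Qed.

Lemma psd_entry_sqr B i j : B^T = B -> psd B -> B i j ^+ 2 <= B i i * B j j.
Proof. by move=> sB pB; rewrite -!bf_delta; exact: psd_CS. Qed.

(** Stands in for a bound by the largest eigenvalue: the form is tested on [u_j e_i - u_i e_j] for
    each pair of indices, and the resulting inequalities are summed. *)
Lemma psd_le_tr B u : B^T = B -> psd B -> bf B u u <= \tr B * dot u u.
Proof.
move=> sB pB; have hij i j : u 0 i * B i j * u 0 j <= (B i i * u 0 j ^+ 2 + B j j * u 0 i ^+ 2) / 2.
  have := pB (u 0 j *: delta_mx 0 i - u 0 i *: delta_mx 0 j).
  rewrite -scaleNr !(bfDl, bfDr, bfZl, bfZr) !bf_delta.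
  have -> : B j i = B i j by rewrite -[in LHS]sB mxE.
  by move=> h; lra.
rewrite bfE; apply: (@le_trans _ _ (\sum_i \sum_j (B i i * u 0 j ^+ 2 + B j j * u 0 i ^+ 2) / 2)).
  by apply: ler_sum => i _; apply: ler_sum => j _; exact: hij.
rewrite le_eqVlt; apply/orP; left; apply/eqP.
have e1 : \tr B * dot u u = \sum_i \sum_j B i i * u 0 j ^+ 2.
  by rewrite /mxtrace mulr_suml; apply: eq_bigr => i _; rewrite mulr_sumr;
    apply: eq_bigr => j _; rewrite expr2.
have e2 : \tr B * dot u u = \sum_i \sum_j B j j * u 0 i ^+ 2 by rewrite e1 exchange_big.
under eq_bigr do rewrite -mulr_suml big_split/=.
by rewrite -mulr_suml big_split/= -e1 -e2; lra.
Qed.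

End bilinear_forms.

(** * The moment equations *)


Section matrix_evolution.
Context {R : realType}.

Definition mevolves m n (F G : R -> 'M[R]_(m, n)) :=
  forall i j, evolves (fun t => F t i j) (fun t => G t i j).

Lemma mevolves_eq m n (F G H : R -> 'M[R]_(m, n)) :
  (forall t, 0 < t -> G t = H t) -> mevolves F G -> mevolves F H.
Proof. by move=> GH h i j; apply: evolves_eq (h i j) => t /GH ->. Qed.

Lemma mevolves_cst m n (A : 'M[R]_(m, n)) : mevolves (fun=> A) (fun=> 0).
Proof.
by move=> i j; apply: evolves_eq (evolves_cst _) => t _; rewrite mxE.
Qed.

Lemma mevolves_sub m n (F G dF dG : R -> 'M[R]_(m, n)) :
  mevolves F dF -> mevolves G dG ->
  mevolves (fun t => F t - G t) (fun t => dF t - dG t).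
Proof.
move=> hF hG i j; under eq_fun do rewrite !mxE.
by apply: evolves_eq (evolves_sub (hF i j) (hG i j)) => t _; rewrite !mxE.
Qed.

Lemma mevolves_tr m n (F dF : R -> 'M[R]_(m, n)) : mevolves F dF ->
  mevolves (fun t => (F t)^T) (fun t => (dF t)^T).
Proof.
move=> hF i j; under eq_fun do rewrite mxE.
by apply: evolves_eq (hF j i) => t _; rewrite mxE.
Qed.

Lemma mevolves_mul m n p (F dF : R -> 'M[R]_(m, n)) (G dG : R -> 'M[R]_(n, p)) :
  mevolves F dF -> mevolves G dG ->
  mevolves (fun t => F t *m G t) (fun t => dF t *m G t + F t *m dG t).
Proof.
move=> hF hG i j; under eq_fun do rewrite mxE.
have := evolves_bigsum (index_enum 'I_n) xpredT
  (fun k => evolves_mul (hF i k) (hG k j)).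
by apply: evolves_eq => t _; rewrite big_split/= !mxE.
Qed.

Lemma evolves_trace n (F dF : R -> 'M[R]_n) : mevolves F dF ->
  evolves (fun t => \tr (F t)) (fun t => \tr (dF t)).
Proof. by move=> h; apply: evolves_bigsum => i; exact: h. Qed.

Lemma evolves_bf n (F dF : R -> 'M[R]_n) u v : mevolves F dF ->
  evolves (fun t => bf (F t) u v) (fun t => bf (dF t) u v).
Proof.
move=> h; have := mevolves_mul (mevolves_mul (mevolves_cst u) h) (mevolves_cst v^T).
by move=> /(_ 0 0); apply: evolves_eq => t _; rewrite mul0mx add0r mulmx0 addr0.
Qed.

Lemma evolves_id : evolves (fun t : R => t) (fun=> 1).
Proof.
split=> [|t _]; last exact: is_derive_id.
by apply: continuous_subspaceT => t; exact: cvg_id.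
Qed.

End matrix_evolution.

(** * Dynamics of the covariance and of its inverse *)

Section moment_flow.
Context {R : realType} {d : nat}.

(** What the mean-field law and the empirical measure have in common. Means are row vectors, so
    [m *m S] is the product written [S m] in column form, and [m^T *m m] is the outer product.
    Symmetry and positivity are recorded at every time, since they are immediate for moments of a
    probability measure. *)
Record moment_flow (m : R -> 'rV[R]_d) (S : R -> 'M[R]_d) : Prop := MomentFlow {
  mean_evolves : mevolves m (fun t => - (m t *m S t));
  second_evolves : mevolves S
    (fun t => 2 *: S t - 2 *: (S t *m S t) - 2 *: ((m t)^T *m m t));
  second_sym : forall t, 0 <= t -> (S t)^T = S t;
  cov_psd : forall t, 0 <= t -> psd (S t - (m t)^T *m m t) }.

Variables (m : R -> 'rV[R]_d) (S : R -> 'M[R]_d).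
Hypothesis mS : moment_flow m S.

Let Sig t := S t - (m t)^T *m m t.
Let mm t := (m t)^T *m m t.

Lemma cov_sym (t : R) : 0 <= t -> (Sig t)^T = Sig t.
Proof.
by move=> t0; rewrite /Sig linearB/= (second_sym mS)// trmx_mul trmxK.
Qed.

Lemma bf_second t u : bf (S t) u u = bf (Sig t) u u + dot u (m t) ^+ 2.
Proof.
have e : S t = Sig t + (m t)^T *m m t by rewrite subrK.
rewrite [in LHS]e bf_add bf_rank1.
by rewrite expr2 (dotC (m t) u).
Qed.

Lemma second_psd (t : R) : 0 <= t -> psd (S t).
Proof. by move=> t0 u; rewrite bf_second addr_ge0 ?sqr_ge0//; exact: (cov_psd mS). Qed.

Lemma cov_le_second t u : bf (Sig t) u u <= bf (S t) u u.
Proof. by rewrite bf_second lerDl sqr_ge0. Qed.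

Lemma trace_mm t : \tr (mm t) = dot (m t) (m t).
Proof. by rewrite mxtrace_mulC /mxtrace big_ord1 -dotE. Qed.

Lemma trace_cov_le t : \tr (Sig t) <= \tr (S t).
Proof. by rewrite /Sig linearB/= trace_mm gerBl dot_ge0. Qed.

(** Summing [(S i i - 1) ^+ 2 >= 0] gives [\tr (S *m S) >= 2 \tr S - d], whence
    [(\tr S - d)' <= - 2 (\tr S - d)]. *)
Lemma trace_second_bound (t : R) : 0 <= t -> \tr (S t) <= d%:R + \tr (S 0).
Proof.
move=> t0.
have trS0 : 0 <= \tr (S 0) by apply: psd_tr; exact: second_psd.
pose f t := expR (2 * t) * (\tr (S t) - d%:R).
have ef := evolves_mul (evolves_expR 2)
  (evolves_sub (evolves_trace (second_evolves mS)) (evolves_cst d%:R)).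
have : f t <= f 0.
  apply: (evolves_nonincr ef) => // s s0.
  have hSS : \tr (S s *m S s) >= 2 * \tr (S s) - d%:R.
    rewrite /mxtrace mulr_sumr -[X in _ - X%:R](card_ord d) -sumr_const -sumrB.
    apply: ler_sum => i _; rewrite mxE (bigD1 i)//=.
    apply: (@le_trans _ _ (S s i i * S s i i)).
      by have := sqr_ge0 (S s i i - 1); move: (S s i i) => a; nra.
    rewrite lerDl; apply: sumr_ge0 => j _.
    have -> : S s j i = S s i j by rewrite -[in LHS](second_sym mS (ltW s0)) mxE.
    by rewrite -expr2 sqr_ge0.
  have hmm := dot_ge0 (m s); rewrite -trace_mm /mm in hmm.
  rewrite !raddfB/= !mxtraceZ -(mulrA 2) mulrCA -mulrDr pmulr_rle0 ?expR_gt0//.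
  lra.
rewrite /f mulr0 expR0 mul1r => h.
have [h1|h1] := leP (\tr (S t) - d%:R) 0; first by lra.
have d0 : 0 <= d%:R :> R by exact: ler0n.
suff : \tr (S t) - d%:R <= expR (2 * t) * (\tr (S t) - d%:R) by lra.
by rewrite ler_peMl ?(ltW h1)// -expR0 ler_expR mulr_ge0.
Qed.

(** The terms of [S'] and of [(m^T m)'] regroup into an equation linear in the covariance, with
    coefficient [S]. Its determinant and its inverse then satisfy equally simple equations. *)
Lemma cov_evolves :
  mevolves Sig (fun t => 2 *: Sig t - S t *m Sig t - Sig t *m S t).
Proof.
have := mevolves_sub (second_evolves mS)
  (mevolves_mul (mevolves_tr (mean_evolves mS)) (mean_evolves mS)).
apply: mevolves_eq => t t0.
rewrite linearN/= trmx_mul (second_sym mS (ltW t0)) mulNmx mulmxN.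
rewrite /Sig mulmxBr mulmxBl !mulmxA.
move: (S t *m S t) (S t *m (m t)^T *m m t) ((m t)^T *m m t *m S t) ((m t)^T *m m t) (S t).
by move=> A B C D E; apply/matrixP => i j; rewrite !mxE; ring.
Qed.

Lemma trace_adj_lyapunov (G H : 'M[R]_d) :
  \tr (\adj G *m (2 *: G - H *m G - G *m H)) = \det G * (2 * d%:R - 2 * \tr H).
Proof.
rewrite !mulmxBr !raddfB/= -scalemxAr mul_adj_mx mxtraceZ mxtrace_scalar.
rewrite !mulmxA mul_adj_mx mul_scalar_mx mxtraceZ mxtrace_mulC mulmxA mul_mx_adj.
by rewrite mul_scalar_mx mxtraceZ -mulr_natr; ring.
Qed.

Lemma conj_lyapunov (Q G H : 'M[R]_d) : Q *m G = 1%:M -> G *m Q = 1%:M ->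
  - (Q *m (2 *: G - H *m G - G *m H) *m Q) = Q *m H + H *m Q - 2 *: Q.
Proof.
move=> QG GQ; rewrite !(mulmxBr, mulmxBl) -scalemxAr QG -scalemxAl mul1mx.
rewrite !mulmxA QG mul1mx -!mulmxA GQ mulmx1.
by move: (H *m Q) (Q *m H) => A B; apply/matrixP => i j; rewrite !mxE; ring.
Qed.

(** The algebra behind [s' = - 2 s], where [n], [Q], [H] stand for the mean, the inverse covariance
    and the second moment: the terms in [H] coming from [n'] cancel those coming from [Q']. *)
Lemma quad_lyapunov (n : 'rV[R]_d) (Q H : 'M[R]_d) :
  2 * bf Q n n + ((- (n *m H) *m Q + n *m (Q *m H + H *m Q - 2 *: Q)) *m n^T
    + n *m Q *m - (H *m n^T)) 0 0 = 0.
Proof.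
rewrite /bf !(mulmxBr, mulmxDr, mulNmx, mulmxN, mulmxDl) -scalemxAr -scalemxAl.
rewrite !mulmxA.
move: (n *m H *m Q *m n^T) (n *m Q *m H *m n^T) (n *m Q *m n^T) => A B C.
by rewrite !mxE; ring.
Qed.

Let T := d%:R + \tr (S 0).

(** Jacobi's formula applied to [cov_evolves], as in Liouville's formula for linear systems. *)
Lemma det_cov_evolves :
  evolves (fun t => \det (Sig t))
    (fun t => \det (Sig t) * (2 * d%:R - 2 * \tr (S t))).
Proof.
split=> [|t t0]; first by apply: hcont_det => i j; exact: (cov_evolves i j).1.
apply: is_derive_eq; first by apply: is_derive_det => i j; exact: (cov_evolves i j).2.
exact: trace_adj_lyapunov.
Qed.

Hypothesis det0 : \det (Sig 0) != 0.

(** The logarithmic derivative of the squared determinant is [4 d - 4 \tr S >= - 4 T], so the square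
    times [expR (4 * T * t)] is nondecreasing. Squaring avoids following the sign of the
    determinant. *)
Lemma det_cov_neq0 (t : R) : 0 <= t -> \det (Sig t) != 0.
Proof.
move=> t0.
have e := evolves_scale (-1) (evolves_mul (evolves_expR (4 * T))
  (evolves_mul det_cov_evolves det_cov_evolves)).
have := evolves_nonincr e _ t0; rewrite !mulN1r lerN2 mulr0 expR0 mul1r.
move=> h; apply/negP => /eqP dt.
have : \det (Sig 0) * \det (Sig 0) <= 0.
  rewrite (le_trans (h _)) ?dt ?mul0r ?mulr0// => s s0.
  rewrite mulN1r oppr_le0.
  set D := \det (Sig s); set E := expR _.
  have -> : 4 * T * E * (D * D) + E * (D * (2 * d%:R - 2 * \tr (S s)) * D +
     D * (D * (2 * d%:R - 2 * \tr (S s)))) = 4 * E * (D * D) * (T + d%:R - \tr (S s)) by ring.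
  have DD : 0 <= D * D by rewrite -expr2 sqr_ge0.
  apply: mulr_ge0; first by rewrite mulr_ge0// mulr_ge0// expR_ge0.
  have := trace_second_bound (ltW s0); rewrite -/T.
  have : 0 <= d%:R :> R by exact: ler0n.
  lra.
by rewrite -expr2 le_eqVlt ltNge sqr_ge0 orbF sqrf_eq0 (negPf det0).
Qed.

Let P t := detadj (Sig t).

Lemma cov_unit (t : R) : 0 <= t -> Sig t \in unitmx.
Proof. by move=> t0; rewrite unitmxE unitfE det_cov_neq0. Qed.

Lemma precE (t : R) : 0 <= t -> P t = invmx (Sig t).
Proof. by move=> t0; rewrite /P detadj_inv// cov_unit. Qed.

Lemma prec_sym (t : R) : 0 <= t -> (P t)^T = P t.
Proof. by move=> t0; rewrite precE// trmx_inv cov_sym. Qed.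

Lemma mul_prec_cov (t : R) : 0 <= t -> P t *m Sig t = 1%:M.
Proof. by move=> t0; rewrite precE// mulVmx// cov_unit. Qed.

Lemma mul_cov_prec (t : R) : 0 <= t -> Sig t *m P t = 1%:M.
Proof. by move=> t0; rewrite precE// mulmxV// cov_unit. Qed.

Lemma prec_evolves :
  mevolves P (fun t => P t *m S t + S t *m P t - 2 *: P t).
Proof.
move=> i j; split=> [|t t0].
  apply: hcont_detadj => [t t0|k l]; first exact: det_cov_neq0.
  exact: (cov_evolves k l).1.
apply: is_derive_eq.
  apply: is_derive_detadj; first by apply: det_cov_neq0; exact: ltW.
  by move=> k l; exact: (cov_evolves k l).2.
rewrite -precE ?(ltW t0)// conj_lyapunov//.
- by apply: mul_prec_cov; exact: ltW.
- by apply: mul_cov_prec; exact: ltW.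
Qed.

(** Inserted in [prec_evolves], this identity and the next one turn the equation of [P] into
    [P' = 2 (1 - P) + mm P + P mm]. *)
Lemma second_prec (t : R) : 0 <= t -> S t *m P t = 1%:M + mm t *m P t.
Proof. by move=> t0; rewrite -(mul_cov_prec t0) -mulmxDl subrK. Qed.

Lemma prec_second (t : R) : 0 <= t -> P t *m S t = 1%:M + P t *m mm t.
Proof. by move=> t0; rewrite -(mul_prec_cov t0) -mulmxDr subrK. Qed.

Lemma bf_prec_cov (t : R) u v : 0 <= t -> bf (P t) u v = bf (Sig t) (u *m P t) (v *m P t).
Proof.
move=> t0; rewrite /bf trmx_mul prec_sym// mulmxA; congr ((_ *m _) 0 0).
by rewrite -!mulmxA mul_cov_prec// mulmx1.
Qed.

Lemma bf_cov_prec (t : R) u v : 0 <= t ->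
  bf (P t) (u *m Sig t) (v *m Sig t) = bf (Sig t) u v.
Proof.
move=> t0; rewrite /bf trmx_mul cov_sym// mulmxA; congr ((_ *m _) 0 0).
by rewrite -!mulmxA mul_prec_cov// mulmx1.
Qed.

Lemma prec_psd (t : R) : 0 <= t -> psd (P t).
Proof. by move=> t0 u; rewrite bf_prec_cov//; exact: (cov_psd mS). Qed.

Let s t := bf (P t) (m t) (m t).

Lemma mahalanobis_ge0 (t : R) : 0 <= t -> 0 <= s t.
Proof. by move=> t0; exact: prec_psd. Qed.

(* [s] solves [s' = - 2 s]. *)
Lemma mahalanobis_decay (t : R) : 0 <= t -> expR (2 * t) * s t = s 0.
Proof.
move=> t0.
have e := mevolves_mul (mevolves_mul (mean_evolves mS) prec_evolves)
  (mevolves_tr (mean_evolves mS)).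
have -> : s 0 = expR (2 * 0) * s 0 by rewrite mulr0 expR0 mul1r.
apply: (evolves_const (evolves_mul (evolves_expR 2) (e 0 0))) => // r r0.
rewrite linearN/= trmx_mul (second_sym mS (ltW r0)) -(mulrA 2) mulrCA -mulrDr.
apply/eqP; rewrite mulf_eq0; apply/orP; right; rewrite /s /bf.
by apply/eqP; exact: quad_lyapunov.
Qed.

(** Cauchy-Schwarz for the form [P], applied to [m] and [u Sigma]: the mixed value is [dot u m], and
    the value at [u Sigma] is [bf Sigma u u]. *)
Lemma mean_CS (t : R) u : 0 <= t -> dot u (m t) ^+ 2 <= s t * bf (Sig t) u u.
Proof.
move=> t0; rewrite -bf_cov_prec//.
have -> : dot u (m t) = bf (P t) (m t) (u *m Sig t).
  rewrite dotC /bf trmx_mul cov_sym// dotE mulmxA.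
  by rewrite -(mulmxA (m t)) mul_prec_cov// mulmx1.
by apply: psd_CS; [exact: prec_sym|exact: prec_psd].
Qed.

Lemma whitened_mean_CS (t : R) u : 0 <= t ->
  bf (P t) u (m t) ^+ 2 <= s t * bf (P t) u u.
Proof.
by move=> t0; rewrite mulrC; apply: psd_CS; [exact: prec_sym|exact: prec_psd].
Qed.

(* [(\tr P)' = 2 d - 2 \tr P + 2 s], and [s] decays exponentially. *)
Lemma trace_prec_bound (t : R) : 0 <= t -> \tr (P t) <= d%:R + \tr (P 0) + s 0.
Proof.
move=> t0.
have e := evolves_sub (evolves_mul (evolves_expR 2)
  (evolves_sub (evolves_trace prec_evolves) (evolves_cst d%:R)))
  (evolves_scale (2 * s 0) evolves_id).
have := evolves_const e _ t0; rewrite !mulr0 expR0 mul1r subr0 => h.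
have {}h : expR (2 * t) * (\tr (P t) - d%:R) - 2 * s 0 * t = \tr (P 0) - d%:R.
  apply: h => r r0.
  rewrite second_prec ?(ltW r0)// prec_second ?(ltW r0)// !raddfB/= !raddfD/=.
  have -> : \tr (mm r *m P r) = s r.
    rewrite /mm -mulmxA mxtrace_mulC /mxtrace big_ord1 /s /bf -mulmxA.
    by rewrite mulmxA.
  have -> : \tr (P r *m mm r) = s r.
    by rewrite /mm mulmxA mxtrace_mulC /mxtrace big_ord1 /s /bf mulmxA.
  rewrite mxtrace1 (mxtraceZ 2 (P r)) -(mahalanobis_decay (ltW r0)).
  ring.
have tp0 : 0 <= \tr (P 0) by apply: psd_tr; exact: prec_psd.
have s00 := mahalanobis_ge0 (lexx 0).
have h1 : expR (- (2 * t)) <= 1 by rewrite -expR0 ler_expR oppr_le0 mulr_ge0.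
have h2 := @expR_mulN_le1 _ (2 * t) (mulr_ge0 (ler0n _ _) t0).
have h3 : \tr (P t) - d%:R = expR (- (2 * t)) * (\tr (P 0) - d%:R + 2 * s 0 * t).
  by rewrite -h subrK mulrA -expRD addNr expR0 mul1r.
have h4 : expR (- (2 * t)) * \tr (P 0) <= \tr (P 0) by rewrite ler_piMl.
have h5 : (2 * t * expR (- (2 * t))) * s 0 <= s 0 by rewrite ler_piMl.
have h6 : 0 <= d%:R * expR (- (2 * t)) by rewrite mulr_ge0 ?expR_ge0.
lra.
Qed.

(** The quantity [exp (2 t) (P(u,u) - |u|^2)] has derivative [2 exp (2 t) P(u,m) <u,m>]. By
    Cauchy-Schwarz each of the two factors is of order [sqrt s], and [exp (2 t) s] is constant, so
    the quantity grows at most linearly in [t]; finally [t exp (- 2 t) <= exp (- t)]. *)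
Lemma prec_upper_bound (t : R) u : 0 <= t ->
  bf (P t) u u <= dot u u *
    (1 + (\tr (P 0) + s 0 * (2 * d%:R + \tr (P 0) + s 0 + \tr (S 0))) * expR (- t)).
Proof.
(* [k] is [s 0] times the sum of the bounds [d + \tr (P 0) + s 0] on [P] and [d + \tr (S 0)] on the
   covariance. *)
move=> t0; set k := s 0 * _.
have du := dot_ge0 u.
have tp0 : 0 <= \tr (P 0) by apply: psd_tr; exact: prec_psd.
have ts0 : 0 <= \tr (S 0) by apply: psd_tr; exact: second_psd.
have s00 := mahalanobis_ge0 (lexx 0).
have d0 : 0 <= d%:R :> R by exact: ler0n.
have k0 : 0 <= k by rewrite mulr_ge0// !addr_ge0// mulr_ge0.
have e := evolves_sub (evolves_mul (evolves_expR 2)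
  (evolves_sub (evolves_bf u u prec_evolves) (evolves_cst (dot u u))))
  (evolves_scale (k * dot u u) evolves_id).
have := evolves_nonincr e _ t0; rewrite !mulr0 expR0 mul1r subr0 => h.
have {}h : expR (2 * t) * (bf (P t) u u - dot u u) - k * dot u u * t
    <= bf (P 0) u u - dot u u.
  apply: h => r /ltW r0.
  rewrite second_prec// prec_second// !bf_add bf_opp (bf_scale 2 (P r)).
  have e1 : bf 1%:M u u = dot u u by rewrite /bf mulmx1 dotE.
  have e2 : bf (P r *m mm r) u u = bf (P r) u (m r) * dot u (m r).
    have -> : bf (P r *m mm r) u u = bf ((m r)^T *m m r) (u *m P r) u.
      by rewrite /bf !mulmxA.
    by rewrite bf_rank1 dot_mulmx (dotC (m r)).
  have e3 : bf (mm r *m P r) u u = bf (P r) u (m r) * dot u (m r).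
    have -> : bf (mm r *m P r) u u = bf ((m r)^T *m m r) u (u *m P r).
      by rewrite /bf trmx_mul prec_sym// !mulmxA.
    by rewrite bf_rank1 mulrC (dotC (m r)) dot_mulmx.
  rewrite e1 e2 e3.
  have m1 := mean_CS u r0; have m2 := whitened_mean_CS u r0.
  have b1 : bf (P r) u u <= (d%:R + \tr (P 0) + s 0) * dot u u.
    rewrite (le_trans (psd_le_tr _ (prec_sym r0) (prec_psd r0)))//.
    by rewrite ler_wpM2r// trace_prec_bound.
  have b2 : bf (Sig r) u u <= (d%:R + \tr (S 0)) * dot u u.
    rewrite (le_trans (psd_le_tr _ (cov_sym r0) (cov_psd mS r0)))//.
    by rewrite ler_wpM2r// (le_trans (trace_cov_le _))// trace_second_bound.
  have sr0 := mahalanobis_ge0 r0.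
  set q := bf (P r) u (m r) in m2 *; set w := dot u (m r) in m1 *.
  have b3 : q * w *+ 2 <= s r * (2 * d%:R + \tr (P 0) + s 0 + \tr (S 0)) * dot u u.
    apply: (@le_trans _ _ (q ^+ 2 + w ^+ 2)).
      by have := sqr_ge0 (q - w); rewrite sqrrB; lra.
    apply: (le_trans (lerD m2 m1)); rewrite -mulrDr -mulrA ler_wpM2l//.
    apply: (le_trans (lerD b1 b2)); lra.
  have b4 : expR (2 * r) * (q * w *+ 2) <= k * dot u u.
    rewrite (le_trans (ler_wpM2l (expR_ge0 _) b3))//.
    by rewrite !mulrA mahalanobis_decay.
  move: b4; move: (expR _) (k * _) (bf (P r) u u) => E K B; rewrite mulr2n.
  lra.
have bp : bf (P 0) u u <= \tr (P 0) * dot u u.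
  by apply: psd_le_tr; [exact: prec_sym|exact: prec_psd].
have h1 : bf (P t) u u - dot u u <=
    expR (- (2 * t)) * (\tr (P 0) * dot u u + k * dot u u * t).
  rewrite expRN ler_pdivlMl ?expR_gt0//; lra.
have h2 : expR (- (2 * t)) <= expR (- t) by rewrite ler_expR; lra.
have h3 : expR (- (2 * t)) * t <= expR (- t).
  rewrite (_ : - (2 * t) = - t + - t); last by ring.
  by rewrite expRD -mulrA ler_piMr ?expR_ge0// mulrC expR_mulN_le1.
have h4 := ler_wpM2l (mulr_ge0 tp0 du) h2.
have h5 := ler_wpM2l (mulr_ge0 k0 du) h3.
lra.
Qed.

(** Expanding [P(u - u Sigma, u - u Sigma) >= 0] gives [Sigma >= 2 - P], which converts the upper
    bound of [P] into a lower bound of [Sigma], hence of [S]. *)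
Lemma second_lower_bound (t : R) u : 0 <= t ->
  dot u u * (1 - (\tr (P 0) + s 0 * (2 * d%:R + \tr (P 0) + s 0 + \tr (S 0))) * expR (- t))
  <= bf (S t) u u.
Proof.
move=> t0; apply: le_trans (cov_le_second t u).
have h := prec_upper_bound u t0.
have := prec_psd t0 (u - u *m Sig t).
rewrite -scaleN1r !(bfDl, bfDr, bfZl, bfZr) bf_cov_prec//.
have e : bf (P t) (u *m Sig t) u = dot u u.
  by rewrite /bf -(mulmxA u) mul_cov_prec// mulmx1 dotE.
by rewrite [bf (P t) u (u *m _)]bf_sym ?prec_sym// e; lra.
Qed.

(** Summing [mean_CS] over the basis vectors gives [|m|^2 <= s \tr Sigma]: the decay comes from [s],
    while the trace stays bounded. *)
Lemma mean_decay (t : R) : 0 <= t ->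
  dot (m t) (m t) <= s 0 * (d%:R + \tr (S 0)) * expR (- (2 * t)).
Proof.
move=> t0.
have e : s t = s 0 * expR (- (2 * t)).
  by rewrite -(mahalanobis_decay t0) mulrAC -expRD subrr expR0 mul1r.
rewrite mulrAC -e; have st0 := mahalanobis_ge0 t0.
apply: (@le_trans _ _ (s t * \tr (Sig t))).
  rewrite /mxtrace mulr_sumr; apply: ler_sum => i _.
  by have := mean_CS (delta_mx 0 i) t0; rewrite dotC dot_delta bf_delta expr2.
by rewrite ler_wpM2l// (le_trans (trace_cov_le _))// trace_second_bound.
Qed.

End moment_flow.

(** * Relaxation and stability of the moment flow *)

Section stability.
Context {R : realType} {d : nat}.

Lemma dot_eq0 (u : 'rV[R]_d) : dot u u = 0 -> u = 0.
Proof.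
move=> u0; apply/rowP => j; rewrite [RHS]mxE; apply/eqP; rewrite -sqrf_eq0.
rewrite eq_le sqr_ge0 andbT -u0 /dot (bigD1 j)//= expr2 lerDl.
by apply: sumr_ge0 => k _; rewrite -expr2 sqr_ge0.
Qed.

Definition coercive (c : R) (B : 'M[R]_d) := forall u, c * dot u u <= bf B u u.

Lemma coercive_unit (c : R) (B : 'M[R]_d) : 0 < c -> coercive c B -> B \in unitmx.
Proof.
move=> c0 h; rewrite -row_free_unit -kermx_eq0; apply/eqP/row_matrixP => i.
rewrite row0; set u := row i _.
have uB : u *m B = 0 by rewrite /u -row_mul mulmx_ker row0.
have : dot u u <= 0 by rewrite -(pmulr_rle0 _ c0) (le_trans (h u))// /bf uB mul0mx mxE.
by move=> u0; apply: dot_eq0; apply/eqP; rewrite eq_le u0 dot_ge0.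
Qed.

(** With [v = u B^-1], coercivity reads [c |v|^2 <= dot u v]; inserting this in [|u - c v|^2 >= 0]
    leaves [c (dot u v) <= |u|^2]. *)
Lemma inverse_coercive_bound (c : R) (B : 'M[R]_d) u : 0 < c -> B^T = B ->
  coercive c B -> bf (invmx B) u u <= c^-1 * dot u u.
Proof.
move=> c0 sB h; have uB := coercive_unit c0 h.
have sV : (invmx B)^T = invmx B by rewrite trmx_inv sB.
set v := u *m invmx B.
have e1 : bf B v v = bf (invmx B) u u.
  by rewrite /bf /v trmx_mul sV mulmxA -(mulmxA u) mulVmx// mulmx1.
have e2 : bf (invmx B) u u = dot u v.
  by rewrite dotE /v trmx_mul sV /bf mulmxA.
have h1 := h v; rewrite e1 e2 in h1.
have := dot_ge0 (u - c *: v).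
have -> : dot (u - c *: v) (u - c *: v) = dot u u - 2 * c * dot u v + c ^+ 2 * dot v v.
  rewrite -[dot (u - _) _]addr0 -scaleNr /dot addr0 !mulr_sumr -sumrN -!big_split/=.
  apply: eq_bigr => i _; rewrite !mxE; ring.
rewrite e2 ler_pdivlMl//; nra.
Qed.

Lemma uniform_relaxation (c M : R) : 0 < c -> 0 <= M -> exists2 K : R, 0 <= K &
  forall (m : R -> 'rV[R]_d) (S : R -> 'M[R]_d), moment_flow m S ->
    coercive c (S 0 - (m 0)^T *m m 0) -> \tr (S 0) <= M ->
    forall t : R, 0 <= t ->
      (forall i, `|m t 0 i| <= K * expR (- t)) /\
      coercive (1 - K * expR (- t)) (S t).
Proof.
move=> c0 M0.
(* [B] bounds the factor of [exp (- t)] in [second_lower_bound] and [C] the constant of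
   [mean_decay], through [\tr (P 0) <= d / c], [s 0 <= M / c] and [\tr (S 0) <= M]. As the mean is
   controlled through its square, [1 + C] stands for the square root of [C]. *)
pose B := d%:R / c + M / c * (2 * d%:R + d%:R / c + M / c + M).
pose C := M / c * (d%:R + M).
have d0 : 0 <= d%:R :> R by exact: ler0n.
have dc0 : 0 <= d%:R / c by rewrite divr_ge0// ltW.
have Mc0 : 0 <= M / c by rewrite divr_ge0// ltW.
have B0 : 0 <= B by rewrite addr_ge0// mulr_ge0// !addr_ge0// mulr_ge0.
have C0 : 0 <= C by rewrite mulr_ge0// addr_ge0.
have K0 : 0 <= B + (1 + C) by rewrite addr_ge0// addr_ge0.
exists (B + (1 + C)) => //.
move=> m S mS cS trM t t0.
set Sg := S 0 - _ in cS.
have uS := coercive_unit c0 cS.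
have det0 : \det Sg != 0 by rewrite -unitfE -unitmxE.
have sSg : Sg^T = Sg by apply: (cov_sym mS).
have PE : detadj Sg = invmx Sg by rewrite detadj_inv.
have hP u : bf (detadj Sg) u u <= c^-1 * dot u u.
  by rewrite PE; exact: inverse_coercive_bound.
have trS0 : 0 <= \tr (S 0) by apply: psd_tr; exact: (second_psd mS).
have trP : \tr (detadj Sg) <= d%:R / c.
  rewrite -[X in X%:R](card_ord d) -sumr_const mulr_suml; apply: ler_sum => i _.
  by rewrite -bf_delta (le_trans (hP _))// dot_delta mxE !eqxx mulr1 mul1r.
have trP0 : 0 <= \tr (detadj Sg) by apply: psd_tr; exact: (prec_psd mS det0 (lexx 0)).
have s00 := mahalanobis_ge0 mS det0 (lexx 0).
have s0 : bf (detadj Sg) (m 0) (m 0) <= M / c.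
  rewrite (le_trans (hP _))// mulrC ler_wpM2r ?invr_ge0 ?(ltW c0)//.
  rewrite (le_trans _ trM)// -subr_ge0 -trace_mm -raddfB/=.
  by apply: psd_tr; exact: (cov_psd mS).
have E0 := expR_ge0 (- t).
split=> [i|u].
- have : m t 0 i ^+ 2 <= C * expR (- (2 * t)).
    apply: (@le_trans _ _ (dot (m t) (m t))).
      rewrite /dot (bigD1 i)//= expr2 lerDl; apply: sumr_ge0 => j _.
      by rewrite -expr2 sqr_ge0.
    apply: (le_trans (mean_decay mS det0 t0)); rewrite ler_wpM2r ?expR_ge0//.
    by rewrite ler_pM// ?addr_ge0// lerD2l.
  have -> : expR (- (2 * t)) = expR (- t) ^+ 2 by rewrite -expRM_natl; congr expR; ring.
  have KE0 : 0 <= (B + (1 + C)) * expR (- t) by exact: mulr_ge0.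
  move=> h; rewrite -[leRHS]ger0_norm//.
  rewrite -ler_sqr ?nnegrE// !real_normK ?num_real// (le_trans h)// exprMn.
  by rewrite ler_wpM2r ?sqr_ge0//; nra.
- rewrite mulrC (le_trans _ (second_lower_bound mS det0 u t0))//.
  rewrite ler_wpM2l ?dot_ge0// lerD2l lerN2 ler_wpM2r//.
  apply: (@le_trans _ _ B); last by lra.
  by rewrite lerD// ler_pM// ?addr_ge0 ?mulr_ge0// !lerD.
Qed.

Definition sqF p q (B : 'M[R]_(p, q)) : R := \sum_i \sum_j B i j ^+ 2.

Lemma sqF_ge0 p q (B : 'M[R]_(p, q)) : 0 <= sqF B.
Proof. by apply: sumr_ge0 => i _; apply: sumr_ge0 => j _; exact: sqr_ge0. Qed.

Lemma sqF_row n (u : 'rV[R]_n) : sqF u = dot u u.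
Proof. by rewrite /sqF big_ord1; apply: eq_bigr => i _; rewrite expr2. Qed.

Lemma sqF_trace (B : 'M[R]_d) : B^T = B -> \tr (B *m B) = sqF B.
Proof.
move=> sB; apply: eq_bigr => i _; rewrite mxE; apply: eq_bigr => j _.
by rewrite -{2}sB mxE expr2.
Qed.

(** Young's inequality entry by entry, with the small factor [k] kept in front; [d] counts the rows
    over which [v 0 j ^+ 2] is repeated. *)
Lemma bf_lower (k : R) (B : 'M[R]_d) (u v : 'rV[R]_d) : 0 <= k -> (forall i, `|u 0 i| <= k) ->
  - bf B u v <= k / 2 * (sqF B + d%:R * dot v v).
Proof.
move=> k0 uk; rewrite bfE -sumrN.
have -> : k / 2 * (sqF B + d%:R * dot v v) =
    \sum_i \sum_j k / 2 * (B i j ^+ 2 + v 0 j ^+ 2).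
  have -> : dot v v = \sum_j v 0 j ^+ 2 by apply: eq_bigr => j _; rewrite expr2.
  under [in RHS]eq_bigr do rewrite -mulr_sumr big_split/=.
  by rewrite -mulr_sumr big_split/= sumr_const card_ord mulr_natl.
apply: ler_sum => i _; rewrite -sumrN; apply: ler_sum => j _.
rewrite (le_trans (ler_norm _))// normrN !normrM -mulrA.
rewrite (le_trans (ler_wpM2r _ (uk i)))// ?mulr_ge0//.
rewrite -mulrA ler_wpM2l// -(real_normK (num_real (B i j))) -(real_normK (num_real (v 0 j))).
by have := sqr_ge0 (`|B i j| - `|v 0 j|); lra.
Qed.

Lemma trace_conj (H B : 'M[R]_d) : B^T = B ->
  \tr (B *m H *m B) = \sum_i bf H (row i B) (row i B).
Proof.
move=> sB; apply: eq_bigr => i _; rewrite /bf -row_mul mxE [RHS]mxE.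
apply: eq_bigr => j _; have -> : B j i = B i j by rewrite -{1}sB mxE.
by congr (_ * _); [rewrite [RHS]mxE|rewrite [RHS]mxE [RHS]mxE].
Qed.

(** With [B = H - H'] and [a = n - n'], the growth term [4 sqF B] is compensated by
    [- 4 \tr (B H B) <= - 4 (1 - k) sqF B], while [H'] enters with a favourable sign. The cross
    terms all contain [n] or [n'], hence a factor [k]. *)
Lemma difference_contraction (k : R) (n n' : 'rV[R]_d) (H H' : 'M[R]_d) :
  0 <= k -> (forall i, `|n 0 i| <= k) -> (forall i, `|n' 0 i| <= k) ->
  H^T = H -> H'^T = H' -> psd H -> psd H' -> coercive (1 - k) H ->
  2 * dot (- (n *m H) - - (n' *m H')) (n - n') +
  2 * \tr ((H - H') *m (2 *: H - 2 *: (H *m H) - 2 *: (n^T *m n) -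
                   (2 *: H' - 2 *: (H' *m H') - 2 *: (n'^T *m n')))) <=
  k * (9 + 5 * d%:R) * (dot (n - n') (n - n') + sqF (H - H')).
Proof.
move=> k0 nk nk' sH sH' pH pH' cH.
pose a := n - n'; pose B := H - H'.
have sB : B^T = B by rewrite /B linearB/= sH sH'.
have -> : - (n *m H) - - (n' *m H') = - (a *m H) - n' *m B.
  by rewrite /a /B mulmxBl mulmxBr; apply/matrixP => i j; rewrite !mxE; ring.
have -> : 2 *: H - 2 *: (H *m H) - 2 *: (n^T *m n) -
    (2 *: H' - 2 *: (H' *m H') - 2 *: (n'^T *m n')) =
    2 *: B - 2 *: (H *m B + B *m H') - 2 *: (n^T *m a + a^T *m n').
  have -> : a^T = n^T - n'^T by rewrite /a linearB.
  rewrite /a /B !(mulmxBl, mulmxBr).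
  move: (H *m H) (H' *m H') (H *m H') (n^T *m n) (n'^T *m n') (n^T *m n').
  move=> x1 x2 x3 x4 x5 x6; apply/matrixP => i j; rewrite !mxE; ring.
rewrite -/a -/B; clearbody a B.
have -> : dot (- (a *m H) - n' *m B) a = - bf H a a - bf B n' a.
  by rewrite dotE mulmxBl mulNmx /bf !mxE.
have -> : \tr (B *m (2 *: B - 2 *: (H *m B + B *m H') - 2 *: (n^T *m a + a^T *m n'))) =
   2 * sqF B - 2 * (\tr (B *m H *m B) + \tr (B *m H' *m B)) - 2 * (bf B n a + bf B n' a).
  rewrite !mulmxBr -!scalemxAr !mulmxDr !mulmxA -sqF_trace//.
  rewrite [in X in _ = _ - X](bf_sym n)// [\tr (B *m H' *m B)]mxtrace_mulC mulmxA.
  rewrite !raddfB/= !mxtraceZ !raddfD/=.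
  have -> : \tr (B *m n^T *m a) = bf B a n.
    by rewrite mxtrace_mulC /mxtrace big_ord1 /bf mulmxA.
  have -> : \tr (B *m a^T *m n') = bf B n' a.
    by rewrite mxtrace_mulC /mxtrace big_ord1 /bf mulmxA.
  by [].
rewrite !trace_conj//.
have h1 : (1 - k) * sqF B <= \sum_i bf H (row i B) (row i B).
  rewrite mulr_sumr; apply: ler_sum => i _; rewrite (le_trans _ (cH _))//.
  by rewrite /dot le_eqVlt; apply/orP; left; apply/eqP; congr (_ * _); apply: eq_bigr => j _;
    rewrite mxE expr2.
have h2 : 0 <= \sum_i bf H' (row i B) (row i B) by apply: sumr_ge0 => i _; exact: pH'.
have h3 := pH a.
(* The cross terms are [- 4 bf B n a - 6 bf B n' a], at most [5 k (sqF B + d |a|^2)]. Together with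
   the [4 k sqF B] left over from [h1], this explains the constants 9 and [5 d]. *)
have h4 := bf_lower B a k0 nk; have h5 := bf_lower B a k0 nk'.
have d0 : 0 <= d%:R :> R by exact: ler0n.
have h6 := mulr_ge0 k0 (sqF_ge0 B).
have h7 := mulr_ge0 k0 (dot_ge0 a).
have h8 := mulr_ge0 d0 h6; have h9 := mulr_ge0 d0 h7.
move: h1 h2 h3 h4 h5 h6 h7 h8 h9.
move: (\sum_i _) (\sum_i _) (bf H a a) (bf B n a) (bf B n' a) (sqF B) (dot a a) =>
  x1 x2 x3 x4 x5 x6 x7.
move=> h1 h2 h3 h4 h5 h6 h7 h8 h9; lra.
Qed.

Lemma evolves_sqF p q (F dF : R -> 'M[R]_(p, q)) : mevolves F dF ->
  evolves (fun t => sqF (F t)) (fun t => \sum_i \sum_j 2 * (dF t i j * F t i j)).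
Proof.
move=> h; apply: evolves_bigsum => i; apply: evolves_bigsum => j.
apply: evolves_eq (evolves_mul (h i j) (h i j)) => t _.
by rewrite [_ * dF t i j]mulrC mulr2n mulrDl mul1r.
Qed.

Lemma evolves_expR_comp (f g : R -> R) : evolves f g ->
  evolves (fun t => expR (f t)) (fun t => expR (f t) * g t).
Proof.
move=> [cf df]; split=> [t|t t0]; last first.
  by have dft := df t t0; exact: (@is_derive1_comp _ expR f).
by apply: continuous_comp; [exact: cf|exact: continuous_expR].
Qed.

(** For [D' <= L exp (- t) D] the integrating factor is [exp (L exp (- t))]. It equals [exp L] at
    time 0 and never falls below 1, so the constant does not depend on [t]. *)
Lemma flow_gronwall (K : R) (m m' : R -> 'rV[R]_d) (S S' : R -> 'M[R]_d) :
  0 <= K -> moment_flow m S -> moment_flow m' S' ->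
  (forall t i, 0 <= t -> `|m t 0 i| <= K * expR (- t)) ->
  (forall t i, 0 <= t -> `|m' t 0 i| <= K * expR (- t)) ->
  (forall t, 0 <= t -> coercive (1 - K * expR (- t)) (S t)) ->
  forall t, 0 <= t -> sqF (m t - m' t) + sqF (S t - S' t) <=
    expR (K * (9 + 5 * d%:R)) * (sqF (m 0 - m' 0) + sqF (S 0 - S' 0)).
Proof.
move=> K0 mS mS' mK mK' SK t t0.
set L := K * _.
have e := evolves_mul
  (evolves_expR_comp (evolves_scale L (evolves_expR (-1))))
  (evolves_add (evolves_sqF (mevolves_sub (mean_evolves mS) (mean_evolves mS')))
     (evolves_sqF (mevolves_sub (second_evolves mS) (second_evolves mS')))).
have := evolves_nonincr e _ t0; rewrite mulr0 expR0 mulr1 => h.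
apply: le_trans (h _).
  rewrite ler_peMl ?addr_ge0 ?sqF_ge0// -expR0 ler_expR mulr_ge0 ?expR_ge0//.
  by rewrite mulr_ge0// addr_ge0// mulr_ge0.
move=> r /ltW r0; rewrite -mulrA -mulrDr pmulr_rle0 ?expR_gt0// mulN1r.
have hc := difference_contraction (mulr_ge0 K0 (expR_ge0 (- r))) (fun i => mK r i r0)
  (fun i => mK' r i r0) (second_sym mS r0) (second_sym mS' r0) (second_psd mS r0)
  (second_psd mS' r0) (SK r r0).
set X := \sum_i _; set Y := \sum_i \sum_j _.
rewrite -sqF_row in hc.
suff -> : X + Y = 2 * dot (- (m r *m S r) - - (m' r *m S' r)) (m r - m' r) +
  2 * \tr ((S r - S' r) *m (2 *: S r - 2 *: (S r *m S r) - 2 *: ((m r)^T *m m r) -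
     (2 *: S' r - 2 *: (S' r *m S' r) - 2 *: ((m' r)^T *m m' r)))).
  by move: hc; rewrite /L mulN1r; lra.
congr (_ + _).
  by rewrite /X big_ord1 /dot mulr_sumr.
have sD : (S r - S' r)^T = S r - S' r.
  by rewrite linearB/= (second_sym mS)// (second_sym mS').
rewrite /Y exchange_big /mxtrace mulr_sumr; apply: eq_bigr => i _.
rewrite [in RHS]mxE mulr_sumr; apply: eq_bigr => j _.
have -> : (S r - S' r) j i = (S r - S' r) i j by rewrite -{1}sD [LHS]mxE.
by rewrite [_ * (S r - S' r) i j]mulrC.
Qed.

Definition moment_dist (m m' : 'rV[R]_d) (S S' : 'M[R]_d) := sqF (m - m') + sqF (S - S').

Lemma sqF_sub_le p q (A B : 'M[R]_(p, q)) : sqF (A - B) <= 2 * (sqF A + sqF B).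
Proof.
rewrite /sqF -big_split/= mulr_sumr; apply: ler_sum => i _.
rewrite -big_split/= mulr_sumr; apply: ler_sum => j _; rewrite !mxE.
by have := sqr_ge0 (A i j + B i j); lra.
Qed.

Lemma psd_sqF_le (B : 'M[R]_d) : B^T = B -> psd B -> sqF B <= \tr B ^+ 2.
Proof.
move=> sB pB; rewrite expr2 {1}/mxtrace mulr_suml; apply: ler_sum => i _.
by rewrite mulr_sumr; apply: ler_sum => j _; exact: psd_entry_sqr.
Qed.

Lemma sqr_sum_le n (x : 'I_n -> R) :
  (\sum_i x i) ^+ 2 <= n%:R * \sum_i x i ^+ 2.
Proof.
rewrite expr2 mulr_suml; under eq_bigr do rewrite mulr_sumr.
apply: (@le_trans _ _ (\sum_i \sum_j (x i ^+ 2 + x j ^+ 2) / 2)).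
  apply: ler_sum => i _; apply: ler_sum => j _.
  by have := sqr_ge0 (x i - x j); lra.
rewrite le_eqVlt; apply/orP; left; apply/eqP.
under eq_bigr do rewrite -mulr_suml big_split/= sumr_const card_ord.
rewrite -mulr_suml big_split/= sumr_const card_ord sumrMnl -[_ *+ n]mulr_natl.
by move: (n%:R * _) => y; field.
Qed.

Lemma trace_diff_sqr (A B : 'M[R]_d) :
  (\tr A - \tr B) ^+ 2 <= d%:R * sqF (A - B).
Proof.
rewrite -raddfB/= (le_trans (sqr_sum_le (fun i => (A - B) i i)))//.
rewrite ler_wpM2l//; apply: ler_sum => i _; rewrite [leRHS](bigD1 i)//= lerDl.
by apply: sumr_ge0 => k _; exact: sqr_ge0.
Qed.

Lemma dot_CS (u v : 'rV[R]_d) : dot u v ^+ 2 <= dot u u * dot v v.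
Proof.
have bE w z : bf (1%:M : 'M[R]_d) w z = dot w z by rewrite /bf mulmx1 dotE.
rewrite -!bE; apply: psd_CS; first exact: trmx1.
by move=> w; rewrite bE dot_ge0.
Qed.

Lemma bf_le_sqF (e : R) (B : 'M[R]_d) u : 0 < e -> sqF B <= e ^+ 2 ->
  bf B u u <= e * dot u u.
Proof.
move=> e0 Be; have [U0|U0] := eqVneq (dot u u) 0.
  by rewrite U0 (dot_eq0 U0) /bf !mul0mx mxE mulr0.
have {}U0 : 0 < dot u u by rewrite lt_def U0 dot_ge0.
(* This factor reduces the claim to [2 x y <= x^2 + y^2] for each pair of indices, with
   [x = e u_i u_j] and [y = |u|^2 B_ij]. *)
rewrite -(@ler_pM2l _ (2 * e * dot u u)) ?mulr_gt0//.
apply: (@le_trans _ _ (e ^+ 2 * dot u u ^+ 2 + dot u u ^+ 2 * sqF B)); last first.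
  have := ler_wpM2l (sqr_ge0 (dot u u)) Be; lra.
have -> : e ^+ 2 * dot u u ^+ 2 + dot u u ^+ 2 * sqF B =
    \sum_i \sum_j (e ^+ 2 * (u 0 i ^+ 2 * u 0 j ^+ 2) + dot u u ^+ 2 * B i j ^+ 2).
  under eq_bigr do rewrite big_split/= -!mulr_sumr.
  rewrite big_split/= -!mulr_sumr -mulr_suml; congr (_ * _ + _); rewrite expr2.
rewrite bfE mulr_sumr; apply: ler_sum => i _; rewrite mulr_sumr; apply: ler_sum => j _.
by have := sqr_ge0 (e * (u 0 i * u 0 j) - dot u u * B i j); move: (dot u u) => U h; lra.
Qed.

(** Crude bound for the case where the second covariance may be singular. Each
    [|m|^2 + |S|^2 <= \tr S + (\tr S)^2] stays bounded by [trace_second_bound], and [\tr (S' 0)]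
    differs from [\tr (S 0)] by an amount whose square is at most [d] times the initial distance. *)
Lemma flow_moment_dist_bound (m m' : R -> 'rV[R]_d) (S S' : R -> 'M[R]_d) (M t : R) :
  moment_flow m S -> moment_flow m' S' -> \tr (S 0) <= M -> 0 <= t ->
  moment_dist (m t) (m' t) (S t) (S' t) <=
    8 * (1 + d%:R + M) ^+ 2 + 4 * d%:R * moment_dist (m 0) (m' 0) (S 0) (S' 0).
Proof.
move=> mS mS' SM t0; set D0 := moment_dist (m 0) _ _ _.
have tm (n : R -> 'rV[R]_d) (H : R -> 'M[R]_d) : moment_flow n H -> sqF (n t) + sqF (H t) <= \tr
  (H t) + \tr (H t) ^+ 2.
  move=> nH; apply: lerD; last first.
    exact: psd_sqF_le (second_sym nH t0) (second_psd nH t0).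
  rewrite sqF_row -subr_ge0 -trace_mm -raddfB/=.
  by apply: psd_tr; exact: (cov_psd nH).
have b1 := trace_second_bound mS t0; have b2 := trace_second_bound mS' t0.
have p1 : 0 <= \tr (S t) by apply: psd_tr; exact: (second_psd mS).
have p2 : 0 <= \tr (S' t) by apply: psd_tr; exact: (second_psd mS').
have p3 : 0 <= \tr (S 0) by apply: psd_tr; exact: (second_psd mS).
have p4 : 0 <= \tr (S' 0) by apply: psd_tr; exact: (second_psd mS').
have hD : (\tr (S 0) - \tr (S' 0)) ^+ 2 <= d%:R * D0.
  by rewrite (le_trans (trace_diff_sqr _ _))// ler_wpM2l// lerDr sqF_ge0.
have d0 : 0 <= d%:R :> R by exact: ler0n.
apply: (@le_trans _ _ (2 * (sqF (m t) + sqF (S t)) + 2 * (sqF (m' t) + sqF (S' t)))).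
  by have := sqF_sub_le (m t) (m' t); have := sqF_sub_le (S t) (S' t); rewrite /moment_dist; lra.
have h1 := tm _ _ mS; have h2 := tm _ _ mS'.
have h3 : \tr (S t) + \tr (S t) ^+ 2 <= (1 + d%:R + M) ^+ 2 by nra.
set Z := \tr (S 0) - \tr (S' 0) in hD.
have h4 : \tr (S' t) + \tr (S' t) ^+ 2 <= (1 + d%:R + M - Z) ^+ 2.
  have : \tr (S' t) <= d%:R + M - Z by rewrite /Z; lra.
  nra.
have h5 : (1 + d%:R + M - Z) ^+ 2 <= 2 * (1 + d%:R + M) ^+ 2 + 2 * Z ^+ 2.
  by have := sqr_ge0 (1 + d%:R + M + Z); nra.
have := sqr_ge0 (1 + d%:R + M); lra.
Qed.

(* An initial distance at most [e ^+ 2] transfers coercivity and the trace bound to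
   the second flow; a larger one is absorbed in the constant, since both flows stay
   bounded. *)
Theorem flow_stability (c M : R) : 0 < c -> 0 <= M -> exists2 L : R, 0 <= L &
  forall (m m' : R -> 'rV[R]_d) (S S' : R -> 'M[R]_d),
    moment_flow m S -> moment_flow m' S' ->
    coercive c (S 0 - (m 0)^T *m m 0) -> \tr (S 0) <= M ->
    forall t : R, 0 <= t -> moment_dist (m t) (m' t) (S t) (S' t) <=
      L * moment_dist (m 0) (m' 0) (S 0) (S' 0).
Proof.
move=> c0 M0.
have d0 : 0 <= d%:R :> R by exact: ler0n.
have c20 : 0 < c / 2 by rewrite divr_gt0.
have M10 : 0 <= M + 1 + d%:R by rewrite !addr_ge0.
(* The weakened constants [c / 2] and [M + 1 + d] hold for both flows once their initial distance is
   at most [e ^+ 2]. *)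
have [K K0 HK] := uniform_relaxation c20 M10.
(* Passing to the second flow costs the covariance form at most
   [e + e ^+ 2 + e (M + 1) <= e (3 + M)] times [|u|^2]: [e] for the change of [S], the rest for the
   change of [dot u (m 0) ^+ 2]. This choice makes the loss at most [c / 2]; the cap 1 gives
   [e ^+ 2 <= e]. *)
pose e := Num.min 1 (c / (2 * (3 + M))).
have e0 : 0 < e by rewrite lt_min ltr01 divr_gt0// mulr_gt0// ltr_wpDr.
pose L1 := expR (K * (9 + 5 * d%:R)).
pose L2 := 8 * (1 + d%:R + M) ^+ 2 / e ^+ 2 + 4 * d%:R.
have L20 : 0 <= L2.
  apply: addr_ge0; last by apply: mulr_ge0.
  by apply: divr_ge0; [apply: mulr_ge0; rewrite ?sqr_ge0|exact: sqr_ge0].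
exists (L1 + L2); first by apply: addr_ge0 => //; exact: expR_ge0.
move=> m m' S S' mS mS' cS SM t t0; set D0 := moment_dist (m 0) _ _ _.
have D00 : 0 <= D0 by rewrite addr_ge0 ?sqF_ge0.
have [De|De] := leP D0 (e ^+ 2); last first.
  apply: (le_trans (flow_moment_dist_bound mS mS' SM t0)); rewrite -/D0.
  apply: (@le_trans _ _ (L2 * D0)); last first.
    by rewrite ler_wpM2r// lerDr; exact: expR_ge0.
  have e20 : 0 < e ^+ 2 by exact: exprn_gt0.
  rewrite /L2 [leRHS]mulrDl lerD2r -mulrA ler_peMr//.
    by rewrite mulr_ge0// sqr_ge0.
  by rewrite mulrC ler_pdivlMr// mul1r ltW.
have De' : moment_dist (m 0) (m' 0) (S 0) (S' 0) <= e ^+ 2 by [].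
have e1 : e <= 1 by rewrite ge_min lexx.
have e2 : e * (3 + M) <= c / 2.
  have : e <= c / (2 * (3 + M)) by rewrite ge_min lexx orbT.
  by rewrite ler_pdivlMr ?mulr_gt0 ?ltr_wpDr//; lra.
have trS0 : 0 <= \tr (S 0) by apply: psd_tr; exact: (second_psd mS).
have mb : sqF (m 0) <= M.
  rewrite (le_trans _ SM)// sqF_row -subr_ge0 -trace_mm -raddfB/=.
  by apply: psd_tr; exact: (cov_psd mS).
have dm : sqF (m 0 - m' 0) <= e ^+ 2 by rewrite (le_trans _ De)// lerDl sqF_ge0.
have dS : sqF (S 0 - S' 0) <= e ^+ 2 by rewrite (le_trans _ De)// lerDr sqF_ge0.
have SM' : \tr (S' 0) <= M + 1 + d%:R.
  have := trace_diff_sqr (S 0) (S' 0); set z := _ - _ => hz.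
  have : z ^+ 2 <= d%:R * 1.
    rewrite (le_trans hz)// ler_wpM2l// (le_trans dS)//.
    by rewrite expr_le1// ltW.
  have : \tr (S' 0) = \tr (S 0) - z by rewrite /z; ring.
  move=> -> hz1; have := sqr_ge0 (z + 1); nra.
have cS2 : coercive (c / 2) (S 0 - (m 0)^T *m m 0).
  move=> u; apply: le_trans (cS u); rewrite ler_wpM2r ?dot_ge0//; lra.
have cS' : coercive (c / 2) (S' 0 - (m' 0)^T *m m' 0).
  move=> u; have := cS u; have := dot_ge0 u.
  rewrite !bf_add !bf_opp !bf_rank1 !(dotC (m _)) !(dotC (m' _)).
  set a := dot u (m 0); set b := dot u (m' 0).
  have h1 := bf_le_sqF u e0 dS; rewrite bf_add bf_opp in h1.
  have h2 : (b - a) ^+ 2 <= e ^+ 2 * dot u u.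
    have -> : (b - a) ^+ 2 = dot u (m 0 - m' 0) ^+ 2.
      rewrite -sqrrN opprB; congr (_ ^+ 2).
      by rewrite /dot -sumrB; apply: eq_bigr => i _; rewrite !mxE mulrBr.
    apply: (le_trans (dot_CS _ _)); rewrite mulrC ler_wpM2r ?dot_ge0//.
    by rewrite -sqF_row.
  have h3 : a ^+ 2 <= M * dot u u.
    apply: (le_trans (dot_CS _ _)); rewrite mulrC ler_wpM2r ?dot_ge0//.
    by rewrite -sqF_row.
  move=> U0 h4.
  have h5 : e * (2 * a * (b - a)) <= e * (e * (M + 1) * dot u u).
    have := sqr_ge0 (e * a - (b - a)).
    have := ler_wpM2l (sqr_ge0 e) h3.
    lra.
  rewrite (ler_pM2l e0) in h5.
  have h6 : e ^+ 2 * dot u u <= e * dot u u.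
    by rewrite ler_wpM2r// expr2 ler_piMr// ltW.
  have h7 := ler_wpM2r U0 e2.
  lra.
have [mK SK] : (forall t i, 0 <= t -> `|m t 0 i| <= K * expR (- t)) /\
    (forall t, 0 <= t -> coercive (1 - K * expR (- t)) (S t)).
  split=> [r i|r] r0; have [] := HK _ _ mS cS2 _ r r0 => //; lra.
have mK' : forall t i, 0 <= t -> `|m' t 0 i| <= K * expR (- t).
  by move=> r i r0; have [] := HK _ _ mS' cS' _ r r0.
apply: (le_trans (flow_gronwall K0 mS mS' mK mK' SK t0)).
by rewrite -/L1 ler_wpM2r// lerDl.
Qed.

End stability.

(** * Calculus of the conjugating map *)


Section lines.
Context {R : realType} {V : normedModType R}.
Implicit Types (f g : V -> R) (x y u v : V).

Lemma is_derive_line f u y (s df : R) : is_derive (s *: u + y) u f df ->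
  is_derive s 1 (fun r : R => f (r *: u + y)) df.
Proof.
move=> [h1 h2].
have e : (fun h : R => h^-1 *: (((fun r : R =>
  f (r *: u + y)) \o shift s) (h *: (1 : R)) - f (s *: u + y)))
   = (fun h : R => h^-1 *: ((f \o shift (s *: u + y)) (h *: u) - f (s *: u + y))).
  by apply/funext => h /=; rewrite [_%:A]mulr1 scalerDl addrA.
apply: DeriveDef; first by rewrite /derivable e.
by rewrite -h2 /derive e.
Qed.

Lemma is_derive_of_line f u y (df : R) :
  is_derive (0 : R) 1 (fun r : R => f (r *: u + y)) df -> is_derive y u f df.
Proof.
move=> [h1 h2].
have e : (fun h : R => h^-1 *: (((fun r : R =>
  f (r *: u + y)) \o shift (0 : R)) (h *: (1 : R)) - f ((0:R) *: u + y)))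
   = (fun h : R => h^-1 *: ((f \o shift y) (h *: u) - f y)).
  by apply/funext => h /=; rewrite [_%:A]mulr1 addr0 scale0r add0r.
apply: DeriveDef; first by move: h1; rewrite /derivable e.
by rewrite -h2 /derive e.
Qed.

(** A directional derivative is a derivative along a line, which reduces the claim to the
    one-variable chain rule. *)
Lemma is_derive_chain (g : R -> R) f x v (df dg : R) :
  is_derive (f x) 1 g dg -> is_derive x v f df ->
  is_derive x v (fun z => g (f z)) (dg * df).
Proof.
move=> hg hf; apply: is_derive_of_line.
have hf' : is_derive (0 : R) 1 (fun r : R => f (r *: v + x)) df.
  by apply: is_derive_line; rewrite scale0r add0r.
apply: (@is_derive1_comp _ g (fun r : R => f (r *: v + x))).
by rewrite scale0r add0r.
Qed.

Lemma MVT_line f df u y (h : R) : 0 < h ->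
  (forall z, is_derive z u f (df z)) ->
  exists2 c : R, 0 <= c <= h & f (h *: u + y) - f y = h * df (c *: u + y).
Proof.
move=> h0 hf.
have hl (s : R) : is_derive s 1 (fun r : R => f (r *: u + y)) (df (s *: u + y)).
  exact: is_derive_line.
have [|c cin] := @MVT _ (fun r : R => f (r *: u + y)) (fun s =>
  df (s *: u + y)) _ _ h0 (fun s _ => hl s).
  apply: continuous_subspaceT => s; apply: differentiable_continuous.
  by apply/derivable1_diffP; have [] := hl s.
rewrite scale0r add0r subr0 mulrC => e; exists c => //.
by move: cin; rewrite in_itv/= => /andP[/ltW -> /ltW ->].
Qed.

Lemma second_difference f fu fuv u v x (h : R) : 0 < h ->
  (forall z, is_derive z u f (fu z)) -> (forall z, is_derive z v fu (fuv z)) ->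
  exists s t : R, [/\ 0 <= s <= h, 0 <= t <= h &
    f (h *: u + (h *: v + x)) - f (h *: u + x) - (f (h *: v + x) - f x) =
    h * (h * fuv (t *: v + (s *: u + x)))].
Proof.
move=> h0 hu huv.
have hg z : is_derive z u (fun y => f (h *: v + y) - f y) (fu (h *: v + z) - fu z).
  apply: is_derive_sub.
  apply: is_derive_of_line.
  under eq_fun do rewrite addrCA.
  by apply: is_derive_line; rewrite scale0r add0r; exact: hu.
have [s s01] := MVT_line x h0 hg.
have [t t01 ->] := MVT_line (s *: u + x) h0 huv.
move=> e; exists s, t; split=> //.
by rewrite -e addrCA.
Qed.

(** The second difference of [f] over the parallelogram spanned by [h u] and [h v] equals [h ^ 2]
    times a value of [fuv], and also [h ^ 2] times a value of [fvu], both taken near [x]. Continuity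
    at [x] lets [h] shrink. *)
Lemma derive_schwarz f fu fv fuv fvu u v x :
  (forall z, is_derive z u f (fu z)) -> (forall z, is_derive z v f (fv z)) ->
  (forall z, is_derive z v fu (fuv z)) -> (forall z, is_derive z u fv (fvu z)) ->
  {for x, continuous fuv} -> {for x, continuous fvu} -> fuv x = fvu x.
Proof.
move=> hu hv huv hvu cuv cvu; apply/eqP; rewrite -subr_eq0 -normr_eq0.
apply/eqP/le_anti; rewrite normr_ge0 andbT; apply/ler_addgt0Pl => e e0.
rewrite addr0.
have e20 : 0 < e / 2 by rewrite divr_gt0.
have [/= d1 d10 D1] := (nbhs_normP _ _).1 ((cvgrPdist_lt _ _).1 cuv _ e20).
have [/= d2 d20 D2] := (nbhs_normP _ _).1 ((cvgrPdist_lt _ _).1 cvu _ e20).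
pose k := 1 + `|u| + `|v|.
have k0 : 0 < k by rewrite /k -addrA ltr_pwDl// addr_ge0.
(* Chosen so that [h * k] is half of the smaller radius: every point of the parallelogram then lies
   in both neighbourhoods. *)
pose h := Num.min d1 d2 / (2 * k).
have m0 : 0 < Num.min d1 d2 by rewrite lt_min d10.
have h0 : 0 < h by rewrite divr_gt0// mulr_gt0.
have hk : h * k < Num.min d1 d2.
  rewrite /h invfM mulrA divfK ?gt_eqF//; lra.
have near_pt w z (a b : R) : `|w| + `|z| <= k -> 0 <= a <= h -> 0 <= b <= h ->
    `|x - (a *: w + (b *: z + x))| < Num.min d1 d2.
  move=> wz /andP[a0 ah] /andP[b0 bh]; apply: le_lt_trans hk.
  rewrite addrA opprD addrCA subrr addr0 normrN.
  rewrite (le_trans (ler_normD _ _))// !normrZ !ger0_norm//.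
  apply: (@le_trans _ _ (h * (`|w| + `|z|))); last by rewrite ler_pM2l.
  by rewrite mulrDr lerD// ler_wpM2r.
have [s [t [s01 t01 e1]]] := second_difference x h0 hu huv.
have [s' [t' [s01' t01' e2]]] := second_difference x h0 hv hvu.
have e3 : fuv (t *: v + (s *: u + x)) = fvu (t' *: u + (s' *: v + x)).
  apply: (@mulfI _ h); first by rewrite gt_eqF.
  apply: (@mulfI _ h); first by rewrite gt_eqF.
  rewrite -e1 -e2 [h *: v + (h *: u + x)]addrCA; ring.
have n1 := near_pt v u t s _ t01 s01; have n2 := near_pt u v t' s' _ t01' s01'.
have {}n1 := D1 _ (lt_le_trans (n1 _) _); have {}n2 := D2 _ (lt_le_trans (n2 _) _).
rewrite (_ : fuv x - fvu x = (fuv x - fuv (t *: v + (s *: u + x))) - (fvu x - fvu (t' *: u + (s'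
  *: v + x)))); last first.
  by rewrite e3; ring.
rewrite (le_trans (ler_normB _ _))// (splitr e) lerD// ltW//.
- by apply: n1; rewrite /k ?ge_min ?lexx//; lra.
- by apply: n2; rewrite /k ?ge_min ?lexx ?orbT//; lra.
Qed.

End lines.

(** * The SVGD integrand in conjugated coordinates *)

Section conjugation.
Context {R : realType} {d : nat}.
Local Notation E := 'rV[R]_d.

Lemma is_derive_entry (V : normedModType R) p q (F : V -> 'M[R]_(p, q)) x v i j :
  differentiable F x -> is_derive x v (fun z => F z i j) (('D_v F x) i j).
Proof.
move=> /(@diff_derivable _ _ _ _ _ v) dF; rewrite derive_mx// mxE.
by apply: derivableP; move/derivable_mxP : dF.
Qed.

Variable A : E -> E.
Hypothesis A3 : Ck 3 A.
Hypothesis oA : orientation_preserving A.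

Let A_diff x : differentiable A x. Proof. exact: A3.1. Qed.
Let A_diff2 i x : differentiable (partial i A) x. Proof. exact: (A3.2 i).1. Qed.

Lemma DA_partial x i j : DA A x i j = partial j A x 0 i.
Proof. by rewrite /partial deriveEjacobian// -rowE !mxE. Qed.

Lemma is_derive_A x v i :
  is_derive x v (fun z => A z 0 i) ((v *m (DA A x)^T) 0 i).
Proof.
apply: is_derive_eq; first exact: is_derive_entry.
by rewrite deriveEjacobian// trmxK.
Qed.

Lemma is_derive_A_delta x i j :
  is_derive x (delta_mx 0 j) (fun z => A z 0 i) (DA A x i j).
Proof. by apply: is_derive_eq; [exact: is_derive_A|rewrite -rowE !mxE]. Qed.

Definition hess k x : 'M[R]_d := \matrix_(i, j) partial k (partial j A) x 0 i.

Lemma is_derive_DA x k i j :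
  is_derive x (delta_mx 0 k) (fun z => DA A z i j) (hess k x i j).
Proof.
under eq_fun do rewrite DA_partial; rewrite mxE.
exact: is_derive_entry.
Qed.

Lemma continuous_entry (T : topologicalType) p q (F : T -> 'M[R]_(p, q)) i j x :
  {for x, continuous F} -> {for x, continuous (fun z => F z i j)}.
Proof.
move=> cF; apply: (@continuous_comp _ _ _ F (fun M : 'M[R]_(p, q) => M i j)) => //.
exact: coord_continuous.
Qed.

(** Schwarz's theorem. In [div2_KA2] this symmetry expresses the divergence of [invDA] through
    [trace_log_grad]. *)
Lemma hess_sym k x i j : hess k x i j = hess j x i k.
Proof.
have h l m z : is_derive z (delta_mx 0 m) (fun y => DA A y i l) (hess m z i l).
  exact: is_derive_DA.
apply: (@derive_schwarz _ _ (fun z => A z 0 i) (fun z => DA A z i j)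
  (fun z => DA A z i k) (fun z => hess k z i j) (fun z => hess j z i k)
  (delta_mx 0 j) (delta_mx 0 k) x) => //.
- by move=> z; exact: is_derive_A_delta.
- by move=> z; exact: is_derive_A_delta.
- have -> : (fun z => hess k z i j) = (fun z => partial k (partial j A) z 0 i).
    by apply/funext => z; rewrite mxE.
  by apply: continuous_entry; apply: differentiable_continuous; exact: ((A3.2 j).2 k).1.
- have -> : (fun z => hess j z i k) = (fun z => partial j (partial k A) z 0 i).
    by apply/funext => z; rewrite mxE.
  by apply: continuous_entry; apply: differentiable_continuous; exact: ((A3.2 k).2 j).1.
Qed.

Lemma DA_unit x : DA A x \in unitmx.
Proof. by rewrite unitmxE unitfE gt_eqF// oA. Qed.

Definition invDA x := invmx (DA A x).

Lemma is_derive_invDA x k i j :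
  is_derive x (delta_mx 0 k) (fun z => invDA z i j)
    ((- (invDA x *m hess k x *m invDA x)) i j).
Proof.
have -> : (fun z => invDA z i j) = (fun z => detadj (DA A z) i j).
  by apply/funext => z; rewrite detadj_inv// DA_unit.
apply: is_derive_detadj; last by move=> k' l; exact: is_derive_DA.
by rewrite -unitfE -unitmxE DA_unit.
Qed.

Lemma l2norm_sqr m n (B : 'M[R]_(m, n)) : l2norm B ^+ 2 = \sum_i \sum_j B i j ^+ 2.
Proof.
by rewrite /l2norm sqr_sqrtr//; apply: sumr_ge0 => i _; apply: sumr_ge0 => j _; exact: sqr_ge0.
Qed.

Lemma l2norm_row (u : E) : l2norm u ^+ 2 = dot u u.
Proof. by rewrite l2norm_sqr big_ord1; apply: eq_bigr => i _; rewrite expr2. Qed.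

Lemma is_derive_dotA x v (u : E) :
  is_derive x v (fun z => dot u (A z)) (dot u (v *m (DA A x)^T)).
Proof.
apply: is_derive_bigsum => i _; apply: is_derive_scale; exact: is_derive_A.
Qed.

(** The gradient of [ln (\det (DA A x))], as given by Jacobi's formula. *)
Definition trace_log_grad x : E := \row_k \tr (invDA x *m hess k x).

Lemma is_derive_VA x k :
  is_derive x (delta_mx 0 k) (VA A)
    ((- trace_log_grad x + A x *m DA A x) 0 k).
Proof.
have d0 := oA x.
have h1 : is_derive x (delta_mx 0 k) (fun z => ln (\det (DA A z)))
    ((\det (DA A x))^-1 * \tr (\adj (DA A x) *m hess k x)).
  apply: (@is_derive_chain _ _ (@ln R) (fun z => \det (DA A z))).
    exact: is_derive1_ln.
  by apply: is_derive_det => i j; exact: is_derive_DA.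
have h2 : is_derive x (delta_mx 0 k) (fun z => dot (A z) (A z))
    (\sum_i (DA A x i k * A x 0 i + A x 0 i * DA A x i k)).
  by apply: is_derive_bigsum => i _; apply: is_derive_mul; exact: is_derive_A_delta.
have -> : VA A = (fun z => - ln (\det (DA A z)) + 2^-1 * dot (A z) (A z)).
  by apply/funext => z; rewrite /VA l2norm_row mulrC.
have h3 := is_derive_add (is_derive_opp h1) (is_derive_scale 2^-1 h2).
apply: is_derive_eq.
rewrite [RHS]mxE !mxE /invDA /invmx DA_unit -scalemxAl mxtraceZ; congr (_ + _).
by rewrite mulr_sumr; apply: eq_bigr => i _; rewrite [DA A x i k * _]mulrC; field.
Qed.

(** The velocity field sees [V] only through its gradient, so the unknown normalisation costs just
    an additive constant. *)
Lemma potential_shift V : potential_of (piA_density A) V ->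
  exists c : R, V = fun x => VA A x + c.
Proof.
move=> [Z [Z0 h]].
have c0 : 0 < ((2 * pi) `^ (- (d%:R / 2))) * Z :> R.
  by rewrite mulr_gt0// powR_gt0// mulr_gt0// pi_gt0.
exists (- ln (((2 * pi) `^ (- (d%:R / 2))) * Z)); apply/funext => x.
have := h x; rewrite /piA_density => /(congr1 (fun r => r * Z)).
rewrite mulfVK ?gt_eqF// mulrAC => /(congr1 (@ln R)).
set c := _ * Z in c0 *; rewrite (@lnM _ c) ?posrE ?expR_gt0// !expRK => e; lra.
Qed.

Lemma grad_potential V x : potential_of (piA_density A) V ->
  grad V x = - trace_log_grad x + A x *m DA A x.
Proof.
move=> /potential_shift[c ->]; apply/rowP => k; rewrite [LHS]mxE.
have := is_derive_add (is_derive_VA x k) (is_derive_cst c x (delta_mx 0 k)).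
by move=> /(@derive_val _ _ _ _ _ _ _); rewrite addr0.
Qed.

Lemma KA2E x y : KA2 A x y = (1 + dot (A x) (A y)) *: (invDA x *m (invDA y)^T).
Proof. by []. Qed.

(** Differentiating the scalar factor contracts [DA A y] with [invDA y] and leaves [A x];
    differentiating [invDA] yields, by [hess_sym], the gradient of the log-determinant. *)
Lemma div2_KA2 x y : div2 (KA2 A) x y =
  (A x - (1 + dot (A x) (A y)) *: (trace_log_grad y *m invDA y)) *m (invDA x)^T.
Proof.
apply/rowP => a; rewrite [LHS]mxE.
have h b : is_derive y (delta_mx 0 b) (fun z => KA2 A x z a b)
   (\sum_c invDA x a c * (dot (A x) (delta_mx 0 b *m (DA A y)^T) * invDA y b c +
      (1 + dot (A x) (A y)) * (- (invDA y *m hess b y *m invDA y)) b c)).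
  have -> : (fun z => KA2 A x z a b) =
      (fun z => \sum_c invDA x a c * ((1 + dot (A x) (A z)) * invDA z b c)).
    apply/funext => z.
    rewrite KA2E [LHS]mxE [X in _ * X]mxE mulr_sumr; apply: eq_bigr => c _.
    by rewrite [(invDA z)^T c b]mxE mulrCA.
  apply: is_derive_bigsum => c _; apply: is_derive_scale; apply: is_derive_mul.
    rewrite -[X in is_derive _ _ _ X]add0r; apply: is_derive_add.
    exact: is_derive_dotA.
  exact: is_derive_invDA.
rewrite /partial; under eq_bigr do rewrite (@derive_val _ _ _ _ _ _ _ (h _)).
rewrite exchange_big/= [RHS]mxE; apply: eq_bigr => c _.
rewrite -mulr_sumr mulrC [(invDA x)^T c a]mxE; congr (_ * _).
rewrite big_split/= [RHS]mxE; congr (_ + _).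
  transitivity ((A x *m DA A y *m invDA y) 0 c); last by rewrite mulmxK// DA_unit.
  rewrite [RHS]mxE; apply: eq_bigr => b _; congr (_ * _); rewrite mxE.
  by apply: eq_bigr => e _; rewrite -rowE [X in _ * X]mxE mxE.
rewrite -mulr_sumr [RHS]mxE [X in _ = - X]mxE -mulrN; congr (_ * _).
rewrite [X in _ = - X]mxE -sumrN.
under eq_bigr do rewrite mxE mxE -sumrN.
rewrite exchange_big/=; apply: eq_bigr => q _; rewrite sumrN; congr (- _).
rewrite -mulr_suml; congr (_ * _); rewrite [RHS]mxE.
apply: eq_bigr => b _; rewrite [LHS]mxE [RHS]mxE; apply: eq_bigr => p _.
by congr (_ * _); exact: hess_sym.
Qed.

(** The log-determinant part of the gradient of [V] cancels against the divergence of the factor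
    [invDA] of the kernel. Up to the outer factor at [x], what remains is SVGD for the standard
    Gaussian in the coordinates [A x]. *)
Lemma svgd_integrandE V x y : potential_of (piA_density A) V ->
  svgd_integrand V (KA2 A) x y =
  (A x - (1 + dot (A x) (A y)) *: A y) *m (invDA x)^T.
Proof.
move=> hV; rewrite /svgd_integrand (grad_potential _ hV) div2_KA2.
rewrite KA2E; set k := 1 + _.
rewrite linearZ/= trmx_mul trmxK -scalemxAr mulmxA.
rewrite [_ *m invDA y]mulmxDl mulmxK ?DA_unit// scalemxAl -mulNmx -mulmxDl.
congr (_ *m _); rewrite scalerDr mulNmx.
by move: (trace_log_grad y *m invDA y) => T; apply/rowP => i; rewrite !mxE; ring.
Qed.

End conjugation.

(** * Moments and the velocity field *)


Lemma rV_continuous_measurable (R : realType) (d : nat) (f : 'rV[R]_d -> R) :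
  continuous f -> measurable_fun setT f.
Proof.
move=> /continuousP cf; apply: (measurability _ (RGenOInfty.measurableE R)).
move=> _ [_ [a ->] <-]; rewrite setTI.
by apply: sub_sigma_algebra; apply: cf; exact: interval_open.
Qed.

(** * Integrals of real-valued functions *)

Section real_integration.
Context d (T : measurableType d) (R : realType) (mu : {measure set T -> \bar R}).
Implicit Types f g : T -> R.

Definition rint f := mu.-integrable setT (EFin \o f).

Lemma rint_measurable f : rint f -> measurable_fun setT f.
Proof. by move=> /integrableP[/measurable_EFinP]. Qed.

Lemma rint_ext f g : (forall x, f x = g x) -> rint f -> rint g.
Proof. by move=> /funext ->. Qed.

Lemma rint_add f g : rint f -> rint g -> rint (fun x => f x + g x).
Proof. by move=> hf hg; exact: (integrableD measurableT hf hg). Qed.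

Lemma rint_scale k f : rint f -> rint (fun x => k * f x).
Proof. by move=> hf; exact: (integrableZl measurableT k hf). Qed.

Lemma rint_opp f : rint f -> rint (fun x => - f x).
Proof.
move=> hf; have -> : (fun x => - f x) = (fun x => -1 * f x).
  by apply/funext => x; rewrite mulN1r.
exact: rint_scale.
Qed.

Lemma rint_sub f g : rint f -> rint g -> rint (fun x => f x - g x).
Proof. by move=> hf /rint_opp; exact: rint_add. Qed.

Lemma rint0 : rint (fun=> 0).
Proof. exact: integrable0. Qed.

Lemma rint_bigsum (I : Type) (r : seq I) (P : pred I) (F : I -> T -> R) :
  (forall i, P i -> rint (F i)) -> rint (fun x => \sum_(i <- r | P i) F i x).
Proof.
move=> h; elim: r => [|i r IH].
  by apply: (rint_ext _ rint0) => x; rewrite big_nil.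
have [Pi|Pi] := boolP (P i).
  by apply: (rint_ext _ (rint_add (h i Pi) IH)) => x; rewrite big_cons Pi.
by apply: (rint_ext _ IH) => x; rewrite big_cons (negPf Pi).
Qed.

Lemma rint_norm f : rint f -> rint (fun x => `|f x|).
Proof. exact: integrable_norm. Qed.

Lemma rint_le f g : measurable_fun setT f -> rint g ->
  (forall x, `|f x| <= g x) -> rint f.
Proof.
move=> mf hg fg; apply: (le_integrable measurableT _ _ hg).
  exact/measurable_EFinP.
by move=> x _; rewrite /= lee_fin (le_trans (fg x))// ler_norm.
Qed.

Lemma Rint_add f g : rint f -> rint g ->
  \int[mu]_x (f x + g x) = \int[mu]_x f x + \int[mu]_x g x.
Proof. exact: RintegralD. Qed.

Lemma Rint_sub f g : rint f -> rint g ->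
  \int[mu]_x (f x - g x) = \int[mu]_x f x - \int[mu]_x g x.
Proof. exact: RintegralB. Qed.

Lemma Rint_scale k f : rint f -> \int[mu]_x (k * f x) = k * \int[mu]_x f x.
Proof. exact: RintegralZl. Qed.

Lemma Rint_zero : \int[mu]_x (0 : R) = 0.
Proof. by rewrite Rintegral_cst// mul0r. Qed.

Lemma Rint_bigsum (I : Type) (r : seq I) (P : pred I) (F : I -> T -> R) :
  (forall i, P i -> rint (F i)) ->
  \int[mu]_x (\sum_(i <- r | P i) F i x) = \sum_(i <- r | P i) \int[mu]_x F i x.
Proof.
move=> h; elim: r => [|i r IH].
  by rewrite big_nil -[RHS]Rint_zero; apply: eq_Rintegral => x _; rewrite big_nil.
rewrite big_cons -IH; have [Pi|Pi] := boolP (P i).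
  rewrite -Rint_add; [|exact: h|exact: rint_bigsum].
  by apply: eq_Rintegral => x _; rewrite big_cons Pi.
by apply: eq_Rintegral => x _; rewrite big_cons (negPf Pi).
Qed.

Lemma Rint_le f g : rint f -> rint g -> (forall x, f x <= g x) ->
  \int[mu]_x f x <= \int[mu]_x g x.
Proof. by move=> hf hg fg; apply: le_Rintegral. Qed.

Lemma Rint_norm_le f g : rint f -> rint g -> (forall x, `|f x| <= g x) ->
  `|\int[mu]_x f x| <= \int[mu]_x g x.
Proof.
move=> hf hg fg; apply: (le_trans (le_normr_Rintegral measurableT hf)).
by apply: Rint_le => //; exact: rint_norm.
Qed.

Hypothesis mass1 : mu setT = 1%E.

Lemma rint_cst k : rint (fun=> k).
Proof.
apply/integrableP; split; first exact: measurable_cst.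
by rewrite integral_cst// mass1 mule1 ltry.
Qed.

Lemma Rint_cst k : \int[mu]_x (k : R) = k.
Proof. by rewrite Rintegral_cst// mass1 mulr1. Qed.

End real_integration.

Lemma Rintegral_dct d (T : measurableType d) (R : realType)
    (mu : {measure set T -> \bar R}) (D : set T) (f_ : nat -> T -> R) (f g : T -> R) :
  measurable D -> (forall n, measurable_fun D (f_ n)) ->
  mu.-integrable D (EFin \o g) ->
  (forall x, D x -> (fun n => f_ n x) @ \oo --> f x) ->
  (forall n x, D x -> `|f_ n x| <= g x) ->
  mu.-integrable D (EFin \o f) /\
  (fun n => \int[mu]_(x in D) f_ n x) @ \oo --> \int[mu]_(x in D) f x.
Proof.
move=> mD mf ig ff fg.
have mf' : measurable_fun D (EFin \o f).
  apply/measurable_EFinP.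
  exact: (measurable_fun_cvg (h := f_)).
have [|||h1 _ h2] := @dominated_convergence _ _ _ mu D mD (fun n x =>
  (f_ n x)%:E) (EFin \o f) (EFin \o g) _ mf' _ ig.
- by move=> n; apply/measurable_EFinP.
- by apply: aeW => x Dx; apply: cvg_EFin; [exact: nearW|exact: ff].
- by apply: aeW => x n Dx; rewrite /= lee_fin fg.
split=> //; apply: fine_cvg; rewrite fineK; first exact: h2.
exact: (integrable_fin_num mD h1).
Qed.

Section moments.
Context {R : realType} {d : nat}.
Local Notation E := 'rV[R]_d.
Variable A : E -> E.

(* The coordinates of [(1, A x)]: means and second moments are then both of the form [augmom]. *)
Definition aug (o : option 'I_d) (x : E) : R := if o is Some i then A x 0 i else 1.

Variable rho : {measure set E -> \bar R}.

Definition L2moments := forall o o', rint rho (fun x => aug o x * aug o' x).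

Definition augmom o o' : R := \int[rho]_x (aug o x * aug o' x).

Hypothesis mass1 : rho setT = 1%E.
Hypothesis L2 : L2moments.

Lemma augmomC o o' : augmom o o' = augmom o' o.
Proof. by apply: eq_Rintegral => x _; rewrite mulrC. Qed.

Lemma augmom_None : augmom None None = 1.
Proof.
by rewrite /augmom; under eq_Rintegral do rewrite mulr1; rewrite Rint_cst.
Qed.

Lemma mean_augmom i : mean_mx A rho 0 i = augmom (Some i) None.
Proof. by rewrite mxE; apply: eq_Rintegral => x _; rewrite /= mulr1. Qed.

Lemma second_augmom i j : second_moment_mx A rho i j = augmom (Some i) (Some j).
Proof. by rewrite mxE. Qed.

Lemma second_moment_sym : (second_moment_mx A rho)^T = second_moment_mx A rho.
Proof. by apply/matrixP => i j; rewrite mxE !second_augmom augmomC. Qed.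

Lemma rint_coord i : rint rho (fun x => A x 0 i).
Proof. by apply: (rint_ext _ (L2 (Some i) None)) => x; rewrite mulr1. Qed.

Lemma rint_prod i j : rint rho (fun x => A x 0 i * A x 0 j).
Proof. exact: (L2 (Some i) (Some j)). Qed.

(** The form at [u] is the variance of [dot u (A x)]. *)
Lemma cov_moment_psd :
  psd (second_moment_mx A rho - (mean_mx A rho)^T *m mean_mx A rho).
Proof.
move=> u; set m := mean_mx A rho; set S := second_moment_mx A rho.
rewrite bf_add bf_opp bf_rank1 (dotC m).
have i1 : rint rho (fun x => dot u (A x)).
  by apply: rint_bigsum => i _; apply: rint_scale; exact: rint_coord.
have i2 : rint rho (fun x => dot u (A x) ^+ 2).
  apply: (@rint_ext _ _ _ _ (fun x => \sum_i \sum_j (u 0 i * u 0 j) * (A x 0 i * A x 0 j))).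
    move=> x; rewrite expr2 {1}/dot mulr_suml; apply: eq_bigr => i _.
    by rewrite mulr_sumr; apply: eq_bigr => j _; ring.
  by apply: rint_bigsum => i _; apply: rint_bigsum => j _; apply: rint_scale; exact: rint_prod.
have e1 : \int[rho]_x dot u (A x) = dot u m.
  rewrite Rint_bigsum; last by move=> i _; apply: rint_scale; exact: rint_coord.
  by apply: eq_bigr => i _; rewrite Rint_scale ?mxE//; exact: rint_coord.
have e2 : \int[rho]_x dot u (A x) ^+ 2 = bf S u u.
  transitivity (\int[rho]_x (\sum_i \sum_j (u 0 i * u 0 j) * (A x 0 i * A x 0 j))).
    apply: eq_Rintegral => x _; rewrite expr2 {1}/dot mulr_suml; apply: eq_bigr => i _.
    by rewrite mulr_sumr; apply: eq_bigr => j _; ring.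
  rewrite Rint_bigsum; last first.
    by move=> i _; apply: rint_bigsum => j _; apply: rint_scale; exact: rint_prod.
  rewrite bfE; apply: eq_bigr => i _.
  rewrite Rint_bigsum; last by move=> j _; apply: rint_scale; exact: rint_prod.
  apply: eq_bigr => j _; rewrite Rint_scale; last exact: rint_prod.
  by rewrite mxE mulrAC.
have : 0 <= \int[rho]_x ((dot u (A x) ^+ 2 + (- (2 * dot u m)) * dot u (A x)) + dot u m ^+ 2).
  apply: Rintegral_ge0 => x _.
  by have := sqr_ge0 (dot u (A x) - dot u m); lra.
rewrite Rint_add; [|by apply: rint_add => //; exact: rint_scale|exact: rint_cst].
rewrite Rint_add//; last exact: rint_scale.
rewrite Rint_scale// e1 e2 Rint_cst//.
by move=> h; lra.
Qed.

Hypothesis A3 : Ck 3 A.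
Hypothesis oA : orientation_preserving A.

Definition drift (m : E) (S : 'M[R]_d) (x : E) : E := A x - A x *m S - m.

Lemma drift_entry m S x c :
  drift m S x 0 c = A x 0 c - \sum_e A x 0 e * S e c - m 0 c.
Proof. by rewrite /drift !mxE. Qed.

(** The integral of [daug o (drift x) * aug o' x], written as a polynomial in the moments: the
    closure of the system and the continuity in time of its right-hand side become visible. *)
Definition drift_moment o o' : R := if o is Some c then
  augmom (Some c) o' - \sum_e second_moment_mx A rho e c * augmom (Some e) o'
    - mean_mx A rho 0 c * augmom None o'
  else 0.

(** The differential of [aug o] at a velocity [a] expressed in the coordinates [A x]; the constant
    coordinate has differential 0. *)
Definition daug (o : option 'I_d) (a : E) : R := if o is Some i then a 0 i else 0.

Let w x := drift (mean_mx A rho) (second_moment_mx A rho) x.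

Lemma drift_moment_int o o' :
  rint rho (fun x => daug o (w x) * aug o' x) /\
  \int[rho]_x (daug o (w x) * aug o' x) = drift_moment o o'.
Proof.
case: o => [c|] /=; last first.
  split; first by apply: (rint_ext _ (rint0 rho)) => x; rewrite mul0r.
  by under eq_Rintegral do rewrite mul0r; rewrite Rint_zero.
have e x : w x 0 c * aug o' x = aug (Some c) x * aug o' x -
    \sum_e second_moment_mx A rho e c * (aug (Some e) x * aug o' x) -
    mean_mx A rho 0 c * (aug None x * aug o' x).
  rewrite drift_entry /= mul1r !mulrBl mulr_suml.
  by congr (_ - _ - _); apply: eq_bigr => k _; ring.
have i1 : rint rho (fun x => \sum_e second_moment_mx A rho e c * (aug (Some e) x * aug o' x)).
  by apply: rint_bigsum => k _; apply: rint_scale; exact: L2.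
have i2 : rint rho (fun x => mean_mx A rho 0 c * (aug None x * aug o' x)).
  by apply: rint_scale; exact: L2.
have i0 := L2 (Some c) o'.
split.
  by apply: (rint_ext _ (rint_sub (rint_sub i0 i1) i2)) => x; rewrite e.
under eq_Rintegral do rewrite e.
rewrite Rint_sub//; last exact: rint_sub.
rewrite Rint_sub// Rint_bigsum; last by move=> k _; apply: rint_scale; exact: L2.
rewrite Rint_scale; last exact: L2.
by congr (_ - _ - _); apply: eq_bigr => k _; rewrite Rint_scale//; exact: L2.
Qed.

Lemma drift_moments_int o o' :
  \int[rho]_x (daug o (w x) * aug o' x + aug o x * daug o' (w x)) =
  drift_moment o o' + drift_moment o' o.
Proof.
have [i1 <-] := drift_moment_int o o'; have [i2 <-] := drift_moment_int o' o.
rewrite -Rint_add//.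
by apply: eq_Rintegral => x _; rewrite [aug o x * _]mulrC.
Qed.

(** The integrand is a quadratic polynomial in [A y], so integration brings in the first two moments
    only. *)
Lemma svgd_velocityE V x : potential_of (piA_density A) V ->
  svgd_velocity V (KA2 A) rho x =
  drift (mean_mx A rho) (second_moment_mx A rho) x *m (invDA A x)^T.
Proof.
move=> hV; apply/rowP => a; rewrite [LHS]mxE.
set M := (invDA A x)^T.
transitivity (\int[rho]_y (\sum_c M c a * ((A x 0 c - A y 0 c) -
    \sum_e A x 0 e * (A y 0 e * A y 0 c)))).
  apply: eq_Rintegral => y _; rewrite svgd_integrandE// [LHS]mxE.
  apply: eq_bigr => c _; rewrite mulrC; congr (_ * _).
  rewrite [LHS]mxE [X in _ + X]mxE [X in _ - X]mxE mulrDl mul1r opprD addrA.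
  congr (_ - _); rewrite mulr_suml; apply: eq_bigr => e _; ring.
have i1 c : rint rho (fun y => \sum_e A x 0 e * (A y 0 e * A y 0 c)).
  by apply: rint_bigsum => e _; apply: rint_scale; exact: rint_prod.
have i2 c : rint rho (fun y => A x 0 c - A y 0 c).
  by apply: rint_sub; [exact: rint_cst|exact: rint_coord].
rewrite Rint_bigsum; last by move=> c _; apply: rint_scale; apply: rint_sub.
rewrite [RHS]mxE; apply: eq_bigr => c _; rewrite Rint_scale; last exact: rint_sub.
rewrite mulrC; congr (_ * _); rewrite Rint_sub// Rint_sub; [|exact: rint_cst|exact: rint_coord].
rewrite Rint_cst// Rint_bigsum; last by move=> e _; apply: rint_scale; exact: rint_prod.
rewrite [RHS]mxE [X in _ = X + _]mxE -[RHS]addrA; rewrite -[LHS]addrA; congr (_ + _).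
rewrite addrC [X in _ = _ + X]mxE [X in _ = _ - X]mxE; congr (_ - _).
rewrite [RHS]mxE; congr (- _); rewrite [RHS]mxE; apply: eq_bigr => e _.
by rewrite Rint_scale ?mxE//; exact: rint_prod.
Qed.

End moments.

(** After integration, the leading [A x] of the drift cancels [- m] in the mean equation and leaves
    [- m S]. In the second-moment equation the two transposed halves add up. *)
Lemma moment_flow_of_augmom (R : realType) (d : nat) (A : 'rV[R]_d -> 'rV[R]_d)
    (mu : R -> {measure set 'rV[R]_d -> \bar R}) :
  (forall t, mu t setT = 1%E) -> (forall t : R, 0 <= t -> L2moments A (mu t)) ->
  (forall o o', evolves (fun t => augmom A (mu t) o o')
    (fun t => drift_moment A (mu t) o o' + drift_moment A (mu t) o' o)) ->
  moment_flow (fun t => mean_mx A (mu t)) (fun t => second_moment_mx A (mu t)).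
Proof.
move=> mass1 L2 ev; split.
- move=> i j; rewrite (ord1 i).
  have -> : (fun t => mean_mx A (mu t) 0 j) = (fun t => augmom A (mu t) (Some j) None).
    by apply/funext => t; rewrite mean_augmom.
  apply: evolves_eq (ev (Some j) None) => t /ltW t0.
  rewrite /= addr0 (augmom_None A (mass1 t)) mulr1 -mean_augmom.
  rewrite addrAC subrr add0r [RHS]mxE; congr (- _); rewrite [RHS]mxE.
  by apply: eq_bigr => e _; rewrite mulrC -mean_augmom.
- move=> i j.
  have -> : (fun t => second_moment_mx A (mu t) i j) = (fun t => augmom A (mu t) (Some i) (Some j)).
    by apply/funext => t; rewrite second_augmom.
  apply: evolves_eq (ev (Some i) (Some j)) => t /ltW t0.
  rewrite /= -!second_augmom ![augmom _ _ None _]augmomC -!mean_augmom.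
  have sS k l : second_moment_mx A (mu t) k l = second_moment_mx A (mu t) l k.
    by rewrite !second_augmom augmomC.
  have e1 : \sum_e second_moment_mx A (mu t) e i * augmom A (mu t) (Some e) (Some j) =
      \sum_e second_moment_mx A (mu t) i e * second_moment_mx A (mu t) e j.
    by apply: eq_bigr => e _; rewrite -second_augmom (sS e i).
  have e2 : \sum_e second_moment_mx A (mu t) e j * augmom A (mu t) (Some e) (Some i) =
      \sum_e second_moment_mx A (mu t) i e * second_moment_mx A (mu t) e j.
    by apply: eq_bigr => e _; rewrite -second_augmom mulrC (sS e i).
  rewrite e1 e2 (sS j i); move: (second_moment_mx A (mu t)) (mean_mx A (mu t)) => H n.
  by rewrite !mxE big_ord1 !mxE; ring.
- by move=> t t0; exact: second_moment_sym.
- by move=> t t0; apply: cov_moment_psd; [exact: mass1|exact: L2].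
Qed.

(** * Moments of weak solutions *)


Section cutoff_function.
Context {R : realType}.
Implicit Types r : R.

Definition pos r := (r + `|r|) / 2.

Lemma pos_ge0 r : 0 <= pos r.
Proof. by rewrite /pos; have := ler_norm (- r); rewrite normrN; lra. Qed.

Lemma pos_id r : 0 <= r -> pos r = r.
Proof. by move=> r0; rewrite /pos ger0_norm//; lra. Qed.

Lemma pos_eq0 r : r <= 0 -> pos r = 0.
Proof. by move=> r0; rewrite /pos ler0_norm//; lra. Qed.

Lemma continuous_pos : continuous pos.
Proof.
move=> r; apply: cvgM; last exact: cvg_cst.
by apply: cvgD; [exact: cvg_id|exact: norm_continuous].
Qed.

(** Squaring smooths the kink of [pos]: the first-order remainder is at most [h ^+ 2] in each of the
    four sign cases for [r] and [h + r]. *)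
Lemma is_derive_pos_sqr r : is_derive r 1 (fun s : R => pos s ^+ 2) (2 * pos r).
Proof.
have cv : h^-1 *: (pos (h *: 1 + r) ^+ 2 - pos r ^+ 2) @[h --> 0^'] --> 2 * pos r.
  apply/cvgrPdist_le => /= e e0.
  near=> h.
  have h0 : h != 0 by near: h; exact: nbhs_dnbhs_neq.
  have he : `|h| <= e.
    near: h; apply: nbhs_dnbhs; apply/nbhs_normP; exists e => //= y.
    by rewrite /ball_/= sub0r normrN => /ltW.
  have bnd : `|2 * pos r * h - (pos (h + r) ^+ 2 - pos r ^+ 2)| <= `|h| ^+ 2.
    rewrite real_normK ?num_real// ler_norml.
    have [hr|hr] := leP 0 (h + r); have [r0|r0] := leP 0 r;
      rewrite ?(pos_id hr) ?(pos_eq0 (ltW hr)) ?(pos_id r0) ?(pos_eq0 (ltW r0));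
      apply/andP; split; nra.
  rewrite [_%:A]mulr1.
  have -> : 2 * pos r - h^-1 *: (pos (h + r) ^+ 2 - pos r ^+ 2) =
      h^-1 * (2 * pos r * h - (pos (h + r) ^+ 2 - pos r ^+ 2)).
    by rewrite /GRing.scale/=; field.
  by apply: le_trans he; rewrite normrM normfV ler_pdivrMl ?normr_gt0// -expr2.
apply: DeriveDef; first by apply/cvg_ex; eexists; exact: cv.
by rewrite /derive; apply/cvg_lim => //; exact: cv.
Unshelve. all: by end_near. Qed.

(** The squared positive part is of class [C^1], the regularity asked of test functions. *)
Definition cutoff r := pos (1 - r) ^+ 2.

Lemma is_derive_cut r : is_derive r 1 cutoff (- 2 * pos (1 - r)).
Proof.
have h1 : is_derive r 1 (fun s : R => 1 - s) (- 1).
  rewrite -[X in is_derive _ _ _ X]add0r.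
  by apply: is_derive_add; apply: is_derive_opp; exact: is_derive_id.
have -> : - 2 * pos (1 - r) = 2 * pos (1 - r) * (- 1) by ring.
exact: (@is_derive_chain _ _ (fun s : R => pos s ^+ 2) (fun s : R =>
  1 - s) r 1 _ _ (is_derive_pos_sqr _) h1).
Qed.

Lemma cutoff_ge0 r : 0 <= cutoff r.
Proof. exact: sqr_ge0. Qed.

Lemma cutoff_le1 r : 0 <= r -> cutoff r <= 1.
Proof.
move=> r0; rewrite /cutoff expr_le1// ?pos_ge0//.
have [h|h] := leP 0 (1 - r); first by rewrite pos_id//; lra.
by rewrite pos_eq0// ltW.
Qed.

Lemma cutoff_eq0 r : 1 <= r -> cutoff r = 0.
Proof. by move=> r1; rewrite /cutoff pos_eq0 ?expr0n//; lra. Qed.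

Lemma differentiable_cut r : differentiable cutoff r.
Proof. by apply/derivable1_diffP; have [] := is_derive_cut r. Qed.

Lemma cutoff_cvg (a : R) : (fun n => cutoff (a / n.+1%:R)) @ \oo --> (1 : R).
Proof.
have e0 : cutoff 0 = 1 :> R by rewrite /cutoff subr0 pos_id// expr1n.
have c0 : {for (0:R), continuous cutoff}.
  exact: differentiable_continuous (differentiable_cut 0).
rewrite -[X in _ --> X]e0.
apply: (@cvg_comp _ _ _ (fun n : nat =>
  a / n.+1%:R) cutoff \oo (nbhs (0 : R)) (nbhs (cutoff 0)) _ c0).
rewrite -(mulr0 a); apply: cvgM; first exact: cvg_cst.
exact: cvg_harmonic.
Qed.

End cutoff_function.

Section test_functions.
Context {R : realType} {d : nat}.
Local Notation E := 'rV[R]_d.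
Variable A : E -> E.
Hypothesis A3 : Ck 3 A.

Let A_diff x : differentiable A x. Proof. exact: A3.1. Qed.

Definition qA (x : E) : R := dot (A x) (A x).

Definition test n o o' x := aug A o x * aug A o' x * cutoff (qA x / n.+1%:R).

(** The differential of [test], as a function of a direction already pushed forward by [DA]. For the
    velocity field the factor [invDA] cancels and [a] becomes [drift]. *)
Definition dtest n o o' x (a : E) :=
  (daug o a * aug A o' x + aug A o x * daug o' a) * cutoff (qA x / n.+1%:R) +
  aug A o x * aug A o' x * (- 2 * pos (1 - qA x / n.+1%:R) * (2 * dot (A x) a / n.+1%:R)).

Lemma differentiable_A x i : differentiable (fun z => A z 0 i) x.
Proof.
by apply: (@differentiable_comp _ _ _ _ A (fun M : E => M 0 i)) => //; exact: differentiable_coord.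
Qed.

Lemma differentiable_aug x o : differentiable (aug A o) x.
Proof. by case: o => [i|]; [exact: differentiable_A|exact: differentiable_cst]. Qed.

Lemma is_derive_aug x v o : is_derive x v (aug A o) (daug o (v *m (DA A x)^T)).
Proof. by case: o => [i|]; [exact: is_derive_A|exact: is_derive_cst]. Qed.

Lemma differentiable_qA x : differentiable qA x.
Proof.
have -> : qA = \sum_(i < d) ((fun z => A z 0 i) * (fun z => A z 0 i)).
  by apply/funext => z; rewrite fct_sumE.
by apply: differentiable_sum => i; apply: differentiableM; exact: differentiable_A.
Qed.

Lemma is_derive_qA x v : is_derive x v qA (2 * dot (A x) (v *m (DA A x)^T)).
Proof.
have h : is_derive x v qA (\sum_i ((v *m (DA A x)^T) 0 i * A x 0 i + A x 0 i * (v *m (DA A x)^T)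
  0 i)).
  by apply: is_derive_bigsum => i _; apply: is_derive_mul; exact: is_derive_A.
apply: is_derive_eq; rewrite mulr_sumr; apply: eq_bigr => i _.
by rewrite mulrC; ring.
Qed.

Lemma differentiable_cutq n x : differentiable (fun z => cutoff (qA z / n.+1%:R)) x.
Proof.
apply: (@differentiable_comp _ _ _ _ (fun z => qA z / n.+1%:R) cutoff);
  last exact: differentiable_cut.
have -> : (fun z => qA z / n.+1%:R) = (n.+1%:R^-1 : R) *: qA.
  by apply/funext => z; rewrite mulrC.
by apply: differentiableZ; exact: differentiable_qA.
Qed.

Lemma is_derive_test n o o' x v :
  is_derive x v (test n o o') (dtest n o o' x (v *m (DA A x)^T)).
Proof.
apply: is_derive_mul; first by apply: is_derive_mul; exact: is_derive_aug.
apply: (@is_derive_chain _ _ cutoff (fun z => qA z / n.+1%:R)); first exact: is_derive_cut.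
have -> : (fun z => qA z / n.+1%:R) = (fun z => (n.+1%:R^-1 : R) * qA z).
  by apply/funext => z; rewrite mulrC.
rewrite [X in is_derive _ _ _ X]mulrC.
by apply: is_derive_scale; exact: is_derive_qA.
Qed.

Lemma differentiable_test n o o' x : differentiable (test n o o') x.
Proof.
apply: differentiableM; last exact: differentiable_cutq.
by apply: differentiableM; exact: differentiable_aug.
Qed.

Lemma dot_grad (f : E -> R) x u : differentiable f x ->
  dot (grad f x) u = 'D_u f x.
Proof.
move=> df; rewrite [in RHS](row_sum_delta u) deriveE// linear_sum.
by apply: eq_bigr => i _; rewrite linearZ mxE /partial deriveE// mulrC.
Qed.

Lemma dot_grad_test n o o' x u :
  dot (grad (test n o o') x) u = dtest n o o' x (u *m (DA A x)^T).
Proof.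
rewrite dot_grad; last exact: differentiable_test.
by have h := is_derive_test n o o' x u; rewrite derive_val.
Qed.

Lemma continuous_aug o : continuous (aug A o).
Proof. by move=> x; apply: differentiable_continuous; exact: differentiable_aug. Qed.

Lemma continuous_qA : continuous qA.
Proof. by move=> x; apply: differentiable_continuous; exact: differentiable_qA. Qed.

Lemma continuous_cutq n : continuous (fun z => cutoff (qA z / n.+1%:R)).
Proof. by move=> x; apply: differentiable_continuous; exact: differentiable_cutq. Qed.

Lemma for_continuous_add (T : topologicalType) (f g : T -> R) (x : T) :
  {for x, continuous f} -> {for x, continuous g} ->
  {for x, continuous (fun z => f z + g z)}.
Proof. exact: cvgD. Qed.

Lemma for_continuous_sub (T : topologicalType) (f g : T -> R) (x : T) :
  {for x, continuous f} -> {for x, continuous g} ->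
  {for x, continuous (fun z => f z - g z)}.
Proof. exact: cvgB. Qed.

Lemma for_continuous_mul (T : topologicalType) (f g : T -> R) (x : T) :
  {for x, continuous f} -> {for x, continuous g} ->
  {for x, continuous (fun z => f z * g z)}.
Proof. exact: cvgM. Qed.

Lemma for_continuous_cst (T : topologicalType) (k : R) (x : T) :
  {for x, continuous (fun=> k)}.
Proof. exact: cst_continuous. Qed.

Lemma for_continuous_bigsum (T : topologicalType) (I : Type) (r : seq I)
    (F : I -> T -> R) (x : T) : (forall i, {for x, continuous (F i)}) ->
  {for x, continuous (fun z => \sum_(i <- r) F i z)}.
Proof.
move=> h; elim: r => [|i r IH].
  have -> : (fun z => \sum_(i <- [::]) F i z) = (fun=> 0).
    by apply/funext => z; rewrite big_nil.
  exact: cst_continuous.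
have -> : (fun z => \sum_(j <- i :: r) F j z) = (fun z => F i z + \sum_(j <- r) F j z).
  by apply/funext => z; rewrite big_cons.
exact: cvgD (h i) IH.
Qed.

Lemma continuous_dtest n o o' (a : E -> E) : (forall i, continuous (fun x => a x 0 i)) ->
  continuous (fun x => dtest n o o' x (a x)).
Proof.
move=> ca x.
have cd p : {for x, continuous (fun z => daug p (a z))}.
  by case: p => [i|]; [exact: ca|exact: (@cst_continuous _ _ (0 : R))].
have cA p : {for x, continuous (aug A p)} by exact: continuous_aug.
suff : {for x, continuous (fun z => dtest n o o' z (a z))} by [].
rewrite /dtest.
apply: for_continuous_add.
  apply: for_continuous_mul; last exact: continuous_cutq.
  by apply: for_continuous_add; exact: for_continuous_mul.
apply: for_continuous_mul; first exact: for_continuous_mul.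
apply: for_continuous_mul.
  apply: for_continuous_mul; first exact: for_continuous_cst.
  apply: (@continuous_comp _ _ _ (fun z => 1 - qA z / n.+1%:R) pos); last exact: continuous_pos.
  apply: for_continuous_sub; first exact: for_continuous_cst.
  apply: for_continuous_mul; last exact: for_continuous_cst.
  exact: continuous_qA.
apply: for_continuous_mul; last exact: for_continuous_cst.
apply: for_continuous_mul; first exact: for_continuous_cst.
apply: for_continuous_bigsum => i.
by apply: for_continuous_mul; [exact: (cA (Some i))|exact: ca].
Qed.

Lemma Ck1_test n o o' : Ck 1 (test n o o').
Proof.
split=> [x|k]; first exact: differentiable_test.
rewrite /= (_ : partial k _ = fun x => dtest n o o' x (delta_mx 0 k *m (DA A x)^T)); last first.
  apply/funext => x; rewrite /partial.
  by have h := is_derive_test n o o' x (delta_mx 0 k); rewrite derive_val.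
apply: continuous_dtest => i x.
have -> : (fun x => ((delta_mx 0 k : E) *m (DA A x)^T) 0 i) = (fun x => partial k A x 0 i).
  by apply/funext => z; rewrite -rowE [LHS]mxE [LHS]mxE DA_partial.
apply: continuous_entry; apply: differentiable_continuous; exact: (A3.2 k).1.
Qed.

(** The support lies in the preimage under [A] of a closed ball, that is, in the image of a compact
    set under the continuous inverse [B]. *)
Lemma compact_support_test n o o' : (exists B, [/\ cancel A B, cancel B A & Ck 3 B]) ->
  compact_support (test n o o').
Proof.
move=> [B [AB BA B3]].
pose Q := [set y : E | dot y y <= n.+1%:R].
have cB : continuous B by move=> x; apply: differentiable_continuous; exact: B3.1.
have cQ : compact Q.
  apply: bounded_closed_compact.
    exists n.+1%:R; split; first exact: num_real.
    move=> M nM y Qy.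
    have M0 : 0 <= M by rewrite (le_trans _ (ltW nM)).
    rewrite /Num.Def.normr/= mx_normrE; apply: bigmax_le => //= -[i j] _ /=.
    rewrite (ord1 i).
    have h : y 0 j ^+ 2 <= n.+1%:R.
      apply: le_trans Qy; rewrite /dot (bigD1 j)//= -expr2 lerDl.
      by apply: sumr_ge0 => k _; rewrite -expr2 sqr_ge0.
    rewrite (le_trans _ (ltW nM))// -ler_sqr ?nnegrE// real_normK ?num_real//.
    by rewrite (le_trans h)// expr2 ler_peMr// ler1n.
  have -> : Q = (fun y : E => dot y y) @^-1` [set r : R | r <= n.+1%:R] by [].
  apply: closed_comp; last exact: closed_le.
  move=> y _; apply: for_continuous_bigsum => i.
  by apply: for_continuous_mul; exact: coord_continuous.
have cBQ : compact (B @` Q) by apply: continuous_compact => //; exact: continuous_subspaceT.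
apply: (subclosed_compact _ cBQ); first exact: closed_closure.
have clBQ : closed (B @` Q) by exact: (compact_closed (@norm_hausdorff R E) cBQ).
rewrite [X in _ `<=` X]((closure_id _).1 clBQ); apply: closure_subset => x /=.
rewrite /test => h; exists (A x) => //; rewrite /Q/= leNgt; apply/negP => lt.
move/negP: h; apply; rewrite cutoff_eq0 ?mulr0// ler_pdivlMr// mul1r.
exact: ltW.
Qed.

End test_functions.

(** * From integral equations to differential equations *)

Section integral_equations.
Context {R : realType}.
Implicit Types f g : R -> R.
Local Notation leb := (@lebesgue_measure R).

Lemma hcont_segments f : (forall a : R, 0 < a -> {within `[0, a], continuous f}) -> hcont f.
Proof.
move=> h; apply/continuous_within_itvcyP; split.
  move=> x; rewrite in_itv/= andbT => x0.
  have x10 : 0 < x + 1 by lra.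
  apply: (within_continuous_continuous x10 (h _ x10)).
  by rewrite in_itv/= x0; lra.
by have /(continuous_within_itvP _ ltr01)[] := h 1 ltr01.
Qed.

(** Continuity of the indefinite integral of an integrable function; it applies to the moments
    before their right-hand sides are known to be continuous. *)
Lemma integral_hcont f g :
  (forall t : R, 0 <= t -> leb.-integrable `[0, t] (EFin \o g)) ->
  (forall t : R, 0 <= t -> f t = f 0 + \int[leb]_(s in `[0, t]) g s) -> hcont f.
Proof.
move=> ig fg; apply: hcont_segments => a a0.
have h := parameterized_integral_continuous (ltW a0) (ig a (ltW a0)).
apply: (@subspace_eq_continuous _ _ _ (fun t => f 0 + parameterized_integral leb 0 t g)).
  by move=> t; rewrite inE/= in_itv/= => /andP[t0 _]; rewrite [RHS]fg.
by move=> x; exact: (for_continuous_add (@for_continuous_cst _ _ (f 0) x) (h x)).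
Qed.

Lemma hcont_interior f (t : R) : hcont f -> 0 < t -> {for t, continuous f}.
Proof.
move=> /continuous_within_itvcyP[h _] t0; apply: h.
by rewrite in_itv/= andbT.
Qed.

Lemma integral_evolves f g :
  (forall t : R, 0 <= t -> leb.-integrable `[0, t] (EFin \o g)) ->
  (forall t : R, 0 <= t -> f t = f 0 + \int[leb]_(s in `[0, t]) g s) -> hcont g ->
  evolves f g.
Proof.
move=> ig fg cg; split; first exact: integral_hcont fg.
move=> t t0; have t1 : t < t + 1 by lra.
have [h1 h2] := continuous_FTC1_closed t1 (ig (t + 1) ltac:(lra)) t0 (hcont_interior cg t0).
have h3 : is_derive t 1 (fun x => f 0 + \int[leb]_(s in `[0, x]) g s) (g t).
  rewrite -[X in is_derive _ _ _ X]add0r; apply: is_derive_add.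
  by rewrite -h2 derive1E; exact: derivableP.
apply: (near_eq_is_derive _ h3).
near=> x; rewrite -fg//; apply: ltW; near: x; exact: lt_nbhsr.
Unshelve. all: by end_near. Qed.

End integral_equations.

Section bounds.
Context {R : realType} {d : nat}.
Local Notation E := 'rV[R]_d.
Variable A : E -> E.

Lemma qA_ge0 x : 0 <= qA A x. Proof. exact: dot_ge0. Qed.

Lemma coord_sqr_le x i : A x 0 i ^+ 2 <= qA A x.
Proof.
rewrite /qA /dot (bigD1 i)//= -expr2 lerDl.
by apply: sumr_ge0 => k _; rewrite -expr2 sqr_ge0.
Qed.

Lemma aug_le o o' x : `|aug A o x * aug A o' x| <= 1 + qA A x.
Proof.
have q0 := qA_ge0 x.
have h p : `|aug A p x| ^+ 2 <= 1 + qA A x.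
  rewrite real_normK ?num_real//; case: p => [i|]/=; last by rewrite expr1n lerDl.
  by have := coord_sqr_le x i; lra.
rewrite normrM; have := h o; have := h o'.
by have := sqr_ge0 (`|aug A o x| - `|aug A o' x|); lra.
Qed.

Variables (C : R) (m : E) (S : 'M[R]_d).
Hypothesis C0 : 0 <= C.
Hypothesis mC : forall i, `|m 0 i| <= C.
Hypothesis SC : forall i j, `|S i j| <= C.

Lemma daug_drift_le o o' x :
  `|daug o (drift A m S x) * aug A o' x| <= (1 + d%:R * C + C) * (1 + qA A x).
Proof.
have q0 := qA_ge0 x.
have d0 : 0 <= d%:R :> R by exact: ler0n.
case: o => [c|] /=; last by rewrite mul0r normr0 mulr_ge0 ?addr_ge0// mulr_ge0.
have hz p : `|aug A p x * aug A o' x| <= 1 + qA A x by exact: aug_le.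
have -> : drift A m S x 0 c * aug A o' x = aug A (Some c) x * aug A o' x -
    \sum_e S e c * (aug A (Some e) x * aug A o' x) - m 0 c * (aug A None x * aug A o' x).
  rewrite drift_entry /= mul1r !mulrBl mulr_suml.
  by congr (_ - _ - _); apply: eq_bigr => e _; ring.
rewrite (le_trans (ler_normB _ _))// mulrDl lerD//; last first.
  by rewrite normrM ler_pM.
rewrite (le_trans (ler_normB _ _))// mulrDl mul1r lerD//.
apply: (le_trans (ler_norm_sum _ _ _)).
apply: (@le_trans _ _ (\sum_(e < d) C * (1 + qA A x))).
  by apply: ler_sum => e _; rewrite normrM ler_pM.
by rewrite sumr_const card_ord -mulrA mulr_natl.
Qed.

(** Domination uniform in [n] by an integrable function. The derivative of the cutoff meets a
    product of order [(1 + qA) ^ 2], but it lives where [qA <= n + 1] and carries a factor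
    [1 / (n + 1)], so one power of [1 + qA] is replaced by the constant 2. *)
Lemma dtest_drift_le n o o' x :
  `|dtest A n o o' x (drift A m S x)| <=
  (2 + 8 * d%:R) * (1 + d%:R * C + C) * (1 + qA A x).
Proof.
have q0 := qA_ge0 x.
have d0 : 0 <= d%:R :> R by exact: ler0n.
set K := 1 + d%:R * C + C; have K0 : 0 <= K by rewrite !addr_ge0// mulr_ge0.
rewrite /dtest; set w := drift A m S x; set r := qA A x / n.+1%:R.
have n0 : 0 < n.+1%:R :> R by rewrite ltr0n.
have r0 : 0 <= r by rewrite divr_ge0.
have h1 : `|(daug o w * aug A o' x + aug A o x * daug o' w) * cutoff r| <= 2 * K * (1 + qA A x).
  rewrite normrM (ger0_norm (cutoff_ge0 _)).
  apply: (@le_trans _ _ (`|daug o w * aug A o' x + aug A o x * daug o' w| * 1)).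
    by rewrite ler_wpM2l// cutoff_le1.
  rewrite mulr1 (le_trans (ler_normD _ _))//.
  have := daug_drift_le o o' x; have := daug_drift_le o' o x.
  by rewrite -/w -/K [aug A o x * _]mulrC; lra.
have h2 : `|dot (A x) w| <= d%:R * K * (1 + qA A x).
  apply: (le_trans (ler_norm_sum _ _ _)).
  apply: (@le_trans _ _ (\sum_(e < d) K * (1 + qA A x))).
    by apply: ler_sum => e _; rewrite mulrC; exact: (daug_drift_le (Some e) (Some e)).
  by rewrite sumr_const card_ord -mulrA mulr_natl.
have h3 : pos (1 - r) * (1 + qA A x) / n.+1%:R <= 2.
  have [h|h] := leP 1 r; first by rewrite pos_eq0 ?mul0r//; lra.
  rewrite pos_id; last by lra.
  have qn : qA A x <= n.+1%:R by move: h; rewrite /r ltr_pdivrMr// mul1r => /ltW.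
  rewrite ler_pdivrMr//.
  apply: (@le_trans _ _ (1 * (1 + qA A x))).
    by rewrite ler_wpM2r ?addr_ge0//; lra.
  by have : 1 <= n.+1%:R :> R; [rewrite ler1n|lra].
have h4 : `|aug A o x * aug A o' x * (- 2 * pos (1 - r) * (2 * dot (A x) w / n.+1%:R))|
    <= 8 * d%:R * K * (1 + qA A x).
  rewrite normrM; have ha := aug_le o o' x.
  have p0 : 0 <= pos (1 - r) / n.+1%:R by rewrite divr_ge0// pos_ge0.
  have p40 : 0 <= 4 * (pos (1 - r) / n.+1%:R) by rewrite mulr_ge0.
  have -> : `|- 2 * pos (1 - r) * (2 * dot (A x) w / n.+1%:R)| =
      4 * (pos (1 - r) / n.+1%:R) * `|dot (A x) w|.
    have -> : - 2 * pos (1 - r) * (2 * dot (A x) w / n.+1%:R) =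
       - (4 * (pos (1 - r) / n.+1%:R)) * dot (A x) w by ring.
    by rewrite normrM normrN (ger0_norm p40).
  apply: (@le_trans _ _ ((1 + qA A x) * (4 * (pos (1 - r) / n.+1%:R) * (d%:R * K * (1 + qA A x))))).
    by apply: ler_pM => //; [by rewrite mulr_ge0|by rewrite ler_wpM2l].
  have -> : (1 + qA A x) * (4 * (pos (1 - r) / n.+1%:R) * (d%:R * K * (1 + qA A x))) =
     4 * (d%:R * K * (1 + qA A x)) * (pos (1 - r) * (1 + qA A x) / n.+1%:R) by ring.
  apply: (@le_trans _ _ (4 * (d%:R * K * (1 + qA A x)) * 2)); last by lra.
  by rewrite ler_wpM2l// !mulr_ge0// addr_ge0.
rewrite (le_trans (ler_normD _ _))//; lra.
Qed.

End bounds.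

Lemma dtest_cvg (R : realType) (d : nat) (A : 'rV[R]_d -> 'rV[R]_d) o o' x a :
  (fun n => dtest A n o o' x a) @ \oo -->
    daug o a * aug A o' x + aug A o x * daug o' a.
Proof.
rewrite -[X in _ --> X]addr0 -[X in _ --> X + _]mulr1.
apply: cvgD; first by apply: cvgM; [exact: cvg_cst|exact: cutoff_cvg].
rewrite -(mulr0 (aug A o x * aug A o' x)); apply: cvgM; first exact: cvg_cst.
rewrite -(mulr0 (- 2 * pos (1 - 0))); apply: cvgM.
  apply: cvgM; first exact: cvg_cst.
  apply: (@cvg_comp _ _ _ (fun n : nat => 1 - qA A x / n.+1%:R) pos \oo (nbhs (1 - 0 : R)));
    last exact: continuous_pos.
  apply: cvgB; first exact: cvg_cst.
  by rewrite -[X in _ --> X](mulr0 (qA A x)); apply: cvgM; [exact: cvg_cst|exact: cvg_harmonic].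
rewrite -(mulr0 (2 * dot (A x) a)); apply: cvgM; first exact: cvg_cst.
exact: cvg_harmonic.
Qed.

(** * Moment equations of the mean-field law *)

Section mean_field.
Context {R : realType} {d : nat}.
Local Notation E := 'rV[R]_d.
Local Notation leb := (@lebesgue_measure R).
Variables (A : E -> E) (V : E -> R) (mu0 : probability E R)
  (mu : R -> probability E R).
Hypothesis A3 : Ck 3 A.
Hypothesis A_inv : exists B, [/\ cancel A B, cancel B A & Ck 3 B].
Hypothesis oA : orientation_preserving A.
Hypothesis hV : potential_of (piA_density A) V.
Hypothesis flow : mean_field_flow V (KA2 A) mu0 mu.

Let mass1 t : mu t setT = 1%E. Proof. exact: probability_setT. Qed.

(** The velocity integrand in the coordinates [A x]. For fixed [x] it is a linear image of
    [svgd_integrand], so integrability carries over, and it is polynomial in [A y]. *)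
Definition resid (x y : E) : E := A x - (1 + dot (A x) (A y)) *: A y.

Lemma resid_integrand x y :
  resid x y = svgd_integrand V (KA2 A) x y *m (DA A x)^T.
Proof.
rewrite svgd_integrandE// -mulmxA -trmx_mul mulmxV ?DA_unit// trmx1.
by rewrite mulmx1.
Qed.

Lemma rint_resid (t : R) x c : 0 <= t -> rint (mu t) (fun y => resid x y 0 c).
Proof.
move=> t0; apply: (@rint_ext _ _ _ _ (fun y =>
  \sum_a DA A x c a * svgd_integrand V (KA2 A) x y 0 a)).
  move=> y; rewrite resid_integrand [RHS]mxE; apply: eq_bigr => a _.
  by rewrite mulrC [(DA A x)^T a c]mxE.
apply: rint_bigsum => a _; apply: rint_scale.
exact: (mff_integrable flow).
Qed.

Lemma point_preimage y : exists x, A x = y.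
Proof. by have [B [_ BA _]] := A_inv; exists (B y); rewrite BA. Qed.

Lemma resid0 x y c : A x = 0 -> resid x y 0 c = - A y 0 c.
Proof.
move=> Ax; rewrite /resid Ax /dot big1 => [|i _]; last by rewrite mxE mul0r.
by rewrite addr0 scale1r !mxE add0r.
Qed.

Lemma resid_delta x y i c : A x = delta_mx 0 i ->
  resid x y 0 c = (c == i)%:R - A y 0 c - A y 0 i * A y 0 c.
Proof.
move=> Ax; rewrite /resid Ax dotC dot_delta !mxE eqxx/=.
by rewrite mulrDl mul1r opprD addrA.
Qed.

(* Integrability of the velocity field at points where [A] is [0] or a basis
   vector already gives all second moments. *)
Lemma flow_L2 (t : R) : 0 <= t -> L2moments A (mu t).
Proof.
move=> t0.
have [x0 Ax0] := point_preimage 0.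
have h1 c : rint (mu t) (fun y => A y 0 c).
  apply: (rint_ext _ (rint_opp (rint_resid x0 c t0))) => y.
  by rewrite resid0// opprK.
have h2 i c : rint (mu t) (fun y => A y 0 i * A y 0 c).
  have [x Ax] := point_preimage (delta_mx 0 i).
  apply: (rint_ext _ (rint_sub (rint_sub (rint_cst (mass1 t) (c == i)%:R) (h1 c)) (rint_resid x
    c t0))) => y.
  by rewrite (resid_delta _ _ Ax); ring.
move=> [i|] [j|] /=.
- exact: h2.
- by apply: (rint_ext _ (h1 i)) => y; rewrite mulr1.
- by apply: (rint_ext _ (h1 j)) => y; rewrite mul1r.
- by apply: (rint_ext _ (rint_cst (mass1 t) 1)) => y; rewrite mulr1.
Qed.

Lemma entry_le_l2norm (u : E) a : `|u 0 a| <= l2norm u.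
Proof.
rewrite -ler_sqr ?nnegrE ?sqrtr_ge0// real_normK ?num_real// l2norm_row.
by rewrite /dot (bigD1 a)//= -expr2 lerDl; apply: sumr_ge0 => k _; rewrite -expr2 sqr_ge0.
Qed.

Lemma resid_bound x (T : R) : exists2 C : R, 0 <= C & forall (t : R) c, 0 <= t <= T ->
  \int[mu t]_y `|resid x y 0 c| <= C.
Proof.
have [M HM] := mff_locally_bounded flow x T.
pose D := \sum_c \sum_a `|DA A x c a|.
have D0 : 0 <= D by apply: sumr_ge0 => c _; apply: sumr_ge0 => a _.
exists (D * `|M|); first by rewrite mulr_ge0.
move=> t c tT; have t0 : 0 <= t by case/andP: tT.
pose N y := l2norm (svgd_integrand V (KA2 A) x y).
have N0 y : 0 <= N y by exact: sqrtr_ge0.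
have mN : measurable_fun setT N.
  apply: (measurableT_comp (f := @Num.sqrt R)).
    by apply: continuous_measurable_fun; exact: sqrt_continuous.
  apply: measurable_sum => i; apply: measurable_sum => j.
  rewrite (ord1 i); apply: measurable_funX.
  exact: (rint_measurable (mff_integrable flow x j t0)).
have iN : rint (mu t) N.
  apply/integrableP; split; first exact/measurable_EFinP.
  under eq_integral do rewrite /= ger0_norm//.
  by apply: le_lt_trans (HM t tT) _; rewrite ltry.
have NM : \int[mu t]_y N y <= `|M|.
  have := HM t tT; rewrite -[X in (X <= _)%E](fineK (integrable_fin_num measurableT iN)) lee_fin.
  by move=> h; apply: (le_trans h); exact: ler_norm.
apply: (@le_trans _ _ (\int[mu t]_y (D * N y))).
  apply: Rint_le.
  - by apply: rint_norm; exact: rint_resid.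
  - exact: rint_scale.
  - move=> y; rewrite resid_integrand mxE (le_trans (ler_norm_sum _ _ _))//.
    apply: (@le_trans _ _ (\sum_a `|DA A x c a| * N y)).
      apply: ler_sum => a _; rewrite normrM mulrC mxE ler_wpM2l//.
      exact: entry_le_l2norm.
    rewrite -mulr_suml ler_wpM2r// /D [leRHS](bigD1 c)//= lerDl.
    by apply: sumr_ge0 => k _; apply: sumr_ge0.
by rewrite Rint_scale// ler_wpM2l.
Qed.

(** Same evaluation points as in [flow_L2], now with bounds uniform over [[0, T]]: [A x = 0] gives
    first moments, and [A x] a basis vector gives products of coordinates up to terms already
    bounded. *)
Lemma moment_bound (T : R) : exists2 C : R, 0 <= C & forall (t : R) o o', 0 <= t <= T ->
  \int[mu t]_y `|aug A o y * aug A o' y| <= C.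
Proof.
have [x0 Ax0] := point_preimage 0.
have [C0 C00 h0] := resid_bound x0 T.
have hi i : exists C : R, 0 <= C /\ forall (t : R) c, 0 <= t <= T ->
    \int[mu t]_y `|A y 0 i * A y 0 c| <= C.
  have [x Ax] := point_preimage (delta_mx 0 i).
  have [C1 C10 h1] := resid_bound x T.
  exists (1 + C0 + C1); split; first by rewrite !addr_ge0.
  move=> t c tT; have t0 : 0 <= t by case/andP: tT.
  have L2 := flow_L2 t0.
  have i0 := rint_norm (rint_resid x0 c t0); have i1 := rint_norm (rint_resid x c t0).
  have ic := rint_cst (mass1 t) 1.
  apply: (@le_trans _ _ (\int[mu t]_y (1 + `|resid x0 y 0 c| + `|resid x y 0 c|))).
    apply: Rint_le.
    - by apply: rint_norm; exact: rint_prod.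
    - by apply: rint_add => //; exact: rint_add.
    - move=> y; rewrite resid0// normrN (resid_delta _ _ Ax).
      set a := A y 0 i * _; set b := A y 0 c; set k := _%:R : R.
      have -> : a = k - b - (k - b - a) by ring.
      rewrite (le_trans (ler_normB _ _))// lerD//; last first.
        by have -> : k - b - (k - b - (k - b - a)) = k - b - a by ring.
      rewrite (le_trans (ler_normB _ _))// lerD// /k.
      by case: (c == i); rewrite ?normr1 ?normr0.
  rewrite Rint_add//; last exact: rint_add.
  rewrite Rint_add// (Rint_cst (mass1 t)) lerD//; last exact: h1.
  by rewrite lerD2l; exact: h0.
have [F HF] := choice hi.
exists (1 + C0 + \sum_i F i).
  by rewrite !addr_ge0//; apply: sumr_ge0 => i _; exact: (HF i).1.
have sF : 0 <= \sum_i F i by apply: sumr_ge0 => i _; exact: (HF i).1.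
move=> t o o' tT; have t0 : 0 <= t by case/andP: tT.
have h1 c : \int[mu t]_y `|A y 0 c| <= C0.
  apply: le_trans (h0 t c tT); rewrite le_eqVlt; apply/orP; left; apply/eqP.
  by apply: eq_Rintegral => y _; rewrite resid0// normrN.
case: o o' => [i|] [j|] /=.
- apply: (le_trans ((HF i).2 t j tT)); rewrite (bigD1 i)//= addrCA lerDl.
  by rewrite !addr_ge0//; apply: sumr_ge0 => k _; exact: (HF k).1.
- under eq_Rintegral do rewrite mulr1.
  by apply: (le_trans (h1 i)); lra.
- under eq_Rintegral do rewrite mul1r.
  by apply: (le_trans (h1 j)); lra.
- under eq_Rintegral do rewrite mulr1 normr1.
  by rewrite (Rint_cst (mass1 t)); lra.
Qed.

Let m t := mean_mx A (mu t).
Let S t := second_moment_mx A (mu t).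

Lemma augmom_bound (T : R) : exists2 C : R, 0 <= C &
  forall t : R, 0 <= t <= T -> [/\ forall i, `|m t 0 i| <= C,
    forall i j, `|S t i j| <= C & \int[mu t]_x qA A x <= d%:R * C].
Proof.
have [C C0 h] := moment_bound T; exists C => // t tT.
have t0 : 0 <= t by case/andP: tT.
have hG o o' : `|augmom A (mu t) o o'| <= C.
  apply: le_trans (h t o o' tT); apply: le_normr_Rintegral => //.
  exact: (flow_L2 t0 o o').
split=> [i|i j|].
- by rewrite mean_augmom.
- by rewrite second_augmom.
- rewrite /qA /dot Rint_bigsum; last by move=> i _; exact: (rint_prod (flow_L2 t0) i i).
  apply: (@le_trans _ _ (\sum_(i < d) C)); last by rewrite sumr_const card_ord mulr_natl.
  by apply: ler_sum => i _; apply: le_trans (ler_norm _) (hG (Some i) (Some i)).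
Qed.

Definition gen_moment t o o' : R :=
  \int[mu t]_x (daug o (drift A (m t) (S t) x) * aug A o' x +
                aug A o x * daug o' (drift A (m t) (S t) x)).

Lemma rint_qA (t : R) : 0 <= t -> rint (mu t) (qA A).
Proof.
by move=> t0; apply: rint_bigsum => i _; exact: (rint_prod (flow_L2 t0) i i).
Qed.

Lemma velocity_test n o o' (t : R) x : 0 <= t ->
  dot (grad (test A n o o') x) (svgd_velocity V (KA2 A) (mu t) x) =
  dtest A n o o' x (drift A (m t) (S t) x).
Proof.
move=> t0; rewrite dot_grad_test// (svgd_velocityE (mass1 t) (flow_L2 t0) A3 oA x hV).
by rewrite -mulmxA -trmx_mul mulmxV ?DA_unit// trmx1 mulmx1.
Qed.

Lemma measurable_dtest n o o' p q :
  measurable_fun setT (fun x => dtest A n o o' x (drift A p q x)).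
Proof.
apply: rV_continuous_measurable; apply: continuous_dtest => // i x.
have -> : (fun x => drift A p q x 0 i) =
    (fun x => A x 0 i - \sum_k A x 0 k * q k i - p 0 i).
  by apply/funext => y; rewrite /drift !mxE.
have cA k : {for x, continuous (fun x => A x 0 k)} by exact: (@continuous_aug _ _ A A3 (Some k) x).
suff : {for x, continuous (fun x => A x 0 i - \sum_k A x 0 k * q k i - p 0 i)} by [].
apply: for_continuous_sub; last exact: for_continuous_cst.
apply: for_continuous_sub; first exact: cA.
apply: for_continuous_bigsum => k; apply: for_continuous_mul => //.
exact: for_continuous_cst.
Qed.

(** Dominated convergence in space as the cutoff is removed. The uniform [K] then serves as
    dominating constant for the integral in time. *)
Lemma gen_moment_cvg (T : R) o o' : exists2 K : R, 0 <= K & forall t : R, 0 <= t <= T ->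
  (forall n, `|\int[mu t]_x dot (grad (test A n o o') x) (svgd_velocity V (KA2 A) (mu t) x)| <=
    K) /\
  (fun n => \int[mu t]_x dot (grad (test A n o o') x) (svgd_velocity V (KA2 A) (mu t) x))
    @ \oo --> gen_moment t o o'.
Proof.
have [C C0 hC] := augmom_bound T.
set k := (2 + 8 * d%:R) * (1 + d%:R * C + C).
have k0 : 0 <= k by rewrite mulr_ge0// !addr_ge0// mulr_ge0.
exists (k * (1 + d%:R * C)); first by rewrite mulr_ge0// addr_ge0// mulr_ge0.
move=> t tT; have t0 : 0 <= t by case/andP: tT.
have [mC SC qC] := hC t tT.
have ig : rint (mu t) (fun x => k * (1 + qA A x)).
  by apply: rint_scale; apply: rint_add; [exact: (rint_cst (mass1 t))|exact: rint_qA].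
have bnd n x : `|dtest A n o o' x (drift A (m t) (S t) x)| <= k * (1 + qA A x).
  exact: dtest_drift_le.
have e n : \int[mu t]_x dot (grad (test A n o o') x) (svgd_velocity V (KA2 A) (mu t) x) =
    \int[mu t]_x dtest A n o o' x (drift A (m t) (S t) x).
  by apply: eq_Rintegral => x _; exact: velocity_test.
have [_ cv] := @Rintegral_dct _ _ _ (mu t) setT
  (fun n x => dtest A n o o' x (drift A (m t) (S t) x)) _ _ measurableT
  (fun n => measurable_dtest n o o' (m t) (S t)) ig (fun x _ => @dtest_cvg _ _ A o o' x _)
  (fun n x _ => bnd n x).
split=> [n|].
  rewrite e; apply: (@le_trans _ _ (\int[mu t]_x (k * (1 + qA A x)))).
    apply: Rint_norm_le => //.
    exact: (rint_le (measurable_dtest n o o' (m t) (S t)) ig (bnd n)).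
  rewrite Rint_scale; last by apply: rint_add; [exact: (rint_cst (mass1 t))|exact: rint_qA].
  rewrite ler_wpM2l// Rint_add; [|exact: (rint_cst (mass1 t))|exact: rint_qA].
  by rewrite (Rint_cst (mass1 t)) lerD2l.
by under eq_fun do rewrite e.
Qed.

(** Limit of the weak formulation along [test n]: the boundary terms are dominated by
    [|aug o * aug o'|], the time integral by the constant of [gen_moment_cvg]. *)
Lemma augmom_integral (t : R) o o' : 0 <= t ->
  leb.-integrable `[0, t] (EFin \o (fun s => gen_moment s o o')) /\
  augmom A (mu t) o o' = augmom A (mu 0) o o' +
    \int[leb]_(s in `[0, t]) gen_moment s o o'.
Proof.
move=> t0; have [K K0 HK] := gen_moment_cvg t o o'.
pose h n s := \int[mu s]_x dot (grad (test A n o o') x) (svgd_velocity V (KA2 A) (mu s) x).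
have c1 n : Ck 1 (test A n o o') by exact: Ck1_test.
have c2 n : compact_support (test A n o o') by exact: compact_support_test.
have ih n : leb.-integrable `[0, t] (EFin \o h n).
  exact: (mff_time_integrable flow (c1 n) (c2 n) t0).
have mI : measurable (`[0, t]%classic : set R) by exact: measurable_itv.
have iK : leb.-integrable `[0, t] (EFin \o (fun=> K)).
  apply: measurable_bounded_integrable => //.
    by rewrite /= lebesgue_measure_itv/=; case: ifP => _ //; rewrite -EFinD ltry.
  exact: bounded_cst.
have [i1 cv] := @Rintegral_dct _ _ _ leb `[0, t]%classic h _ _ mI
  (fun n => (measurable_EFinP _ _).1 (measurable_int _ (ih n))) iK
  (fun s hs => (HK s hs).2) (fun n s hs => (HK s hs).1 n).
split=> //.
have lim_test (s : R) : 0 <= s -> (fun n =>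
  \int[mu s]_x test A n o o' x) @ \oo --> augmom A (mu s) o o'.
  move=> s0.
  have [] := @Rintegral_dct _ _ _ (mu s) setT (fun n => test A n o o')
     (fun x => aug A o x * aug A o' x) (fun x => `|aug A o x * aug A o' x|) measurableT.
  - move=> n; apply: rV_continuous_measurable => x.
    by apply: differentiable_continuous; exact: differentiable_test.
  - by apply: rint_norm; exact: (flow_L2 s0).
  - move=> x _; rewrite -[X in _ --> X]mulr1; apply: cvgM; first exact: cvg_cst.
    exact: cutoff_cvg.
  - move=> n x _; rewrite /test normrM (ger0_norm (cutoff_ge0 _)) ler_piMr//.
    by rewrite cutoff_le1// divr_ge0// qA_ge0.
  - by [].
have weak n : \int[mu t]_x test A n o o' x = \int[mu 0]_x test A n o o' x +
    \int[leb]_(s in `[0, t]) h n s.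
  exact: (mff_weak flow (c1 n) (c2 n) t0).
have cv2 : (fun n => \int[mu 0]_x test A n o o' x + \int[leb]_(s in `[0, t]) h n s)
    @ \oo --> augmom A (mu 0) o o' + \int[leb]_(s in `[0, t]) gen_moment s o o'.
  by apply: cvgD; [exact: lim_test|exact: cv].
have cv1 := lim_test t t0.
rewrite (_ : (fun n => \int[mu t]_x test A n o o' x) = (fun n =>
  \int[mu 0]_x test A n o o' x + \int[leb]_(s in `[0, t]) h n s)) in cv1; last exact/funext.
by rewrite -(cvg_lim (@Rhausdorff R) cv1) -(cvg_lim (@Rhausdorff R) cv2).
Qed.

Lemma gen_momentE (t : R) o o' : 0 <= t ->
  gen_moment t o o' = drift_moment A (mu t) o o' + drift_moment A (mu t) o' o.
Proof. by move=> t0; apply: drift_moments_int; exact: flow_L2. Qed.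

Lemma hcont_augmom o o' : hcont (fun t => augmom A (mu t) o o').
Proof.
apply: (@integral_hcont _ _ (fun s => gen_moment s o o')) => t t0.
  exact: (augmom_integral o o' t0).1.
exact: (augmom_integral o o' t0).2.
Qed.

Lemma hcont_eq (f g : R -> R) : (forall t : R, 0 <= t -> f t = g t) -> hcont f -> hcont g.
Proof.
move=> fg cf; apply: (@subspace_eq_continuous _ _ _ f) => // t.
by rewrite inE/= in_itv/= andbT; exact: fg.
Qed.

Lemma hcont_drift_moment o o' : hcont (fun t => drift_moment A (mu t) o o').
Proof.
case: o => [c|] /=; last exact: hcont_cst.
have -> : (fun t => drift_moment A (mu t) (Some c) o') = (fun t =>
    augmom A (mu t) (Some c) o' +
    (- 1 * (\sum_e augmom A (mu t) (Some e) (Some c) * augmom A (mu t) (Some e) o') +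
    - 1 * (augmom A (mu t) (Some c) None * augmom A (mu t) None o'))).
  apply/funext => t; rewrite /drift_moment mean_augmom !mulN1r addrA.
  by congr (_ - _ - _); apply: eq_bigr => e _; rewrite second_augmom.
apply: hcont_add; first exact: hcont_augmom.
apply: hcont_add; apply: hcont_mul; try exact: hcont_cst.
  by apply: hcont_bigsum => e; apply: hcont_mul; exact: hcont_augmom.
by apply: hcont_mul; exact: hcont_augmom.
Qed.

(** Bootstrap: the integral equation makes the moments continuous, hence also its right-hand side, a
    polynomial in them; the fundamental theorem of calculus then yields the derivative. *)
Lemma augmom_evolves o o' :
  evolves (fun t => augmom A (mu t) o o')
    (fun t => drift_moment A (mu t) o o' + drift_moment A (mu t) o' o).
Proof.
apply: (@evolves_eq _ _ (fun s => gen_moment s o o')) => [t /ltW t0|].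
  exact: gen_momentE.
apply: integral_evolves => [t t0|t t0|].
- exact: (augmom_integral o o' t0).1.
- exact: (augmom_integral o o' t0).2.
- apply: (@hcont_eq (fun t => drift_moment A (mu t) o o' + drift_moment A (mu t) o' o)).
    by move=> t t0; rewrite gen_momentE.
  by apply: hcont_add; exact: hcont_drift_moment.
Qed.

Theorem mean_field_moment_flow :
  moment_flow (fun t => mean_mx A (mu t)) (fun t => second_moment_mx A (mu t)).
Proof.
apply: moment_flow_of_augmom => [t|t t0|o o']; first exact: mass1.
- exact: flow_L2.
- exact: augmom_evolves.
Qed.

End mean_field.

(** * Moments of particle systems *)


Section empirical_integral.
Context d (T : measurableType d) (R : realType) (N : nat) (x : 'I_N -> T).
Hypothesis N0 : (0 < N)%N.

Let NR0 : 0 < N%:R :> R. Proof. by rewrite ltr0n. Qed.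

Lemma empirical_mass : empirical R x setT = 1%E.
Proof.
rewrite /empirical; under eq_bigr do rewrite diracT.
rewrite sumEFin sumr_const card_ord -EFinM mulVf ?gt_eqF//.
Qed.

Lemma empirical_integral_ge0 (f : T -> R) : measurable_fun setT f ->
  (forall z, 0 <= f z) ->
  (\int[empirical R x]_z (f z)%:E = (N%:R^-1 * \sum_i f (x i))%:E)%E.
Proof.
move=> mf f0.
(* Finite sums of measures are indexed by [nat], so the points are extended beyond [N]; the default
   point lies outside the summation range. *)
pose y (k : nat) : T := if insub k is Some i then x i else x (Ordinal N0).
have yx (i : 'I_N) : y i = x i by rewrite /y valK.
have kge0 : 0 <= N%:R^-1 :> R by rewrite invr_ge0.
pose k := NngNum kge0.
pose ms : nat -> {measure set T -> \bar R} := fun j => dirac (y j).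
rewrite (@eq_measure_integral _ _ _ setT (mscale k (msum ms N))); last first.
  move=> B mB _; rewrite /= /mscale /msum /empirical; congr (_ * _)%E.
  by apply: eq_bigr => i _; rewrite /= yx.
rewrite ge0_integral_mscale//=; last 2 first.
- exact/measurable_EFinP.
- by move=> z _; rewrite lee_fin.
rewrite ge0_integral_measure_sum//=; last 2 first.
- by move=> z _; rewrite lee_fin.
- exact/measurable_EFinP.
rewrite EFinM -sumEFin; congr (_ * _)%E; apply: eq_bigr => i _.
rewrite integral_dirac//; last exact/measurable_EFinP.
by rewrite diracT mul1e yx.
Qed.

Lemma empirical_rint (f : T -> R) : measurable_fun setT f ->
  rint (empirical R x) f /\
  \int[empirical R x]_z f z = N%:R^-1 * \sum_i f (x i).
Proof.
move=> mf.
have ge (g : T -> R) : measurable_fun setT g -> (forall z, 0 <= g z) -> rint (empirical R x) g /\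
    \int[empirical R x]_z g z = N%:R^-1 * \sum_i g (x i).
  move=> mg g0; have e := empirical_integral_ge0 mg g0; split.
    apply/integrableP; split; first exact/measurable_EFinP.
    by under eq_integral do rewrite /= ger0_norm//; rewrite e ltry.
  by rewrite /Rintegral e.
have mn : measurable_fun setT (fun z => `|f z|) by exact: measurableT_comp.
(* A signed [f] is the difference of the nonnegative functions [|f| + f] and [|f|]. *)
have [i1 e1] := ge (fun z => `|f z| + f z) (measurable_funD mn mf)
  (fun z => ltac:(by rewrite -lerBlDr sub0r -normrN ler_norm)).
have [i2 e2] := ge _ mn (fun z => normr_ge0 (f z)).
split.
  by apply: (rint_ext _ (rint_sub i1 i2)) => z; ring.
transitivity (\int[empirical R x]_z ((`|f z| + f z) - `|f z|)).
  by apply: eq_Rintegral => z _; ring.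
by rewrite Rint_sub// e1 e2 -mulrBr -sumrB; congr (_ * _); apply: eq_bigr => i _; ring.
Qed.

End empirical_integral.

Section particles.
Context {R : realType} {d : nat}.
Local Notation E := 'rV[R]_d.
Variables (A : E -> E) (V : E -> R) (N : nat) (x : 'I_N -> R -> E).
Hypothesis A3 : Ck 3 A.
Hypothesis oA : orientation_preserving A.
Hypothesis hV : potential_of (piA_density A) V.
Hypothesis N0 : (0 < N)%N.
Hypothesis flow : particle_flow V (KA2 A) x.

Let rho (t : R) : {measure set E -> \bar R} := empirical R (fun j => x j t).

Let mass1 t : rho t setT = 1%E. Proof. exact: empirical_mass. Qed.

Lemma measurable_aug2 o o' : measurable_fun setT (fun z => aug A o z * aug A o' z).
Proof.
by apply: rV_continuous_measurable => z; apply: for_continuous_mul; exact: continuous_aug.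
Qed.

Lemma empirical_L2 t : L2moments A (rho t).
Proof. by move=> o o'; exact: (empirical_rint _ N0 (measurable_aug2 o o')).1. Qed.

Lemma empirical_augmom t o o' :
  augmom A (rho t) o o' = N%:R^-1 * \sum_i aug A o (x i t) * aug A o' (x i t).
Proof. exact: (empirical_rint _ N0 (measurable_aug2 o o')).2. Qed.

Let w t z := drift A (mean_mx A (rho t)) (second_moment_mx A (rho t)) z.

(** Chain rule: the derivative of [A] along the particle multiplies its velocity by [DA], which
    removes the factor [invDA]. *)
Lemma is_derive_A_particle i (t : R) c : 0 < t ->
  is_derive t 1 (fun s => A (x i s) 0 c) (w t (x i t) 0 c).
Proof.
move=> t0; have hx := (flow i).2 t t0.
have dx : differentiable (x i) t by apply/derivable1_diffP; case: hx.
have dA : differentiable A (x i t) by exact: A3.1.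
have dc : differentiable (A \o x i) t by exact: differentiable_comp.
have h : is_derive t 1 (fun s => A (x i s) 0 c) (('D_1 (A \o x i) t) 0 c) :=
  @is_derive_entry R R 1 d (A \o x i) t 1 0 c dc.
apply: is_derive_eq.
have -> : 'D_1 (A \o x i) t = 'D_('D_1 (x i) t) A (x i t).
  by rewrite [LHS]deriveE// diff_comp//= [RHS]deriveE// [X in _ = 'd A _ X]deriveE.
rewrite (@derive_val _ _ _ _ _ _ _ hx) deriveEjacobian//.
rewrite (svgd_velocityE (mass1 t) (@empirical_L2 t) A3 oA _ hV) -mulmxA.
rewrite -[jacobian A _]trmxK -trmx_mul mulmxV ?trmx1 ?mulmx1//.
exact: DA_unit.
Qed.

Lemma hcont_aug_particle i o : hcont (fun s => aug A o (x i s)).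
Proof.
move=> s; have cx := (flow i).1.
apply: (@continuous_comp _ _ _ (x i : subspace _ -> E) (aug A o)); first exact: cx.
exact: continuous_aug.
Qed.

Lemma aug_particle_evolves i o :
  evolves (fun s => aug A o (x i s)) (fun t => daug o (w t (x i t))).
Proof.
split=> [|t t0]; first exact: hcont_aug_particle.
by case: o => [c|]; [exact: is_derive_A_particle|exact: is_derive_cst].
Qed.

Theorem particle_moment_flow :
  moment_flow (fun t => mean_mx A (rho t)) (fun t => second_moment_mx A (rho t)).
Proof.
apply: moment_flow_of_augmom => [t|t t0|o o']; first exact: mass1.
  exact: empirical_L2.
have -> : (fun t => augmom A (rho t) o o') =
    (fun t => N%:R^-1 * \sum_i aug A o (x i t) * aug A o' (x i t)).
  by apply/funext => t; rewrite empirical_augmom.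
have := evolves_scale (N%:R^-1 : R) (evolves_bigsum (index_enum 'I_N) xpredT
  (fun i => evolves_mul (aug_particle_evolves i o) (aug_particle_evolves i o'))).
apply: evolves_eq => t t0; rewrite -drift_moments_int; last exact: empirical_L2.
rewrite (empirical_rint (fun j => x j t) N0 _).2//.
apply: rV_continuous_measurable => z.
have ca p : {for z, continuous (aug A p)} by exact: continuous_aug.
have cd p : {for z, continuous (fun y => daug p (w t y))}.
  case: p => [c|]; last exact: (@cst_continuous _ _ (0 : R)).
  have -> : (fun y => daug (Some c) (w t y)) = (fun y => A y 0 c -
      \sum_k A y 0 k * second_moment_mx A (rho t) k c - mean_mx A (rho t) 0 c).
    by apply/funext => y; rewrite /= drift_entry.
  apply: for_continuous_sub; last exact: for_continuous_cst.
  apply: for_continuous_sub; first exact: (ca (Some c)).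
  apply: for_continuous_bigsum => k; apply: for_continuous_mul; last exact: for_continuous_cst.
  exact: (ca (Some k)).
suff : {for z, continuous (fun y =>
  daug o (w t y) * aug A o' y + aug A o y * daug o' (w t y))} by [].
by apply: for_continuous_add; apply: for_continuous_mul.
Qed.

End particles.

(** * Initial fluctuations *)


Lemma eq_measure_rint d (T : measurableType d) (R : realType)
    (m1 m2 : {measure set T -> \bar R}) (f : T -> R) :
  (forall B, measurable B -> m1 B = m2 B) -> rint m1 f -> rint m2 f.
Proof.
move=> m12 /integrableP[mf h]; apply/integrableP; split=> //.
by rewrite (eq_measure_integral m1)// => B mB _; rewrite m12.
Qed.

Lemma eq_measure_Rintegral d (T : measurableType d) (R : realType)
    (m1 m2 : {measure set T -> \bar R}) (f : T -> R) :
  (forall B, measurable B -> m1 B = m2 B) -> \int[m1]_x f x = \int[m2]_x f x.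
Proof.
by move=> m12; rewrite /Rintegral (eq_measure_integral m2)// => B mB _; exact: m12.
Qed.

Section law.
Context d d' (Omega : measurableType d) (T : measurableType d') (R : realType).
Variables (P : probability Omega R) (mu : probability T R).

Lemma rint_law (X : Omega -> T) (f : T -> R) : measurable_fun setT X ->
  has_law P X mu -> rint mu f ->
  rint P (f \o X) /\ \int[P]_w f (X w) = \int[mu]_x f x.
Proof.
move=> mX lX rf; have mf := rint_measurable rf.
pose pX : {mfun Omega >-> T} := HB.pack X (isMeasurableFun.Build _ _ _ _ _ mX).
pose nu : probability T R := distribution P pX.
have nuE B : measurable B -> mu B = nu B by move=> mB; rewrite -lX.
have i1 : rint P (f \o X).
  apply/integrableP; split; first by apply/measurable_EFinP; exact: measurableT_comp.
  have mabs : measurable_fun setT (fun x => `|(f x)%:E|%E).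
    by apply: measurableT_comp => //; exact/measurable_EFinP.
  have := @ge0_integral_pushforward _ _ _ _ R X mX P setT (fun x =>
    `|(f x)%:E|%E) measurableT mabs (fun _ _ => abse_ge0 _).
  rewrite preimage_setT => e.
  have -> : (\int[P]_x `|(EFin \o (f \o X)) x| = \int[nu]_x `|(f x)%:E|)%E by rewrite [RHS]e.
  rewrite (eq_measure_integral mu); last by move=> B mB _; exact/esym/nuE.
  by have /integrableP[] := rf.
split=> //; rewrite (eq_measure_Rintegral _ nuE) /Rintegral; congr fine.
rewrite -[LHS]/(\int[P]_(x in X @^-1` setT) ((EFin \o f) \o X) x)%E -(@integral_pushforward _ _
  _ _ R X mX)//.
exact/measurable_EFinP.
Qed.

(** The joint law agrees with the product measure on rectangles, hence everywhere; Fubini's theorem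
    then factors the integral. *)
Lemma independent_product (X Y : Omega -> T) (f g : T -> R) :
  measurable_fun setT X -> measurable_fun setT Y ->
  (forall B C, measurable B -> measurable C ->
    P (X @^-1` B `&` Y @^-1` C) = (mu B * mu C)%E) ->
  rint mu f -> rint mu g ->
  rint P (fun w => f (X w) * g (Y w)) ->
  \int[P]_w (f (X w) * g (Y w)) = (\int[mu]_x f x) * (\int[mu]_x g x).
Proof.
move=> mX mY ind rf rg rfg.
have mf := rint_measurable rf; have mg := rint_measurable rg.
pose XY w := (X w, Y w).
have mXY : measurable_fun setT XY by exact: measurable_fun_pair.
pose pXY : {mfun Omega >-> (T * T)%type} := HB.pack XY (isMeasurableFun.Build _ _ _ _ _ mXY).
pose nu : probability (T * T)%type R := distribution P pXY.
pose h (z : T * T) := f z.1 * g z.2.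
have mh : measurable_fun setT h.
  by apply: measurable_funM; apply: measurableT_comp.
have mhE : measurable_fun setT (EFin \o h) by exact/measurable_EFinP.
have nuE B : measurable B -> (mu \x mu)%E B = nu B.
  apply: product_measure_unique => C D mC mD; rewrite /= -ind//.
have i1 : rint nu h by exact: (@integrable_pushforward _ _ _ _ R XY mXY P setT (EFin \o h) mhE).
have i2 : rint (mu \x mu)%E h.
  by apply: (@eq_measure_rint _ _ _ nu) => // B mB; exact/esym/nuE.
transitivity (\int[nu]_z h z).
  rewrite /Rintegral; congr fine.
  by rewrite [RHS](@integral_pushforward _ _ _ _ R XY mXY P setT (EFin \o h)).
have e x : fubini_F mu (EFin \o h) x = ((\int[mu]_y g y) * f x)%:E.
  rewrite /fubini_F; transitivity (\int[mu]_y ((f x)%:E * (g y)%:E))%E.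
    by apply: eq_integral => y _.
  by rewrite integralZl// -[X in (_ * X)%E](fineK (integrable_fin_num measurableT rg)) -EFinM mulrC.
rewrite -(eq_measure_Rintegral _ nuE) {1}/Rintegral -(integral12_prod_meas1 i2).
under eq_integral do rewrite e.
by rewrite -[LHS]/(\int[mu]_x (_ * f x)) Rint_scale// mulrC.
Qed.

End law.

(** Expanding the square of the centred mean, independence kills the off-diagonal terms; the [N]
    diagonal ones are variances, at most the second moment. *)
Lemma iid_mean_variance d d' (Omega : measurableType d) (T : measurableType d')
    (R : realType) (P : probability Omega R) (mu : probability T R) (N : nat)
    (X : 'I_N -> Omega -> T) (f : T -> R) :
  (0 < N)%N -> iid P X mu -> measurable_fun setT f -> rint mu (fun x => f x ^+ 2) ->
  let dev w := N%:R^-1 * \sum_i f (X i w) - \int[mu]_x f x in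
  rint P (fun w => dev w ^+ 2) /\
  \int[P]_w (dev w ^+ 2) <= N%:R^-1 * \int[mu]_x (f x ^+ 2).
Proof.
move=> N0 [mX indX lawX] mf rf2 dev.
have NR0 : N%:R != 0 :> R by rewrite pnatr_eq0 -lt0n.
have mass : mu setT = 1%E := probability_setT mu.
have rc k : rint mu (fun=> k) by exact: rint_cst.
have rf : rint mu f.
  apply: (rint_le mf (rint_add (rc 1) rf2)) => x.
  rewrite ler_norml; have := sqr_ge0 (f x - 1); have := sqr_ge0 (f x + 1).
  by move=> h1 h2; apply/andP; split; nra.
set c := \int[mu]_x f x in dev *.
pose g x := f x - c.
have rg : rint mu g by exact: rint_sub.
have g0 : \int[mu]_x g x = 0 by rewrite Rint_sub// Rint_cst// subrr.
have mg := rint_measurable rg.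
have rg2' : rint mu (fun x => f x ^+ 2 - (2 * c) * f x + c ^+ 2).
  by apply: rint_add => //; apply: rint_sub => //; exact: rint_scale.
have rg2 : rint mu (fun x => g x ^+ 2).
  by apply: (rint_ext _ rg2') => x; rewrite /g; ring.
have vg : \int[mu]_x (g x ^+ 2) <= \int[mu]_x (f x ^+ 2).
  have -> : \int[mu]_x (g x ^+ 2) = \int[mu]_x (f x ^+ 2 - (2 * c) * f x + c ^+ 2).
    by apply: eq_Rintegral => x _; rewrite /g; ring.
  have rcf := rint_scale (2 * c) rf.
  rewrite Rint_add//; last exact: rint_sub.
  rewrite Rint_sub// Rint_scale// Rint_cst// -/c.
  by have := sqr_ge0 c; lra.
have ind i j : i != j -> forall B C, measurable B -> measurable C ->
    P (X i @^-1` B `&` X j @^-1` C) = (mu B * mu C)%E.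
  move=> ij B C mB mC.
  have := indX [set i; j]%SET (fun k => if k == i then B else C).
  rewrite big_setU1 ?inE//= big_set1 eqxx eq_sym (negPf ij) => h.
  have e : \bigcap_(k in [set` [set i; j]%SET]) (X k @^-1` (if k == i then B else C)) =
      X i @^-1` B `&` X j @^-1` C.
    apply/seteqP; split=> w /=.
      move=> H; split; first by have := H i; rewrite /= !inE eqxx; exact.
      by have := H j; rewrite /= !inE eqxx orbT eq_sym (negPf ij); exact.
    move=> [Hi Hj] k /=; rewrite !inE => /orP[|] /eqP ->; first by rewrite eqxx.
    by rewrite eq_sym (negPf ij).
  rewrite -e h; last by move=> k; case: ifP.
  by rewrite -(lawX i B mB) -(lawX j C mC).
have rgX i : rint P (fun w => g (X i w) ^+ 2).
  exact: (rint_law (mX i) (lawX i) rg2).1.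
have mgX i : measurable_fun setT (fun w => g (X i w)) by exact: measurableT_comp.
have rgg i j : rint P (fun w => g (X i w) * g (X j w)).
  apply: (rint_le _ (rint_add (rgX i) (rgX j))); first exact: measurable_funM.
  move=> w; rewrite ler_norml.
  have := sqr_ge0 (g (X i w) - g (X j w)); have := sqr_ge0 (g (X i w) + g (X j w)).
  have := sqr_ge0 (g (X i w)); have := sqr_ge0 (g (X j w)).
  by move: (g _) (g _) => a b h1 h2 h3 h4; apply/andP; split; lra.
have igg i j : \int[P]_w (g (X i w) * g (X j w)) =
    if i == j then \int[mu]_x (g x ^+ 2) else 0.
  case: eqVneq => [->|ij].
    under eq_Rintegral do rewrite -expr2.
    exact: (rint_law (mX j) (lawX j) rg2).2.
  by rewrite (independent_product (mX i) (mX j) (ind i j ij) rg rg (rgg i j)) g0 mul0r.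
have devE w : dev w ^+ 2 = N%:R^-1 ^+ 2 * \sum_i \sum_j (g (X i w) * g (X j w)).
  have -> : dev w = N%:R^-1 * \sum_i g (X i w).
    rewrite /dev /g sumrB sumr_const card_ord mulrBr; congr (_ - _).
    by rewrite -[c *+ N]mulr_natl mulKf.
  rewrite exprMn [X in _ * X]expr2 mulr_suml; congr (_ * _).
  by apply: eq_bigr => i _; rewrite mulr_sumr.
have rS : rint P (fun w => \sum_i \sum_j (g (X i w) * g (X j w))).
  by apply: rint_bigsum => i _; apply: rint_bigsum => j _; exact: rgg.
split.
  by apply: (rint_ext _ (rint_scale (N%:R^-1 ^+ 2) rS)) => w; rewrite devE.
under eq_Rintegral do rewrite devE.
rewrite Rint_scale// Rint_bigsum; last by move=> i _; apply: rint_bigsum => j _; exact: rgg.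
have -> : \sum_i \int[P]_w \sum_j (g (X i w) * g (X j w)) =
    N%:R * \int[mu]_x (g x ^+ 2).
  rewrite -[N in RHS]card_ord mulr_natl -sumr_const; apply: eq_bigr => i _.
  rewrite Rint_bigsum; last by move=> j _; exact: rgg.
  rewrite (bigD1 i)//= igg eqxx big1 ?addr0// => j ji.
  by rewrite igg eq_sym (negPf ji).
by rewrite expr2 -mulrA mulKf// ler_wpM2l// invr_ge0.
Qed.

Section ae_bound.
Import HBNNSimple.


(** Meant for a supremum over uncountably many times, for which measurability is unknown. The
    integral of a nonnegative function is the supremum over the simple functions below it, and each
    of these is almost everywhere at most [g]. *)
Lemma ae_le_integral_bound d (T : measurableType d) (R : realType)
    (mu : {measure set T -> \bar R}) (f : T -> \bar R) (g : T -> R) :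
  (forall x, 0 <= f x)%E -> (forall x, 0 <= g x) -> rint mu g ->
  {ae mu, forall x, (f x <= (g x)%:E)%E} ->
  (\int[mu]_x f x <= (\int[mu]_x g x)%:E)%E.
Proof.
move=> f0 g0 rg fg; rewrite ge0_integralTE//.
apply: ge_ereal_sup => _ /= [h hf <-].
rewrite -integralT_nnsfun /Rintegral (fineK (integrable_fin_num measurableT rg)).
apply: ae_ge0_le_integral => //.
- by move=> x _; rewrite lee_fin; exact: fun_ge0.
- exact/measurable_EFinP.
- by move=> x _; rewrite lee_fin.
- by apply/measurable_EFinP; exact: rint_measurable rg.
- by apply: filterS fg => x fgx _; exact: le_trans (hf x) fgx.
Qed.

End ae_bound.

(** * Consequences of the exponential moment *)

Section initial_moments.
Context {R : realType} {d : nat}.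
Local Notation E := 'rV[R]_d.
Variables (A : E -> E) (mu0 : probability E R) (alpha Ealpha : R).
Hypothesis A3 : Ck 3 A.
Hypothesis alpha0 : 0 < alpha.
Hypothesis expm :
  'E_mu0[fun x => expR (alpha * l2norm (A x) ^+ 2)]%E = Ealpha%:E.

Let e x := expR (alpha * qA A x).

Lemma rint_exp : rint mu0 e /\ \int[mu0]_x e x = Ealpha.
Proof.
have E1 : (\int[mu0]_x (e x)%:E)%E = Ealpha%:E.
  rewrite -expm unlock; apply: eq_integral => x _.
  by rewrite /e /qA l2norm_row.
have me : measurable_fun setT e.
  apply: rV_continuous_measurable => x.
  apply: (@continuous_comp _ _ _ (fun y => alpha * qA A y) expR); last exact: continuous_expR.
  apply: for_continuous_mul; first exact: for_continuous_cst.
  exact: continuous_qA.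
split; last by rewrite /Rintegral E1.
apply/integrableP; split; first exact/measurable_EFinP.
by under eq_integral do rewrite /= ger0_norm ?expR_ge0//; rewrite E1 ltry.
Qed.

Lemma exp_qA_ge x : alpha * qA A x <= e x.
Proof. by apply: le_trans (expR_ge1Dx _); rewrite lerDr. Qed.

Lemma exp_qA_sqr_ge x : alpha ^+ 2 / 2 * qA A x ^+ 2 <= e x.
Proof.
have q0 : 0 <= alpha * qA A x by rewrite mulr_ge0 ?qA_ge0// ltW.
apply: le_trans (expR_ge1Dxn 1 q0).
by rewrite exprMn mulrAC lerDr.
Qed.

Lemma measurable_qA : measurable_fun setT (qA A).
Proof. by apply: rV_continuous_measurable; exact: continuous_qA. Qed.

Lemma qA_moment : rint mu0 (qA A) /\ \int[mu0]_x qA A x <= `|Ealpha| / alpha.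
Proof.
have [re Ee] := rint_exp.
have b x : qA A x <= alpha^-1 * e x.
  by rewrite ler_pdivlMl//; exact: exp_qA_ge.
have rq : rint mu0 (qA A).
  apply: (rint_le measurable_qA (rint_scale alpha^-1 re)) => x.
  by rewrite ger0_norm ?qA_ge0.
split=> //; apply: (@le_trans _ _ (\int[mu0]_x (alpha^-1 * e x))).
  by apply: Rint_le => //; exact: rint_scale.
by rewrite Rint_scale// Ee mulrC ler_wpM2r ?invr_ge0 ?(ltW alpha0)// ler_norm.
Qed.

(** From [z ^ 2 / 2 <= exp z]. These fourth moments of [A] control the fluctuations of the empirical
    second moments. *)
Lemma qA_sqr_moment : rint mu0 (fun x => qA A x ^+ 2) /\
  \int[mu0]_x (qA A x ^+ 2) <= 2 * `|Ealpha| / alpha ^+ 2.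
Proof.
have [re Ee] := rint_exp.
have a20 : 0 < alpha ^+ 2 / 2 by rewrite divr_gt0// exprn_gt0.
have b x : qA A x ^+ 2 <= (alpha ^+ 2 / 2)^-1 * e x.
  by rewrite ler_pdivlMl//; exact: exp_qA_sqr_ge.
have rq : rint mu0 (fun x => qA A x ^+ 2).
  apply: (rint_le _ (rint_scale (alpha ^+ 2 / 2)^-1 re)) => [|x].
    by apply: measurable_funX; exact: measurable_qA.
  by rewrite ger0_norm ?sqr_ge0.
split=> //; apply: (@le_trans _ _ (\int[mu0]_x ((alpha ^+ 2 / 2)^-1 * e x))).
  by apply: Rint_le => //; exact: rint_scale.
rewrite Rint_scale// Ee invf_div mulrAC.
by rewrite ler_wpM2r ?invr_ge0 ?sqr_ge0// ler_wpM2l// ler_norm.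
Qed.

Lemma rint_coord_sqr i : rint mu0 (fun x => A x 0 i ^+ 2) /\
  \int[mu0]_x (A x 0 i ^+ 2) <= `|Ealpha| / alpha.
Proof.
have [rq bq] := qA_moment.
have r : rint mu0 (fun x => A x 0 i ^+ 2).
  apply: (rint_le _ rq) => [|x]; last by rewrite ger0_norm ?sqr_ge0// coord_sqr_le.
  apply: measurable_funX; apply: rV_continuous_measurable.
  exact: (@continuous_aug _ _ A A3 (Some i)).
split=> //; apply: le_trans bq; apply: Rint_le => // x; exact: coord_sqr_le.
Qed.

Lemma measurable_prod i j : measurable_fun setT (fun x => A x 0 i * A x 0 j).
Proof. exact: (measurable_aug2 A3 (Some i) (Some j)). Qed.

Lemma rint_prod_sqr i j : rint mu0 (fun x => (A x 0 i * A x 0 j) ^+ 2) /\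
  \int[mu0]_x ((A x 0 i * A x 0 j) ^+ 2) <= 2 * `|Ealpha| / alpha ^+ 2.
Proof.
have [rq bq] := qA_sqr_moment.
have b x : (A x 0 i * A x 0 j) ^+ 2 <= qA A x ^+ 2.
  by rewrite exprMn [leRHS]expr2 ler_pM ?sqr_ge0// coord_sqr_le.
have r : rint mu0 (fun x => (A x 0 i * A x 0 j) ^+ 2).
  apply: (rint_le _ rq) => [|x]; last by rewrite ger0_norm ?sqr_ge0.
  by apply: measurable_funX; exact: measurable_prod.
by split=> //; apply: le_trans bq; exact: Rint_le.
Qed.

Lemma initial_L2 : L2moments A mu0.
Proof.
move=> o o'; have [rq _] := qA_moment.
apply: (rint_le (measurable_aug2 A3 o o') (rint_add (rint_cst (probability_setT mu0) 1) rq)) => x.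
exact: aug_le.
Qed.

Lemma trace_initial : \tr (second_moment_mx A mu0) <= `|Ealpha| / alpha.
Proof.
have [_ bq] := qA_moment; apply: le_trans bq.
rewrite /qA /dot Rint_bigsum; last by move=> i _; exact: (initial_L2 (Some i) (Some i)).
by rewrite le_eqVlt; apply/orP; left; apply/eqP; apply: eq_bigr => i _; rewrite mxE.
Qed.

Lemma covmxE : covmx mu0 A =
  second_moment_mx A mu0 - (mean_mx A mu0)^T *m mean_mx A mu0.
Proof.
apply/matrixP => i j; rewrite [LHS]mxE unlock.
have mass : mu0 setT = 1%E := probability_setT mu0.
have r1 k := rint_coord initial_L2 k; have r2 := rint_prod initial_L2 i j.
have Ek k : fine ('E_mu0[(fun x =>
  A x (0 : 'I_1)%R k)%R])%E = mean_mx A mu0 0 k by rewrite unlock mxE.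
transitivity (\int[mu0]_x ((A x 0 i - mean_mx A mu0 0 i) * (A x 0 j - mean_mx A mu0 0 j))).
  by rewrite -!Ek unlock.
set a := mean_mx A mu0 0 i; set b := mean_mx A mu0 0 j.
transitivity (\int[mu0]_x (A x 0 i * A x 0 j - (b * A x 0 i + a * A x 0 j) + a * b)).
  by apply: eq_Rintegral => x _; ring.
have r3 := rint_scale b (r1 i); have r4 := rint_scale a (r1 j).
have r5 := rint_add r3 r4.
rewrite Rint_add; [|exact: rint_sub|exact: rint_cst].
rewrite Rint_cst// Rint_sub// Rint_add// !Rint_scale//.
have -> : \int[mu0]_x A x 0 i = a by rewrite /a mxE.
have -> : \int[mu0]_x A x 0 j = b by rewrite /b mxE.
rewrite [RHS]mxE [X in _ = X + _]mxE [X in _ = _ + X]mxE [X in _ = _ - X]mxE big_ord1.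
by rewrite [X in _ = _ - X * _]mxE -/a -/b; ring.
Qed.

Lemma cov_coercive (c0 : R) : loewner_le (c0%:M) (covmx mu0 A) ->
  coercive c0 (second_moment_mx A mu0 - (mean_mx A mu0)^T *m mean_mx A mu0).
Proof.
move=> h u; have := h u; rewrite dot_mulmx bf_add bf_opp covmxE subr_ge0.
apply: le_trans; rewrite le_eqVlt; apply/orP; left; apply/eqP.
by rewrite /bf mul_mx_scalar -scalemxAl mxE dotE.
Qed.

End initial_moments.

Lemma sqF_subC (R : realType) p q (B C : 'M[R]_(p, q)) : sqF (B - C) = sqF (C - B).
Proof.
by apply: eq_bigr => i _; apply: eq_bigr => j _; rewrite !mxE -sqrrN opprB.
Qed.

(** The measures are exchanged on the right so that the mean-field moments come first:
    [flow_stability] asks for coercivity of its first flow. *)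
Lemma dA2_sqr (R : realType) d (A : 'rV[R]_d -> 'rV[R]_d)
    (rho nu : {measure set 'rV[R]_d -> \bar R}) :
  dA2 A rho nu ^+ 2 =
  moment_dist (mean_mx A nu) (mean_mx A rho) (second_moment_mx A nu) (second_moment_mx A rho).
Proof.
rewrite /dA2 sqr_sqrtr; last by rewrite addr_ge0// sqr_ge0.
by rewrite !l2norm_sqr /moment_dist [in RHS]sqF_subC [X in _ = _ + X]sqF_subC.
Qed.

Theorem corollary5p12 (R : realType) (d : nat) (c0 alpha Ealpha : R) :
  (0 < d)%N -> 0 < c0 -> 0 < alpha ->
  exists C : R,
  forall (A : 'rV[R]_d -> 'rV[R]_d) (V : 'rV[R]_d -> R)
         (mu0 : probability 'rV[R]_d R) (mu : R -> probability 'rV[R]_d R)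
         (disp : measure_display) (Omega : measurableType disp)
         (P : probability Omega R) (N : nat)
         (X : 'I_N -> R -> Omega -> 'rV[R]_d),
  Ck_diffeomorphism 3 A -> orientation_preserving A ->
  potential_of (piA_density A) V ->
  'E_mu0[fun x => expR (alpha * l2norm (A x) ^+ 2)]%E = Ealpha%:E ->
  loewner_le (c0%:M) (covmx mu0 A) ->
  (0 < N)%N ->
  iid P (fun i => X i 0) mu0 ->
  (forall i t, 0 <= t -> measurable_fun setT (X i t)) ->
  {ae P, forall w, particle_flow V (KA2 A) (fun i t => X i t w)} ->
  mean_field_flow V (KA2 A) mu0 mu ->
  (\int[P]_w ereal_sup
      [set ((dA2 A (empirical R (fun i => X i t w)) (mu t)) ^+ 2)%:E
        | t in `[0%R, +oo[ ]
    <= (C / N%:R)%:E)%E.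
Proof.
move=> _ c00 alpha0.
(* The constants are fixed before any law is given, so the sign of [Ealpha] is not yet known; hence
   the absolute value. *)
have M0 : 0 <= `|Ealpha| / alpha by rewrite divr_ge0// ltW.
have [L L0 HL] := @flow_stability R d c0 (`|Ealpha| / alpha) c00 M0.
(* Stability constant times the sum of the second-moment bounds: [d] coordinates, each contributing
   at most [|Ealpha| / alpha], and [d ^ 2] products, each contributing at most
   [2 |Ealpha| / alpha ^+ 2]. *)
exists (L * (d%:R * (`|Ealpha| / alpha) + d%:R * (d%:R * (2 * `|Ealpha| / alpha ^+ 2)))).
move=> A V mu0 mu disp Omega P N X [A3 A_inv] oA hV expm cov N0 hiid _ hpart hmf.
pose devm i w := N%:R^-1 * \sum_k A (X k 0 w) 0 i - \int[mu0]_x A x 0 i.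
pose devS i j w := N%:R^-1 * \sum_k (A (X k 0 w) 0 i * A (X k 0 w) 0 j) -
  \int[mu0]_x (A x 0 i * A x 0 j).
pose D w := \sum_i devm i w ^+ 2 + \sum_i \sum_j devS i j w ^+ 2.
have hm i := iid_mean_variance N0 hiid
  (rV_continuous_measurable (@continuous_aug _ _ A A3 (Some i)))
  (rint_coord_sqr A3 alpha0 expm i).1.
have hS i j := iid_mean_variance N0 hiid (measurable_prod A3 i j)
  (rint_prod_sqr A3 alpha0 expm i j).1.
have rm : rint P (fun w => \sum_i devm i w ^+ 2).
  by apply: rint_bigsum => i _; exact: (hm i).1.
have rSj i : rint P (fun w => \sum_j devS i j w ^+ 2).
  by apply: rint_bigsum => j _; exact: (hS i j).1.
have rS : rint P (fun w => \sum_i \sum_j devS i j w ^+ 2).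
  by apply: rint_bigsum => i _; exact: rSj.
have rD : rint P D by exact: rint_add.
have D0 w : 0 <= D w.
  apply: addr_ge0; first by apply: sumr_ge0 => i _; exact: sqr_ge0.
  by apply: sumr_ge0 => i _; apply: sumr_ge0 => j _; exact: sqr_ge0.
have NV : 0 <= N%:R^-1 :> R by rewrite invr_ge0.
have ED : \int[P]_w D w <= (d%:R * (`|Ealpha| / alpha) +
    d%:R * (d%:R * (2 * `|Ealpha| / alpha ^+ 2))) / N%:R.
  rewrite /D Rint_add// mulrDl lerD//.
    rewrite Rint_bigsum; last by move=> i _; exact: (hm i).1.
    apply: (@le_trans _ _ (\sum_(i < d) N%:R^-1 * (`|Ealpha| / alpha))).
      apply: ler_sum => i _; apply: (le_trans (hm i).2); rewrite ler_wpM2l//.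
      exact: (rint_coord_sqr A3 alpha0 expm i).2.
    by rewrite sumr_const card_ord -[_ *+ d]mulr_natl mulrCA mulrC.
  rewrite Rint_bigsum; last by move=> i _; exact: rSj.
  apply: (@le_trans _ _ (\sum_(i < d) \sum_(j < d) N%:R^-1 * (2 * `|Ealpha| / alpha ^+ 2))).
    apply: ler_sum => i _; rewrite Rint_bigsum; last by move=> j _; exact: (hS i j).1.
    apply: ler_sum => j _; apply: (le_trans (hS i j).2); rewrite ler_wpM2l//.
    exact: (rint_prod_sqr A3 alpha0 expm i j).2.
  rewrite !sumr_const !card_ord; move: (2 * _ / _) => c.
  by rewrite -[_ *+ d *+ d]mulr_natl -[_ *+ d]mulr_natl le_eqVlt; apply/orP; left; apply/eqP; ring.
apply: (@le_trans _ _ (\int[P]_w (L * D w))%:E); last first.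
  by rewrite lee_fin Rint_scale// -mulrA ler_wpM2l.
have mu0E B : measurable B -> mu 0 B = mu0 B by exact: (mff_init hmf).
have mean0 : mean_mx A (mu 0) = mean_mx A mu0.
  by apply/rowP => i; rewrite !mxE; exact: eq_measure_Rintegral.
have second0 : second_moment_mx A (mu 0) = second_moment_mx A mu0.
  by apply/matrixP => i j; rewrite !mxE; exact: eq_measure_Rintegral.
have mff := mean_field_moment_flow A3 A_inv oA hV hmf.
apply: ae_le_integral_bound.
(* Time 0 belongs to the index set, so the supremum dominates a nonnegative value. *)
- move=> w; apply: ereal_sup_ge; exists ((dA2 A (empirical R (fun i => X i 0 w)) (mu 0)) ^+ 2)%:E.
    by exists 0 => //=; rewrite in_itv/= lexx.
  by rewrite lee_fin sqr_ge0.
- by move=> w; rewrite mulr_ge0.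
- exact: rint_scale.
- apply: filterS hpart => w hw; apply: ge_ereal_sup => _ /= [t + <-].
  rewrite in_itv/= andbT => t0; rewrite lee_fin dA2_sqr.
  have pf := particle_moment_flow A3 oA hV N0 hw.
  apply: (le_trans (HL _ _ _ _ mff pf _ _ t t0)).
  + by rewrite mean0 second0; exact: (cov_coercive A3 alpha0 expm).
  + by rewrite second0; exact: (trace_initial A3 alpha0 expm).
  rewrite ler_wpM2l// le_eqVlt; apply/orP; left; apply/eqP.
  have eg o o' : augmom A (empirical R (fun i => X i 0 w)) o o' =
      N%:R^-1 * \sum_k aug A o (X k 0 w) * aug A o' (X k 0 w).
    exact: (@empirical_augmom _ _ A N (fun i t => X i t w) A3 N0 0 o o').
  rewrite /moment_dist /D mean0 second0 sqF_subC [X in _ + X]sqF_subC; congr (_ + _).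
    rewrite /sqF big_ord1; apply: eq_bigr => i _; congr (_ ^+ 2).
    rewrite mxE [X in _ + X]mxE mean_augmom eg [X in _ - X]mxE.
    by congr (_ * _ - _); apply: eq_bigr => k _; rewrite mulr1.
  apply: eq_bigr => i _; apply: eq_bigr => j _; congr (_ ^+ 2).
  by rewrite mxE [X in _ + X]mxE second_augmom eg [X in _ - X]mxE.
Qed.
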